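(* Let the process $X$ satisfy $dX_t=\alpha_t\,dt+\sigma_{t-}\,dS_t+dY_t$ and Assumption A (both recalled in the context), let $k_n\propto n^q$ for some $q\in(0,1)$ and $m_n\to\infty$ as $n\to\infty$. Let $X^*_{i/n}=X_{i/n}+\varepsilon_{i/n}$, $i=0,1,\ldots,n$, where the $\varepsilon_{i/n}$ are i.i.d. random variables defined on a product extension of the original probability space and independent from $\mathcal F$. Let $\widehat F_n(\tau)$ be the statistic defined in the context, constructed from the noisy increments $\Delta_i^nX^*=X^*_{i/n}-X^*_{(i-1)/n}$. Suppose that $\mathbb E|\varepsilon_{i/n}|^{1+\iota}<\infty$ for some $\iota>0$. Denote $$\mu=\sqrt{\frac\pi2}\sqrt{\mathbb E\bigl(|\varepsilon_{i/n}-\varepsilon_{(i-1)/n}|\,|\varepsilon_{(i-1)/n}-\varepsilon_{(i-2)/n}|\bigr)},$$ and assume that the c.d.f. $F_\varepsilon(\tau)$ of $\frac1\mu(\varepsilon_{i/n}-\varepsilon_{(i-1)/n})$ is continuous. Then $$\widehat F_n(\tau)\ \stackrel{\mathbb P}{\longrightarrow}\ F_\varepsilon(\tau)\qquad\text{as }n\to\infty,$$ where the convergence is uniform in $\tau$ over compact subsets of $\mathbb R$ (that is, $\sup_{\tau\in\mathcal A}|\widehat F_n(\tau)-F_\varepsilon(\tau)|\to0$ in probability for every compact $\mathcal A\subset\mathbb R$).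
   Context: **Model.** On a filtered probability space $(\Omega,\mathcal F,(\mathcal F_t)_{t\ge0},\mathbb P)$ the process $X$ satisfies, for $t\in[0,1]$, $$dX_t=\alpha_t\,dt+\sigma_{t-}\,dS_t+dY_t,$$ where $\alpha_t,\sigma_t,Y_t$ are adapted processes with càdlàg paths, $Y_t$ is an Itô semimartingale of pure-jump type (zero second characteristic), and $S_t$ is a stable Lévy process with characteristic function $$\log\mathbb E(e^{iuS_t})=-t|cu|^\beta\bigl(1-i\gamma\,\mathrm{sign}(u)\Psi\bigr),\qquad \Psi=\tan(\pi\beta/2)\ \text{if }\beta\ne1,\quad \Psi=-\tfrac2\pi\log|u|\ \text{if }\beta=1,$$ with $\beta\in(0,2]$, $\gamma\in[-1,1]$ and scale constant $c>0$. $Y$ may be dependent on $S,\alpha,\sigma$. **Assumption A.** $X$ satisfies $dX_t=\alpha_t\,dt+\sigma_{t-}\,dS_t+dY_t$ and: A1. $|\sigma_t|^{-1}$ and $|\sigma_{t-}|^{-1}$ are (finite and) strictly positive on $[0,1]$, i.e. $\sigma_t$ and $\sigma_{t-}$ do not vanish. Further, there is a sequence of stopping times $T_p$ increasing to infinity and, for each $p$, a bounded process $\sigma^{(p)}_t$ with $t<T_p\Rightarrow\sigma_t=\sigma^{(p)}_t$, and a constant $K_p>0$, such that $\mathbb E(|\sigma^{(p)}_t-\sigma^{(p)}_s|^2\mid\mathcal F_s)\le K_p|t-s|$ for all $0\le s\le t\le1$. A2. There is a sequence of stopping times $T_p$ increasing to infinity and, for each $p$, a process $Y^{(p)}_t$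 with $t<T_p\Rightarrow Y_t=Y^{(p)}_t$, and a constant $K_p>0$, such that $\mathbb E(|Y^{(p)}_t-Y^{(p)}_s|^{r}\mid\mathcal F_s)\le K_p|t-s|$ for all $0\le s\le t\le1$ and every $r>\beta'$, where $\beta'<\beta$. **Noise.** The common distribution of the $\varepsilon_{i/n}$ does not depend on $n$. **Statistic (built from $X^*$).** $k_n$ and $m_n$ are deterministic sequences of positive integers with $m_n\le k_n$. For $j=1,\ldots,\lfloor n/k_n\rfloor$, $$\widehat V_j^n=\frac\pi2\frac{n}{k_n-1}\sum_{i=(j-1)k_n+2}^{jk_n}|\Delta_{i-1}^nX^*||\Delta_i^nX^*|,$$ and for $i=(j-1)k_n+1,\ldots,jk_n$, $$\widehat V_j^n(i)=\frac{k_n-1}{k_n-3}\widehat V_j^n-\frac\pi2\frac{n}{k_n-3}\,D_i,$$ where $D_i=|\Delta_i^nX^*||\Delta_{i+1}^nX^*|$ if $i=(j-1)k_n+1$; $D_i=|\Delta_{i-1}^nX^*||\Delta_i^nX^*|+|\Delta_i^nX^*||\Delta_{i+1}^nX^*|$ if $(j-1)k_n+2\le i\le jk_n-1$; and $D_i=|\Delta_{i-1}^nX^*||\Delta_i^nX^*|$ if $i=jk_n$. Fix constants $\alpha>0$ (not to be confused with the process $\alpha_t$) and $\varpi\in(0,1/2)$. Put $$N^n(\alpha,\varpi)=\sum_{j=1}^{\lfloor n/k_n\rfloor}\sum_{i=(j-1)k_n+1}^{(j-1)k_n+m_n}1\Bigl(|\Delta_i^nX^*|\le\alpha\sqrt{\widehat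 V_j^n}\,n^{-\varpi}\Bigr),$$ $$\widehat F_n(\tau)=\frac1{N^n(\alpha,\varpi)}\sum_{j=1}^{\lfloor n/k_n\rfloor}\sum_{i=(j-1)k_n+1}^{(j-1)k_n+m_n}1\Bigl\{\frac{\sqrt n\,\Delta_i^nX^*}{\sqrt{\widehat V_j^n(i)}}\le\tau\Bigr\}\,1\Bigl\{|\Delta_i^nX^*|\le\alpha\sqrt{\widehat V_j^n}\,n^{-\varpi}\Bigr\}.$$ *)

(* Defs.v *)
(* MathComp-Analysis, over an abstract [R : realType]. *)
From HB Require Import structures.
From mathcomp Require Import all_boot all_order all_algebra.
From mathcomp Require Import complex.
From mathcomp Require Import all_classical all_reals all_analysis measurable_realfun.

Set Implicit Arguments.
Unset Strict Implicit.
Unset Printing Implicit Defensive.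

Import Order.TTheory GRing.Theory Num.Theory.
Import numFieldNormedType.Exports.

Local Open Scope classical_set_scope.
Local Open Scope ring_scope.

(* Processes are functions [Z : R -> T -> R], [Z t w]; only times [0 <= t]
   matter. *)

Section paths.
Context {R : realType}.
Implicit Types f : R -> R.

Definition cadlag f : Prop :=
  (forall t : R, 0 <= t -> f s @[s --> t^'+] --> f t) /\
  (forall t : R, 0 < t -> cvg (f s @[s --> t^'-])).

(* [f (0-) = f 0]: there is no jump at time 0. *)
Definition left_limit f (t : R) : R :=
  if 0 < t then lim (f s @[s --> t^'-]) else f 0.

Definition jump f (t : R) : R := f t - left_limit f t.

End paths.

Section stochastic_basis.
Context {R : realType} {d : measure_display} {T : measurableType d}.
Variable P : probability T R.
Implicit Types (F : R -> set (set T)) (Z H M N S : R -> T -> R).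

Definition filtration F : Prop :=
  [/\ forall t : R, 0 <= t -> sigma_algebra [set: T] (F t),
      forall t : R, 0 <= t -> F t `<=` measurable &
      forall s t : R, 0 <= s -> s <= t -> F s `<=` F t].

Definition right_limit_filtration F : R -> set (set T) :=
  fun t => [set A | forall s, t < s -> F s A].

Definition sub_measurable {d' : measure_display} {U : measurableType d'}
    (G : set (set T)) (X : T -> U) : Prop :=
  forall B : set U, measurable B -> G (X @^-1` B).

Definition adapted F Z : Prop := forall t : R, 0 <= t -> sub_measurable (F t) (Z t).

Definition cadlag_paths Z : Prop := forall w, cadlag (fun t => Z t w).

Definition random_process Z : Prop :=
  forall t : R, 0 <= t -> measurable_fun [set: T] (Z t).

Definition stopping_time F (tau : T -> \bar R) : Prop :=
  (forall w, (0%:E <= tau w)%E) /\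
  (forall t : R, 0 <= t -> F t [set w | (tau w <= t%:E)%E]).

(* The sigma-algebra of events prior to a finite stopping time. *)
Definition stopped_sigma F (tau : T -> R) : set (set T) :=
  [set A | forall t : R, 0 <= t -> F t (A `&` [set w | tau w <= t])].

Definition localizing_sequence F (tau : nat -> T -> \bar R) : Prop :=
  [/\ forall p, stopping_time F (tau p),
      {ae P, forall w, forall p, (tau p w <= tau p.+1 w)%E} &
      {ae P, forall w, tau p w @[p --> \oo] --> +oo%E}].

(* [Z] is a version of [E(X | G)], for [X] nonnegative or integrable. *)
Definition cond_expectation (G : set (set T)) (X Z : T -> \bar R) : Prop :=
  sub_measurable G Z /\
  (forall A, G A -> (\int[P]_(w in A) Z w = \int[P]_(w in A) X w)%E).

Definition martingale F M : Prop :=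
  [/\ adapted F M,
      forall t : R, 0 <= t -> P.-integrable [set: T] (EFin \o M t) &
      forall s t : R, 0 <= s -> s <= t ->
        cond_expectation (F s) (EFin \o M t) (EFin \o M s)].

Definition stopped M (tau : T -> \bar R) : R -> T -> R :=
  fun t w => M (fine (Order.min t%:E (tau w))) w.

Definition local_martingale F M : Prop :=
  [/\ adapted F M, cadlag_paths M &
      exists2 tau : nat -> T -> \bar R, localizing_sequence F tau &
        forall p, martingale F (stopped M (tau p))].

Definition continuous_local_martingale F N : Prop :=
  local_martingale F N /\
  (forall w, {within `[0, +oo[, continuous (fun t => N t w)}).

(* Orthogonality to all continuous local martingales, i.e. the continuous
   martingale part vanishes. *)
Definition purely_discontinuous F M : Prop :=
  [/\ local_martingale F M, forall w, M 0 w = 0 &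
      forall N, continuous_local_martingale F N ->
        local_martingale F (fun t w => M t w * N t w)].

(* Uniform convergence on compact time intervals, in probability. *)
Definition ucp (Zn : nat -> R -> T -> R) Z : Prop :=
  forall t e : R, 0 <= t -> 0 < e ->
    P [set w | exists2 s : R, 0 <= s <= t & e < `|Zn n s w - Z s w| ]
      @[n --> \oo] --> 0%E.

(* The data of the simple integrand
   [init 1_{0} + \sum_(i < len) val_i 1_(]time_i, time_(i+1)])]. *)
Record simple_integrand := SimpleIntegrand {
  si_len : nat;
  si_init : T -> R;
  si_time : nat -> T -> R;
  si_val : nat -> T -> R }.

Definition simple_predictable F (h : simple_integrand) : Prop :=
  [/\ sub_measurable (F 0) (si_init h),
      forall w, si_time h 0 w = 0,
      forall i w, si_time h i w <= si_time h i.+1 w,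
      forall i, stopping_time F (EFin \o si_time h i) &
      forall i, sub_measurable (stopped_sigma F (si_time h i)) (si_val h i)].

Definition simple_process (h : simple_integrand) : R -> T -> R :=
  fun t w => (t == 0)%R%:R * si_init h w +
    \sum_(i < si_len h)
      (si_time h i w < t <= si_time h i.+1 w)%R%:R * si_val h i w.

Definition simple_integral (h : simple_integrand) S : R -> T -> R :=
  fun t w => si_init h w * S 0 w +
    \sum_(i < si_len h) si_val h i w *
      (S (Num.min t (si_time h i.+1 w)) w - S (Num.min t (si_time h i w)) w).

(* [Z] is the stochastic integral of [H] (adapted, left-continuous with right
   limits) with respect to the semimartingale [S], defined by ucp-continuous
   extension from the simple predictable integrands; the limit does not depend
   on the approximating sequence.  The filtration is not assumed
   right-continuous; simple integrands are taken for its right-limit filtration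
   (the same filtration under the usual conditions), for which they are
   ucp-dense and a Levy process remains a Levy process. *)
Definition stochastic_integral F H S Z : Prop :=
  [/\ random_process Z, cadlag_paths Z &
      exists h : nat -> simple_integrand,
        [/\ forall n, simple_predictable (right_limit_filtration F) (h n),
            ucp (fun n => simple_process (h n)) H &
            ucp (fun n => simple_integral (h n) S) Z]].

Definition time_domain : set (T * R) := [set p | 0 <= p.2].

Definition predictable_sigma F : set (set (T * R)) :=
  <<s time_domain,
    [set C | exists2 A, F 0 A & C = A `*` [set 0]] `|`
    [set C | exists A s t,
       [/\ 0 <= s, s < t, F s A & C = A `*` `]s, t] ] ] >>.

Definition predictable {d' : measure_display} {U : measurableType d'}
    F (g : R -> T -> U) : Prop :=
  forall B : set U, measurable B ->
    predictable_sigma F (time_domain `&` [set p | B (g p.2 p.1)]).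

(* The product of the predictable and the Borel sigma-algebras. *)
Definition predictable_borel_sigma F : set (set ((T * R) * R)) :=
  <<s time_domain `*` [set: R],
    [set E | exists C B,
       [/\ predictable_sigma F C, measurable B & E = C `*` B] ] >>.

Definition predictable_field F (W : T -> R -> R -> \bar R) : Prop :=
  forall B : set (\bar R), measurable B ->
    predictable_borel_sigma F
      ((time_domain `*` [set: R]) `&` [set p | B (W p.1.1 p.1.2 p.2)]).

(* [dt nu_t(dx)] is the compensator of the jump measure of [Y]. *)
Definition jump_compensator F (Y : R -> T -> R)
    (nu : R -> T -> {measure set (measurableTypeR R) -> \bar R}) : Prop :=
  (forall B : set (measurableTypeR R), measurable B ->
     predictable F (fun s w => nu s w B)) /\
  (forall W : T -> R -> R -> \bar R,
     (forall w s x, (0%:E <= W w s x)%E) -> predictable_field F W ->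
     ((\int[P]_w
         \esum_(s in [set s | (0 < s)%R /\ jump (fun t => Y t w) s != 0%R])
           W w s (jump (fun t => Y t w) s))
      = \int[P]_w \int[lebesgue_measure]_(s in `[0%R, +oo[)
          \int[nu s w]_x W w s x)%E).

(* [Y_t] minus the sum of its jumps of size larger than 1 up to time [t]; there
   are finitely many of them. *)
Definition remove_large_jumps (Y : R -> T -> R) : R -> T -> R :=
  fun t w => Y t w -
    \sum_(s \in [set s | 0 < s <= t /\ 1 < `|jump (fun u => Y u w) s| ])
      jump (fun u => Y u w) s.

(* A semimartingale with characteristics
   [(\int_0^t b_s ds, 0, dt nu_t(dx))] relative to the truncation function
   [x 1_{|x| <= 1}].  The second characteristic is the quadratic variation of the
   continuous martingale part, so it is zero iff the local martingale part of
   the truncated process is purely discontinuous. *)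
Definition pure_jump_ito_semimartingale F (Y : R -> T -> R) : Prop :=
  [/\ adapted F Y, cadlag_paths Y &
      exists (b : R -> T -> R)
             (nu : R -> T -> {measure set (measurableTypeR R) -> \bar R}),
        [/\ predictable F b,
            (forall (t : R) w, 0 <= t ->
               lebesgue_measure.-integrable `[0, t] (fun s => (b s w)%:E)),
            (forall (t : R) w, 0 <= t -> nu t w [set 0] = 0%E),
            (forall (t : R) w, 0 <= t ->
               (\int[lebesgue_measure]_(s in `[0%R, t])
                  \int[nu s w]_x (Num.min (x ^+ 2) 1)%:E < +oo)%E) &
            jump_compensator F Y nu /\
            purely_discontinuous F (fun t w =>
              remove_large_jumps Y t w - Y 0 w -
              \int[lebesgue_measure]_(s in `[0, t]) b s w)] ].

End stochastic_basis.

Section stable_levy.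
Context {R : realType} {d : measure_display} {T : measurableType d}.
Variable P : probability T R.
Local Open Scope complex_scope.

Definition cexp (z : R[i]) : R[i] :=
  (expR (complex.Re z))%:C * (cos (complex.Im z) +i* sin (complex.Im z)).

(* [E(exp(i u X))] *)
Definition char_fun (X : T -> R) (u : R) : R[i] :=
  fine ('E_P[fun w => (cos (u * X w))%R])%E +i* fine ('E_P[fun w => (sin (u * X w))%R])%E.

Definition stable_Psi (beta u : R) : R :=
  if beta == 1 then - (2 / pi) * ln `|u| else tan (pi * beta / 2).

Definition stable_exponent (beta gamma c u : R) : R[i] :=
  - (`|c * u| `^ beta)%:C *
    (1 - 'i * (gamma * Num.sg u * stable_Psi beta u)%:C).

Definition levy_process (F : R -> set (set T)) (S : R -> T -> R) : Prop :=
  [/\ adapted F S, cadlag_paths S, {ae P, forall w, S 0 w = 0},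
      (forall (s t : R) A (B : set R), 0 <= s -> s <= t -> F s A -> measurable B ->
         P (A `&` [set w | B (S t w - S s w)]) =
         (P A * P [set w | B (S t w - S s w)%R])%E) &
      (forall (s t : R) (B : set R), 0 <= s -> s <= t -> measurable B ->
         P [set w | B (S t w - S s w)] = P (S (t - s) @^-1` B))].

Definition stable_levy_process (F : R -> set (set T)) (beta gamma c : R)
    (S : R -> T -> R) : Prop :=
  [/\ 0 < beta <= 2, -1 <= gamma <= 1, 0 < c, levy_process F S &
      forall t u : R, 0 <= t ->
        char_fun (S t) u = cexp (t%:C * stable_exponent beta gamma c u)].

End stable_levy.

Section model.
Context {R : realType} {d : measure_display} {T : measurableType d}.
Variables (P : probability T R) (F : R -> set (set T)).

(* [dX_t = alpha_t dt + sigma_{t-} dS_t + dY_t] on [0, 1]. *)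
Definition jump_diffusion (X alpha sigma S Y : R -> T -> R) : Prop :=
  exists2 J : R -> T -> R,
    stochastic_integral P F (fun t w => left_limit (fun s => sigma s w) t) S J &
    {ae P, forall w, forall t : R, 0 <= t <= 1 ->
       X t w = X 0 w + \int[lebesgue_measure]_(s in `[0, t]) alpha s w
               + J t w + (Y t w - Y 0 w)}.

(* [E(|Z_t - Z_s|^r | F_s) <= K |t - s|] for all [0 <= s <= t <= 1]. *)
Definition cond_increment_bound (Z : R -> T -> R) (r K : R) : Prop :=
  forall s t : R, 0 <= s -> s <= t -> t <= 1 ->
    exists2 C : T -> \bar R,
      cond_expectation P (F s) (fun w => (`|Z t w - Z s w| `^ r)%:E) C &
      {ae P, forall w, (C w <= (K * `|t - s|)%:E)%E}.

Definition assumption_A1 (sigma : R -> T -> R) : Prop :=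
  {ae P, forall w, forall t : R, 0 <= t <= 1 ->
     sigma t w != 0 /\ left_limit (fun s => sigma s w) t != 0} /\
  exists (tau : nat -> T -> \bar R) (sigmap : nat -> R -> T -> R),
    localizing_sequence P F tau /\
    forall p,
      [/\ random_process (sigmap p),
          (exists C, forall (t : R) w, 0 <= t -> `|sigmap p t w| <= C),
          (forall (t : R) w, 0 <= t -> (t%:E < tau p w)%E ->
             sigma t w = sigmap p t w) &
          exists2 K, 0 < K & cond_increment_bound (sigmap p) 2 K].

Definition assumption_A2 (beta : R) (Y : R -> T -> R) : Prop :=
  exists2 beta' : R, beta' < beta &
  exists (tau : nat -> T -> \bar R) (Yp : nat -> R -> T -> R),
    localizing_sequence P F tau /\
    forall p,
      [/\ random_process (Yp p),
          (forall (t : R) w, 0 <= t -> (t%:E < tau p w)%E -> Y t w = Yp p t w) &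
          exists2 K, 0 < K &
            forall r, beta' < r -> cond_increment_bound (Yp p) r K].

End model.

Section statistic.
Context {R : realType}.
(* [x i] is the observation at time [i / n], [k] and [m] stand for [k_n] and
   [m_n]; blocks are numbered from 1. *)
Variables (x : nat -> R) (n k m : nat) (a varpi : R).

Definition incr (i : nat) : R := x i - x i.-1.

Definition block_start (j : nat) : nat := (j.-1 * k)%N.

Definition local_var (j : nat) : R :=
  pi / 2 * (n%:R / (k%:R - 1)) *
  \sum_((block_start j).+2 <= i < (j * k).+1) `|incr i.-1| * `|incr i|.

Definition adjacent_terms (j i : nat) : R :=
  if i == (block_start j).+1 then `|incr i| * `|incr i.+1|
  else if i == (j * k)%N then `|incr i.-1| * `|incr i|
  else `|incr i.-1| * `|incr i| + `|incr i| * `|incr i.+1|.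

Definition local_var_without (j i : nat) : R :=
  (k%:R - 1) / (k%:R - 3) * local_var j -
  pi / 2 * (n%:R / (k%:R - 3)) * adjacent_terms j i.

Definition untruncated (j i : nat) : bool :=
  `|incr i| <= a * Num.sqrt (local_var j) * n%:R `^ (- varpi).

Definition untruncated_count : R :=
  \sum_(1 <= j < (n %/ k).+1)
    \sum_((block_start j).+1 <= i < (block_start j + m).+1)
      (untruncated j i)%:R.

(* Equal to 0 if no increment is retained. *)
Definition empirical_cdf (tau : R) : R :=
  untruncated_count^-1 *
  \sum_(1 <= j < (n %/ k).+1)
    \sum_((block_start j).+1 <= i < (block_start j + m).+1)
      (Num.sqrt n%:R * incr i / Num.sqrt (local_var_without j i) <= tau)%R%:R *
      (untruncated j i)%:R.

End statistic.

(* [u_n] is of the exact order [n^q]; this includes [u_n / n^q] converging to a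
   positive constant. *)
Definition proportional_to_power {R : realType} (u : nat -> nat) (q : R) : Prop :=
  exists c1 c2 : R, [/\ 0 < c1, 0 < c2 &
    \forall n \near \oo, c1 * n%:R `^ q <= (u n)%:R <= c2 * n%:R `^ q].

Section noise.
Context {R : realType} {d d' : measure_display}
  {T : measurableType d} {T' : measurableType d'}.
Variables (P : probability T R) (P' : probability T' R).
Local Notation Q := (P \x P')%E.

(* [eps n i] is the noise at time [i / n], for [i <= n], on the product
   extension of the original space. *)
Variable eps : nat -> nat -> {RV Q >-> R}.

Definition noise_iid : Prop :=
  (forall n (B : nat -> set R), (forall i, measurable (B i)) ->
     Q (\bigcap_(i in [set i | (i <= n)%N]) eps n i @^-1` B i) =
     (\prod_(i < n.+1) Q (eps n i @^-1` B i))%E) /\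
  (forall n i n' i' (B : set R), (i <= n)%N -> (i' <= n')%N -> measurable B ->
     distribution Q (eps n i) B = distribution Q (eps n' i') B).

Definition noise_sigma (n : nat) : set (set (T * T')) :=
  <<s [set E | exists i (B : set R),
        [/\ (i <= n)%N, measurable B & E = eps n i @^-1` B] ] >>.

Definition noise_independent_of_base : Prop :=
  forall n (A : set T) (E : set (T * T')), measurable A -> noise_sigma n E ->
    Q ((A `*` [set: T']) `&` E) = (Q (A `*` [set: T']) * Q E)%E.

Definition noisy_obs (X : R -> T -> R) (n : nat) (w : T * T') (i : nat) : R :=
  X (i%:R / n%:R) w.1 + eps n i w.

End noise.

(* Main.v *)
Require Import Defs.
From HB Require Import structures.
From mathcomp Require Import all_boot all_order all_algebra.
From mathcomp Require Import ring lra zify.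
From mathcomp Require Import all_classical all_reals all_analysis measurable_realfun.

Set Implicit Arguments.
Unset Strict Implicit.
Unset Printing Implicit Defensive.

Import Order.TTheory GRing.Theory Num.Theory.
Import numFieldNormedType.Exports.

Local Open Scope classical_set_scope.
Local Open Scope ring_scope.

(** The increments of the noise do not shrink as [n] grows, whereas those of the
    path of [X] do, apart from a bounded number of jumps.  So every ingredient
    of the statistic is asymptotically the same functional of the noise alone.

    Signal.  Almost surely the path of [X] is a sum of cadlag paths and of an
    integral, hence regulated, and for each [delta] the number of increments
    larger than [delta] stays bounded in [n] ([regulated_large_increments]).
    The number [n / k_n] of blocks tends to infinity, so the proportion of blocks
    with such an increment tends to 0 ([near_few_jumps]).

    Local variance.  In the other blocks, the estimator divided by [n] is, up to
    [delta] times an average of bounded mean ([local_var_perturb]), [pi / 2] times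
    the block mean of the products of consecutive absolute noise increments.
    These products are identically distributed, integrable, and independent at
    lags 3 and more, so their block means converge in L1 to [2 mu^2 / pi],
    uniformly over the blocks ([lln_L1], [block_mean_lln]).

    One increment.  Leaving out the terms that contain the i-th increment changes
    the local variance by a relative amount of order [1 / k_n], and the truncation
    level has the diverging order [n^(1/2 - varpi)].
    Hence most increments are retained, and comparing the studentized increment
    with [tau] amounts to comparing the noise increment divided by [mu] with a
    number between [tau - rho] and [tau + rho] ([studentized_le]).  The exceptional
    indices are counted through [badness], a sum of nonnegative terms which is at
    least 1 at an exceptional index of a block without large signal increments
    and whose mean can be made arbitrarily small ([near_mean_badness]).  The
    statistic at [tau] is thus caught between the empirical distribution function
    of the noise at [tau - rho] and at [tau + rho] ([empirical_cdf_sandwich]).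

    Conclusion.  The empirical distribution function of the noise converges at
    each point by Chebyshev's inequality ([near_noise_ecdf]), and the continuity
    of the limit upgrades this to uniform convergence on compact sets through a
    finite net ([finite_net], [sup_ecdf_error_cvg]).

    Two points are easy to overlook.  The deviation is a supremum over an
    uncountable set, and its exceedance must be shown to be an event
    ([measurable_sup_gt]).  And [mu] is positive: otherwise [mu^-1] is 0 and the
    limit is the indicator function of the nonnegative numbers, which is not
    continuous ([scale_neq0]).  This also excludes an infinite mean product of
    noise increments, for which [mu] would be 0. *)

(** * Regulated paths and their large increments *)

Section regulated_paths.
Context {R : realType}.
Implicit Types f g : R -> R.

Lemma right_itvW (r r' t u : R) : r <= r' -> t <= u < t + r -> t <= u < t + r'.
Proof. by move=> rr /andP[-> /lt_le_trans]; apply; rewrite lerD2l. Qed.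

Lemma left_itvW (r r' t u : R) : r <= r' -> t - r < u < t -> t - r' < u < t.
Proof.
by move=> rr /andP[ru ->]; rewrite andbT (le_lt_trans _ ru)// lerD2l lerN2.
Qed.

Lemma ball_of_itv (t r u : R) : t - r < u < t + r -> ball t r u.
Proof. by rewrite /ball/= ltr_distlC. Qed.

(** Right-continuity at [t] together with a left limit at [t], both in Cauchy form
    and restricted to [[0, 1]].  This form is stable under sums, and it covers
    cadlag paths and paths that are continuous on [[0, 1]] alike. *)
Definition regulated f : Prop := forall t e : R, 0 <= t <= 1 -> 0 < e ->
  exists2 r : R, 0 < r &
    (forall u v, 0 <= u <= 1 -> 0 <= v <= 1 -> t <= u < t + r -> t <= v < t + r ->
       `|f u - f v| <= e) /\
    (forall u v, 0 <= u <= 1 -> 0 <= v <= 1 -> t - r < u < t -> t - r < v < t ->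
       `|f u - f v| <= e).

Lemma cadlag_regulated f : cadlag f -> regulated f.
Proof.
move=> [fr fl] t e /andP[t0 t1] e0; have e20 : 0 < e / 2 by rewrite divr_gt0.
have [r1 r10 H1] : exists2 r : R, 0 < r &
    forall u, t <= u < t + r -> `|f t - f u| <= e / 2.
  have /cvgrPdist_le/(_ _ e20) := fr t t0.
  rewrite near_withinE => /nbhs_ballP[r /= r0 H]; exists r => // u /andP[].
  rewrite le_eqVlt => /predU1P[<- _|tu utr]; first by rewrite subrr normr0 ltW.
  by apply: H => //=; apply: ball_of_itv; rewrite utr (lt_le_trans _ (ltW tu))// gtrBl.
have [r2 r20 H2] : exists2 r : R, 0 < r &
    forall u v, 0 <= u -> 0 <= v -> t - r < u < t -> t - r < v < t ->
      `|f u - f v| <= e.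
  move: t0; rewrite le_eqVlt => /predU1P[<-|t0].
    by exists 1 => // u v u0 v0 /andP[_ u0'] _; lra.
  have /cvgrPdist_le/(_ _ e20) := fl t t0.
  rewrite near_withinE => /nbhs_ballP[r /= r0 H]; exists r => // u v _ _.
  move=> /andP[u1 u2] /andP[v1 v2].
  have Hu := H u _ u2; have Hv := H v _ v2.
  rewrite (splitr e) -(subrKA (lim (f s @[s --> t^'-]))).
  rewrite (le_trans (ler_normD _ _))// lerD//.
    by rewrite distrC Hu//; apply: ball_of_itv; rewrite u1 (lt_trans u2)// ltrDl.
  by rewrite Hv//; apply: ball_of_itv; rewrite v1 (lt_trans v2)// ltrDl.
have m1 : Num.min r1 r2 <= r1 by rewrite ge_min lexx.
have m2 : Num.min r1 r2 <= r2 by rewrite ge_min lexx orbT.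
exists (Num.min r1 r2); first by rewrite lt_min r10.
split => u v /andP[u0 _] /andP[v0 _] Hu Hv; last first.
  by apply: H2 => //; exact: left_itvW m2 _.
rewrite (splitr e) -(subrKA (f t)) (le_trans (ler_normD _ _))// lerD//.
  by rewrite distrC H1//; exact: right_itvW m1 _.
by rewrite H1//; exact: right_itvW m1 _.
Qed.

Lemma regulatedD f g : regulated f -> regulated g -> regulated (f \+ g).
Proof.
move=> rf rg t e t01 e0; have e20 : 0 < e / 2 by rewrite divr_gt0.
have [r1 r10 [f1 f2]] := rf t _ t01 e20.
have [r2 r20 [g1 g2]] := rg t _ t01 e20.
have split_norm u v : `|f u - f v| <= e / 2 -> `|g u - g v| <= e / 2 ->
    `|(f u + g u) - (f v + g v)| <= e.
  move=> Hf Hg; rewrite opprD addrACA (splitr e).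
  by rewrite (le_trans (ler_normD _ _))// lerD.
have m1 : Num.min r1 r2 <= r1 by rewrite ge_min lexx.
have m2 : Num.min r1 r2 <= r2 by rewrite ge_min lexx orbT.
exists (Num.min r1 r2); first by rewrite lt_min r10.
split=> u v u01 v01 Hu Hv; apply: split_norm.
- by apply: f1 => //; exact: right_itvW m1 _.
- by apply: g1 => //; exact: right_itvW m2 _.
- by apply: f2 => //; exact: left_itvW m1 _.
- by apply: g2 => //; exact: left_itvW m2 _.
Qed.

Lemma regulated_cst (c : R) : regulated (cst c).
Proof. by move=> t e _ e0; exists 1 => //; split => *; rewrite subrr normr0 ltW. Qed.

Lemma continuous_regulated f : {within `[0, 1], continuous f} -> regulated f.
Proof.
move=> cf t e t01 e0; have e20 : 0 < e / 2 by rewrite divr_gt0.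
have /continuous_within_itvP cfI := cf.
have := cf t; rewrite /continuous_at /=.
have -> : nbhs (t : subspace `[0, 1]) = within `[0, 1] (nbhs t).
  by rewrite nbhs_subspace_in//= in_itv.
move=> /cvgrPdist_le/(_ _ e20); rewrite near_withinE => /nbhs_ballP[r /= r0 H].
have {}H u : 0 <= u <= 1 -> t - r < u < t + r -> `|f t - f u| <= e / 2.
  by move=> u01 ur; apply: H; [exact: ball_of_itv|rewrite /= in_itv].
have {}H u v : 0 <= u <= 1 -> 0 <= v <= 1 -> t - r < u < t + r ->
    t - r < v < t + r -> `|f u - f v| <= e.
  move=> u01 v01 ur vr; rewrite (splitr e) -(subrKA (f t)).
  by rewrite (le_trans (ler_normD _ _))// lerD// ?(distrC (f u)); exact: H.
exists r => //; split=> u v u01 v01 /andP[u1 u2] /andP[v1 v2]; apply: H => //.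
- by rewrite u2 (lt_le_trans _ u1)// gtrBl.
- by rewrite v2 (lt_le_trans _ v1)// gtrBl.
- by rewrite u1 (lt_trans u2)// ltrDl.
- by rewrite v1 (lt_trans v2)// ltrDl.
Qed.

Lemma eq_regulated f g : (forall t, 0 <= t <= 1 -> f t = g t) ->
  regulated f -> regulated g.
Proof.
move=> fg rf t e t01 e0; have [r r0 [H1 H2]] := rf t e t01 e0.
by exists r => //; split=> u v u01 v01 ur vr; rewrite -!fg//; [exact: H1|exact: H2].
Qed.

(** Induction along the real line: the supremum of the points that satisfy
    [Phi] can always be passed, unless it is 1. *)
Lemma real_induction01 (Phi : R -> Prop) : Phi 0 ->
  (forall s, 0 <= s <= 1 -> exists2 r, 0 < r & forall t u, 0 <= t <= s ->
     s - r < t -> Phi t -> 0 <= u <= 1 -> u < s + r -> Phi u) -> Phi 1.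
Proof.
move=> Phi0 step; pose E := [set t | 0 <= t <= 1 /\ Phi t].
have supE : has_sup E.
  by split; [exists 0; split; rewrite ?lexx ?ler01 | exists 1 => t [/andP[]]].
pose s := sup E.
have s0 : 0 <= s by apply: sup_upper_bound => //; split; rewrite ?lexx ?ler01.
have s1 : s <= 1 by apply: ge_sup; [case: supE | move=> t [/andP[]]].
have [|r r0 H] := step s; first by rewrite s0.
have [t [/andP[t0 t1] Phit] st] := sup_adherent r0 supE.
have ts : t <= s by apply: sup_upper_bound => //; split => //; rewrite t0.
have {}H u : 0 <= u <= 1 -> u < s + r -> Phi u.
  by apply: (H t) => //; rewrite t0.
have [sr|sr] := ltP 1 (s + r); first by apply: H => //; rewrite ler01 lexx.
suff : s + r / 2 <= s by lra.
have us : 0 <= s + r / 2 <= 1 by apply/andP; split; lra.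
by apply: sup_upper_bound => //; split => //; apply: H => //; lra.
Qed.

(** Near each [s] the path stays within 1 of [f s] on the right, and within 1 of
    its value at any earlier nearby point on the left, so a bound up to such a
    point propagates beyond [s]. *)
Lemma regulated_bounded f : regulated f ->
  exists C : R, forall t, 0 <= t <= 1 -> `|f t| <= C.
Proof.
move=> rf.
apply: (real_induction01
  (Phi := fun s => exists C : R, forall t, 0 <= t <= s -> `|f t| <= C)).
  exists `|f 0| => t t0; have -> : t = 0 by lra.
  by [].
move=> s s01; have [r r0 [H1 H2]] := rf s 1 s01 ltr01; exists r => //.
move=> t u /andP[t0 ts] st [C HC] /andP[u0 u1] us; exists (C + `|f s| + 1) => v.
move=> /andP[v0 vu].
have C0 : 0 <= C by rewrite (le_trans (normr_ge0 (f 0)))// HC// lexx.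
have vs1 : v < s + r by exact: le_lt_trans us.
have v01 : 0 <= v <= 1 by rewrite v0 (le_trans vu u1).
have [vt|tv] := leP v t.
  rewrite -addrA (le_trans (HC v _)) ?v0//.
  by rewrite lerDl addr_ge0.
have [vs|sv] := ltP v s.
  rewrite -(subrK (f t) (f v)) (le_trans (ler_normD _ _))// addrC.
  have t01 : 0 <= t <= 1 by rewrite t0 (le_trans (ltW tv))//; case/andP: v01.
  rewrite -addrA lerD ?HC ?t0 ?lexx// (le_trans (H2 v t v01 t01 _ _))//.
  - by rewrite vs (lt_trans st tv).
  - by rewrite st (lt_trans tv vs).
  - by rewrite lerDr.
rewrite -(subrK (f s) (f v)) (le_trans (ler_normD _ _))// addrC.
rewrite lerD//; first by rewrite lerDr.
by apply: H1 => //; rewrite ?sv ?lexx//= ltrDl.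
Qed.

(** The cells are disjoint. *)
Lemma sum_cell_le1 (x : R) n :
  (\sum_(1 <= i < n.+1) (i.-1%:R < x <= i%:R)%R <= 1)%N.
Proof.
elim: n => [|n IH]; first by rewrite big_geq.
rewrite big_nat_recr//=; have [xn|nx] := leP x n%:R.
  by rewrite addn0.
rewrite big_nat_cond big1 ?add0n; first by case: (_ <= _).
move=> i /andP[/andP[_ lin] _]; case: (leP x i%:R); rewrite ?andbF// => xi.
have : (i%:R <= n%:R :> R) by rewrite ler_nat.
by move=> /(le_trans xi); rewrite leNgt nx.
Qed.

Definition large_increments f (delta : R) (n : nat) : nat :=
  \sum_(1 <= i < n.+1) (delta < `|f (i%:R / n%:R) - f (i.-1%:R / n%:R)|)%R.

(** By real induction: when the time horizon moves across a point [s], an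
    increment larger than [delta] cannot lie strictly to the left of [s] nor to
    the right of it, so at most two new ones appear, in the grid cell of [s] and
    in the grid cell of the earlier horizon. *)
Lemma regulated_large_increments f (delta : R) : regulated f -> 0 < delta ->
  exists C : nat, forall n, (large_increments f delta n <= C)%N.
Proof.
move=> rf d0.
pose large n i := delta < `|f (i%:R / n%:R) - f (i.-1%:R / n%:R)|.
have [C HC] : exists C, forall n, (0 < n)%N ->
    (\sum_(1 <= i < n.+1) ((i%:R <= 1 * n%:R :> R)%R && large n i) <= C)%N.
  apply: (real_induction01 (Phi := fun t => exists C, forall n, (0 < n)%N ->
    (\sum_(1 <= i < n.+1) ((i%:R <= t * n%:R :> R)%R && large n i) <= C)%N)).
    exists 0 => n n0; rewrite big_nat_cond big1// => i /andP[/andP[i0 _] _].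
    by rewrite mul0r (lern0 _ i) gtn_eqF.
  move=> s s01; have [r r0 [H1 H2]] := rf s _ s01 d0; exists r => //.
  move=> t u /andP[t0 ts] st [C HC] /andP[u0 u1] us; exists (C + 1 + 1)%N.
  move=> n n0; have nR : 0 < n%:R :> R by rewrite ltr0n.
  (* The two cells are those of the old horizon [t] and of the point [s]. *)
  apply: leq_trans (leq_add (leq_add (HC n n0) (sum_cell_le1 (t * n%:R) n))
    (sum_cell_le1 (s * n%:R) n)).
  rewrite -!big_split/= leq_sum// => i _.
  have ab : i.-1%:R / n%:R <= i%:R / n%:R :> R.
    by rewrite ler_pM2r ?invr_gt0// ler_nat leq_pred.
  have a0 : 0 <= i.-1%:R / n%:R :> R by rewrite divr_ge0.
  have e1 (z : R) : (i%:R <= z * n%:R) = (i%:R / n%:R <= z) by rewrite ler_pdivrMr.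
  have e2 (z : R) : (i.-1%:R < z * n%:R) = (i.-1%:R / n%:R < z) by rewrite ltr_pdivrMr.
  have e3 (z : R) : (z * n%:R <= i%:R) = (z <= i%:R / n%:R) by rewrite ler_pdivlMr.
  rewrite /large !{}e1 !{}e2 !{}e3.
  move: (i.-1%:R / n%:R) (i%:R / n%:R) ab a0 => x y xy x0.
  have [yu|//] := leP y u; have [lg|//] := boolP (delta < _).
  have [//|ty] := leP y t; rewrite (ltW ty); have [//|tx] := ltP x t.
  have [sx|xs] := leP s x.
    suff: `|f y - f x| <= delta by rewrite leNgt lg.
    have y01 : 0 <= y <= 1 by rewrite (le_trans x0 xy) (le_trans yu u1).
    apply: H1 => //; first by rewrite x0 (le_trans xy)//; case/andP: y01.
      by rewrite (le_trans sx xy) (le_lt_trans yu us).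
    by rewrite sx (le_lt_trans xy (le_lt_trans yu us)).
  have [//|ys] := leP s y.
  suff: `|f y - f x| <= delta by rewrite leNgt lg.
  have y01 : 0 <= y <= 1 by rewrite (le_trans x0 xy) (le_trans yu u1).
  apply: H2 => //; first by rewrite x0 (le_trans xy)//; case/andP: y01.
    by rewrite ys (lt_le_trans st (ltW ty)).
  by rewrite xs (lt_le_trans st tx).
exists C => -[|n]; first by rewrite /large_increments big_geq.
apply: leq_trans (HC n.+1 isT); rewrite /large_increments.
rewrite big_nat_cond [leqRHS]big_nat_cond leq_sum// => i /andP[/andP[_ ilen] _].
by rewrite mul1r ler_nat (ltnSE ilen).
Qed.

End regulated_paths.

(** * Measurability and regularity of the observed path *)

Section path_measurability.
Context {R : realType}.

(** Such a set is the union over the rationals [p] of the sets of points [x <= p]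
    with [[x, p]] included in [A], and each of these is an interval. *)
Lemma right_open_measurable (A : set R) :
  (forall x, A x -> exists2 v, x < v & `[x, v[ `<=` A) -> measurable A.
Proof.
move=> HA; pose J (p : rat) := [set x | x <= ratr p /\ `[x, ratr p] `<=` A].
have -> : A = \bigcup_p J p.
  apply/seteqP; split => [x Ax|x [p _ [xp]]]; last first.
    by apply; rewrite /= in_itv/= lexx.
  have [v xv H] := HA x Ax; have [p] := rat_in_itvoo xv.
  rewrite in_itv/= => /andP[xp pv]; exists p => //; split; first exact: ltW.
  move=> y /=; rewrite in_itv/= => /andP[xy yp]; apply: H.
  by rewrite /= in_itv/= xy (le_lt_trans yp pv).
apply: bigcupT_measurable_rat => p; apply: is_interval_measurable.
move=> x z [_ Hx] [zp _] y /andP[xy yz]; split; first exact: le_trans zp.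
move=> t /=; rewrite in_itv/= => /andP[yt tp]; apply: Hx.
by rewrite /= in_itv/= tp (le_trans xy yt).
Qed.

(** A strict superlevel set of a right-continuous function contains, with each of
    its points, an interval on the right of it. *)
Lemma cadlag_measurable (f : R -> R) : cadlag f ->
  measurable_fun (`[0, 1]%classic : set R) f.
Proof.
move=> [fr _] mD; apply: (measurability _ (RGenOInfty.measurableE R)) => //.
move=> _ [_ [y ->] <-].
have -> : `[0, 1] `&` f @^-1` `]y, +oo[ = `[0, 1] `&` [set t | 0 <= t /\ y < f t].
  apply/seteqP; split=> t /= []; rewrite !in_itv/= andbT => /andP[t0 t1].
    by split => //; rewrite t0.
  by move=> [_ yf]; rewrite t0 t1.
apply: measurableI => //; apply: right_open_measurable => x [x0 yx].
have e0 : 0 < f x - y by rewrite subr_gt0.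
have /cvgrPdist_lt/(_ _ e0) := fr x x0.
rewrite near_withinE => /nbhs_ballP[r /= r0 H]; exists (x + r); first by rewrite ltrDl.
move=> u /=; rewrite in_itv/= => /andP[]; rewrite le_eqVlt => /predU1P[<- //|xu ur].
split; first by rewrite (le_trans x0 (ltW xu)).
have := H u; rewrite /ball/= !ltr_distlC => /(_ _ xu).
by move=> H'; have : f x - (f x - y) < f u < f x + (f x - y);
  [apply: H'; apply/andP; split; lra | move=> /andP[]; lra].
Qed.

Lemma cadlag_integral_regulated (f : R -> R) : cadlag f ->
  regulated (fun t => \int[lebesgue_measure]_(s in `[0, t]) f s).
Proof.
move=> cf; apply: continuous_regulated.
apply: (parameterized_integral_continuous (f := f)); first exact: ler01.
apply: measurable_bounded_integrable => //.
- exact: compact_finite_measure (@segment_compact _ _ _).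
- exact: cadlag_measurable.
- have [C HC] := regulated_bounded (cadlag_regulated cf).
  exists C; split; first exact: num_real.
  move=> M CM x /=; rewrite in_itv/= => /HC xC; exact: le_trans (ltW CM).
Qed.

End path_measurability.

Section observed_path.
Context {R : realType} {d : measure_display} {T : measurableType d}.

Lemma jump_diffusion_regulated (P : probability T R) (F : R -> set (set T))
    (X alpha sigma S Y : R -> T -> R) :
  cadlag_paths alpha -> pure_jump_ito_semimartingale P F Y ->
  jump_diffusion P F X alpha sigma S Y ->
  {ae P, forall w, regulated (fun t => X t w)}.
Proof.
move=> calpha [_ cY _] [J [_ cJ _]]; apply: filterS => w HX.
apply: (eq_regulated (f := (((cst (X 0 w) \+
  (fun t => \int[lebesgue_measure]_(s in `[0, t]) alpha s w)) \+
  (fun t => J t w)) \+ ((fun t => Y t w) \+ cst (- Y 0 w))))).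
  by move=> t /HX ->.
do !apply: regulatedD; try exact: regulated_cst.
- exact: cadlag_integral_regulated.
- exact: cadlag_regulated.
- exact: cadlag_regulated.
Qed.

End observed_path.

(** * Suprema of right-continuous processes *)

Section suprema.
Context {R : realType}.

(** [D] collects one point of [A] in each rational interval that meets [A], and
    the greatest point of [A] below each rational when it exists; the latter
    catch the points that [A] does not accumulate at from the right. *)
Lemma countable_right_dense (A : set R) : exists D : set R,
  [/\ countable D, D `<=` A &
      forall x v, A x -> x < v -> exists2 y, D y & x <= y < v].
Proof.
pose g (pr : rat * rat) := xget 0 [set x | A x /\ ratr pr.1 < x < ratr pr.2].
pose h (p : rat) := xget 0 [set x | [/\ A x, x < ratr p &
  forall y, A y -> y < ratr p -> y <= x]].
exists (A `&` (range g `|` range h)); split.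
- apply: (sub_countable (subset_card_le (@subIsetr _ _ _))).
  rewrite -bigcup2E; apply: bigcup_countable; first exact: countableP.
  move=> [_|[_|i _]] /=; last exact: countable0.
    by apply: (sub_countable (card_image_le _ _)); exact: countableP.
  by apply: (sub_countable (card_image_le _ _)); exact: countableP.
- by move=> x [].
move=> x v Ax xv; have [p] := rat_in_itvoo xv.
rewrite in_itv/= => /andP[xp pv].
have [[z [Az /andP[xz zp]]]|noz] := pselect (exists z, A z /\ x < z < ratr p).
  have [r] := rat_in_itvoo xz; rewrite in_itv/= => /andP[xr rz].
  have [|Ag /andP[/= rg gp]] := @xgetPex _ 0 [set x | A x /\ ratr r < x < ratr p].
    by exists z; split => //; rewrite rz zp.
  exists (g (r, p)); first by split => //; left; exists (r, p).
  by rewrite (le_trans (ltW xr) (ltW rg)) (lt_trans gp pv).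
have [|Ah hp hmax] := @xgetPex _ 0 [set x | [/\ A x, x < ratr p &
  forall y, A y -> y < ratr p -> y <= x]].
  exists x; split => // y Ay yp; rewrite leNgt; apply/negP => xy.
  by apply: noz; exists y; rewrite xy yp.
exists (h p); first by split => //; right; exists p.
by rewrite (lt_trans hp pv) andbT; exact: hmax.
Qed.

(** By right-continuity, an exceedance at [t] persists on some [[t, v[], hence it
    also occurs in a countable subset of [A] which is dense from the right; the
    set is then a countable union of events. *)
Lemma measurable_sup_gt {d : measure_display} {U : measurableType d}
    (A : set R) (phi : R -> U -> R) (e : R) : 0 <= e ->
  (forall t, measurable [set w | e < phi t w]) ->
  (forall w t, phi s w @[s --> t^'+] --> phi t w) ->
  (forall w, has_ubound [set phi t w | t in A]) ->
  measurable [set w | e < sup [set phi t w | t in A]].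
Proof.
move=> e0 mphi rphi bphi; have [D [cD DA HD]] := countable_right_dense A.
have -> : [set w | e < sup [set phi t w | t in A]] =
          \bigcup_(t in D) [set w | e < phi t w].
  apply/seteqP; split => w /=; last first.
    move=> [t Dt /= et]; apply: lt_le_trans et _.
    apply: sup_upper_bound; last by exists t => //; exact: DA.
    by split => //; exists (phi t w), t => //; exact: DA.
  move=> es; have [t [At et]] : exists t, A t /\ e < phi t w.
    apply: contrapT => H; move: es; rewrite ltNge => /negP; apply.
    have [[t At]|noA] := pselect (A !=set0).
      apply: ge_sup; first by exists (phi t w), t.
      move=> _ [s As <-]; rewrite leNgt; apply/negP => es; apply: H.
      by exists s.
    have -> : [set phi t w | t in A] = set0; last by rewrite sup0.
    by rewrite -subset0 => y [t At _]; apply: noA; exists t.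
  have /cvgr_gt/(_ _ et) := rphi w t.
  rewrite near_withinE => /nbhs_ballP[r /= r0 H].
  have tr : t < t + r by rewrite ltrDl.
  have [y Dy /andP[]] := HD t (t + r) At tr.
  rewrite le_eqVlt => /orP[/eqP ty _|ty yr]; exists y => //=; first by rewrite -ty.
  apply: H => //.
  by rewrite /ball/= ltr_distlC; apply/andP; split; lra.
rewrite bigcup_set_type; apply: countable_bigcupT_measurable => [|t]; last exact: mphi.
by rewrite (eq_countable (card_setT _)).
Qed.

Lemma cvg_at_right_le_indicator (z t : R) :
  ((z <= s)%R%:R : R) @[s --> t^'+] --> ((z <= t)%R%:R : R).
Proof.
apply: cvg_near_cst; have [zt|tz] := leP z t; near=> s.
  by rewrite (le_trans zt)//; near: s; exact: nbhs_right_ge.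
by rewrite leNgt (_ : s < z)//; near: s; exact: nbhs_right_lt.
Unshelve. all: by end_near. Qed.

End suprema.

(** * One increment inside one block *)

Section one_increment.
Context {R : realType}.
Implicit Types (e f : nat -> R) (n k j i : nat).

Definition bipower e i : R := `|incr e i.-1| * `|incr e i|.

(** Adding 1 to both factors makes one quantity bound both a product of
    perturbed increments and, up to the factor [delta], the effect on it of
    perturbations of size [delta <= 1]. *)
Definition padded_bipower e i : R := (`|incr e i.-1| + 1) * (`|incr e i| + 1).

(** The number of pairs of consecutive increments in a block is [k - 1]. *)
Definition block_mean (g : nat -> R) k j : R :=
  (k%:R - 1)^-1 * \sum_((block_start k j).+2 <= i < (j * k).+1) g i.

(** The padded counterpart of [adjacent_terms]. *)
Definition adjacent_padded e k j i : R :=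
  ((block_start k j).+1 < i)%:R * padded_bipower e i +
  (i < j * k)%:R * padded_bipower e i.+1.

Lemma incrD f e i : incr (fun l => f l + e l) i = incr f i + incr e i.
Proof. by rewrite /incr opprD addrACA. Qed.

Lemma padded_bipower_ge0 e i : 0 <= padded_bipower e i.
Proof. by rewrite mulr_ge0// addr_ge0. Qed.

Lemma local_varE (x : nat -> R) n k j :
  local_var x n k j = n%:R * (pi / 2 * block_mean (bipower x) k j).
Proof. by rewrite /local_var /block_mean /bipower; ring. Qed.

Lemma bipower_perturb f e (delta : R) i : 0 <= delta <= 1 ->
  `|incr f i.-1| <= delta -> `|incr f i| <= delta ->
  `|bipower (fun l => f l + e l) i - bipower e i| <= delta * padded_bipower e i.
Proof.
move=> /andP[d0 d1]; rewrite /bipower /padded_bipower !incrD.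
move: (incr f i.-1) (incr f i) (incr e i.-1) (incr e i) => a b c g ad bd.
have Hc : `| `|a + c| - `|c| | <= delta.
  by apply: le_trans (ler_dist_dist _ _) _; rewrite addrK.
have Hg : `| `|b + g| - `|g| | <= delta.
  by apply: le_trans (ler_dist_dist _ _) _; rewrite addrK.
move: Hc Hg; rewrite !ler_norml => /andP[c1 c2] /andP[g1 g2].
have := normr_ge0 c; have := normr_ge0 g.
have := normr_ge0 (a + c); have := normr_ge0 (b + g).
move: `|a + c| `|b + g| `|c| `|g| c1 c2 g1 g2 => A B C D c1 c2 g1 g2 B0 A0 D0 C0.
have dd : delta * delta <= delta by rewrite ler_piMr.
have CD : 0 <= delta * (C * D) by rewrite !mulr_ge0.
apply/andP; split.
  have : C * (D - B) <= C * delta by rewrite ler_wpM2l//; lra.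
  have : B * (C - A) <= (D + delta) * delta.
    by rewrite (le_trans (ler_wpM2l B0 (_ : _ <= delta)))// ?ler_wpM2r//; lra.
  by lra.
have : A * B <= (C + delta) * (D + delta) by rewrite ler_pM//; lra.
by lra.
Qed.

Lemma bipower_le_padded f e i : `|incr f i.-1| <= 1 -> `|incr f i| <= 1 ->
  bipower (fun l => f l + e l) i <= padded_bipower e i.
Proof.
have H (a b : R) : `|a| <= 1 -> `|a + b| <= `|b| + 1.
  by move=> a1; rewrite (le_trans (ler_normD _ _))// addrC lerD2l.
by move=> f1 f2; rewrite /bipower /padded_bipower !incrD ler_pM// H.
Qed.

Section one_block.
Variables (f e : nat -> R) (n k j : nat) (delta : R).
Hypotheses (k4 : (4 <= k)%N) (j1 : (1 <= j)%N) (delta01 : 0 <= delta <= 1).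
Hypothesis small : forall l, (block_start k j < l <= j * k)%N ->
  `|incr f l| <= delta.

Local Notation x := (fun l => f l + e l).

Let k3 : 0 < k%:R - 3 :> R.
Proof. by rewrite subr_gt0 ltr_nat. Qed.

Let k1 : 0 < k%:R - 1 :> R.
Proof. by rewrite subr_gt0 ltr1n; exact: leq_trans k4. Qed.

(** Inside a block whose signal increments are all at most [delta], the local
    variance sees the signal as a perturbation of size [delta]. *)
Lemma local_var_perturb :
  `|pi / 2 * block_mean (bipower x) k j - pi / 2 * block_mean (bipower e) k j|
    <= pi / 2 * (delta * block_mean (padded_bipower e) k j).
Proof.
have p0 : 0 <= pi / 2 :> R by rewrite divr_ge0 ?pi_ge0.
rewrite -mulrBr normrM ger0_norm// ler_wpM2l// /block_mean -mulrBr normrM.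
rewrite ger0_norm ?invr_ge0 ?(ltW k1)// mulrCA ler_wpM2l ?invr_ge0 ?(ltW k1)//.
rewrite -sumrB (le_trans (ler_norm_sum _ _ _))// mulr_sumr.
rewrite big_nat_cond [leRHS]big_nat_cond ler_sum// => i /andP[/andP[si ij] _].
by apply: bipower_perturb => //; apply: small; lia.
Qed.

Lemma adjacent_terms_le i : (block_start k j < i <= j * k)%N ->
  0 <= adjacent_terms x k j i <= adjacent_padded e k j i.
Proof.
move=> /andP[si ij]; have /andP[_ d1] := delta01.
have small1 l : (block_start k j < l <= j * k)%N -> `|incr f l| <= 1.
  by move=> /small /le_trans; apply.
have bj : (block_start k j + k)%N = (j * k)%N.
  by rewrite /block_start -mulSnr prednK.
have B1 : (block_start k j).+1 != i -> 0 <= bipower x i <= padded_bipower e i.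
  move=> ne; rewrite mulr_ge0//=; apply: bipower_le_padded; apply: small1; lia.
have B2 : i != (j * k)%N -> 0 <= bipower x i.+1 <= padded_bipower e i.+1.
  move=> ne; rewrite mulr_ge0//=; apply: bipower_le_padded; apply: small1; lia.
have pe0 := padded_bipower_ge0 e.
rewrite /adjacent_terms /adjacent_padded; case: ifPn => [/eqP ie|ine].
  have lt : (i < j * k)%N by lia.
  rewrite lt ie ltnn mul0r mul1r add0r -ie.
  by apply: B2; rewrite neq_ltn lt.
have lt1 : ((block_start k j).+1 < i)%N by rewrite ltn_neqAle eq_sym ine.
have {B1}/andP[B10 B1] := B1 (negbT (ltn_eqF lt1)).
rewrite lt1 mul1r; case: ifPn => [/eqP ie|ine2].
  by rewrite ie ltnn mul0r addr0 -ie B10.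
have lt2 : (i < j * k)%N by rewrite ltn_neqAle ine2.
have /andP[B20 B2'] := B2 ine2.
rewrite lt2 mul1r; apply/andP; split; first exact: addr_ge0 B10 B20.
exact: lerD B1 B2'.
Qed.

Variables (mu eta : R).
Hypotheses (n0 : (0 < n)%N) (mu0 : 0 < mu) (eta0 : 0 < eta).
Hypothesis eta_small : 8 * eta <= mu ^+ 2.
Hypothesis k_large : 2 * (mu ^+ 2 + 2 * eta) <= eta * (k%:R - 3).
Hypothesis mean_close : `|pi / 2 * block_mean (bipower e) k j - mu ^+ 2| <= eta.
Hypothesis padded_small :
  pi / 2 * (delta * block_mean (padded_bipower e) k j) <= eta.

Let nR : 0 < n%:R :> R. Proof. by rewrite ltr0n. Qed.

Local Notation V := (pi / 2 * block_mean (bipower x) k j).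

Let V_close : `|V - mu ^+ 2| <= 2 * eta.
Proof.
rewrite -(subrKA (pi / 2 * block_mean (bipower e) k j)).
rewrite (le_trans (ler_normD _ _))// mulr_natl mulr2n lerD//.
exact: le_trans local_var_perturb _.
Qed.

(** The local variance is at least [n mu^2 / 4], so the truncation level is at
    least [a (mu / 2) n^(1/2 - varpi)]. *)
Lemma retained_increment (a varpi : R) i :
  0 < a -> `|incr f i| <= 1 ->
  `|incr e i| + 1 <= a * (mu / 2) * (Num.sqrt n%:R * n%:R `^ (- varpi)) ->
  untruncated x n k a varpi j i.
Proof.
move=> a0 fi ei; rewrite /untruncated incrD local_varE.
rewrite (le_trans (ler_normD _ _))// addrC (le_trans (lerD (lexx _) fi))//.
rewrite (le_trans ei)// sqrtrM ?ler0n//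
  [leLHS]mulrA ler_wpM2r ?powR_ge0//.
rewrite -[leLHS]mulrA ler_wpM2l ?(ltW a0)// [leLHS]mulrC ler_wpM2l ?sqrtr_ge0//.
move: V_close; rewrite ler_norml => /andP[V1 V2].
have -> : mu / 2 = Num.sqrt ((mu / 2) ^+ 2) by rewrite sqrtr_sqr ger0_norm// ltW// divr_gt0.
have m4 : (mu / 2) ^+ 2 = mu ^+ 2 / 4 by field.
rewrite ler_wsqrtr// m4.
move: (sqr_ge0 mu) eta_small; lra.
Qed.

(** [x - mu^2] factors as the product of [sqrt x - mu] and [sqrt x + mu], and the
    second factor is at least [mu].  Here the local variance contributes at most
    [2 eta] to [x - mu^2], and leaving out the terms adjacent to [i] at most [eta]. *)
Lemma studentizer_close i : (block_start k j < i <= j * k)%N ->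
  pi / 2 * adjacent_padded e k j i <= eta * (k%:R - 3) ->
  `|Num.sqrt (local_var_without x n k j i) / Num.sqrt n%:R - mu| <= 4 * eta / mu.
Proof.
move=> sij adj; have /andP[D0 D1] := adjacent_terms_le sij.
move: V_close; rewrite ler_norml => /andP[V1 V2].
have p0 : 0 < pi / 2 :> R by rewrite divr_gt0 ?pi_gt0.
(* [W] is the leave-one-out variance divided by [n]. *)
pose W := V + (2 * V - pi / 2 * adjacent_terms x k j i) / (k%:R - 3).
have WE : local_var_without x n k j i = n%:R * W.
  rewrite /local_var_without local_varE /W; field.
  by rewrite gt_eqF.
have W1 : W - V <= eta.
  rewrite /W addrC addKr ler_pdivrMr//.
  have := mulr_ge0 (ltW p0) D0; move: k_large; lra.
have W2 : - eta <= W - V.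
  rewrite /W addrC addKr ler_pdivlMr//.
  have := ler_wpM2l (ltW p0) D1; move: eta_small eta0; lra.
have W0 : 0 < W by move: eta0 eta_small; lra.
rewrite WE sqrtrM ?ler0n// mulrAC divff ?mul1r; last by rewrite sqrtr_eq0 -ltNge.
have s0 : 0 < Num.sqrt W by rewrite sqrtr_gt0.
have sE : (Num.sqrt W - mu) * (Num.sqrt W + mu) = W - mu ^+ 2.
  by rewrite -subr_sqr sqr_sqrtr// ltW.
rewrite ler_pdivlMr//.
have : `|Num.sqrt W - mu| * (Num.sqrt W + mu) <= 4 * eta.
  have sm : 0 <= Num.sqrt W + mu by rewrite addr_ge0 ?ltW.
  rewrite -(ger0_norm sm) -normrM sE ler_norml.
  by apply/andP; split; lra.
by apply: le_trans; rewrite ler_wpM2l// lerDr ltW.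
Qed.

(** Multiplying out the studentizer, [tau] is perturbed by at most [M] times the
    error of the studentizer plus [delta], in units of the noise increment. *)
Lemma studentized_le (tau rho M : R) i : (block_start k j < i <= j * k)%N ->
  pi / 2 * adjacent_padded e k j i <= eta * (k%:R - 3) ->
  `|tau| <= M -> M * (4 * eta / mu) + delta <= rho * mu ->
  let ind := Num.sqrt n%:R * incr x i / Num.sqrt (local_var_without x n k j i) <= tau in
  (mu^-1 * incr e i <= tau - rho -> ind) /\ (ind -> mu^-1 * incr e i <= tau + rho).
Proof.
move=> sij adj tauM small_error; have := studentizer_close sij adj.
have Hd := small sij.
have n1 : 0 < Num.sqrt n%:R :> R by rewrite sqrtr_gt0.
set s := _ / Num.sqrt n%:R => sclose.
have s0 : 0 < s.
  move: sclose; rewrite ler_norml => /andP[+ _]; rewrite lerBrDr.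
  apply: lt_le_trans; rewrite addrC subr_gt0 ltr_pdivrMr// -expr2.
  move: eta_small eta0; lra.
have -> : Num.sqrt (local_var_without x n k j i) = s * Num.sqrt n%:R.
  by rewrite /s divfK// gt_eqF.
have W0 : 0 < s * Num.sqrt n%:R by rewrite mulr_gt0.
rewrite /= incrD ler_pdivrMr//.
have -> : (Num.sqrt n%:R * (incr f i + incr e i) <= tau * (s * Num.sqrt n%:R)) =
          (incr f i + incr e i <= tau * s).
  by rewrite mulrA [leRHS]mulrC ler_pM2l.
have ts : `|tau * s - tau * mu| <= M * (4 * eta / mu).
  by rewrite -mulrBr normrM ler_pM.
move: ts Hd; rewrite !ler_norml => /andP[t1 t2] /andP[d1 d2].
have mu' : 0 < mu := mu0.
rewrite [mu^-1 * incr e i]mulrC ler_pdivrMr// ler_pdivrMr// mulrBl mulrDl.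
by split => ?; lra.
Qed.

End one_block.
End one_increment.

(** * Averages over the retained increments *)

Section counting.
Context {R : realType}.

Definition mean_over (I : Type) (r : seq I) (g : I -> R) : R :=
  (size r)%:R^-1 * \sum_(p <- r) g p.

Lemma mean_over_le (I : eqType) (r : seq I) (g h : I -> R) :
  (forall p, p \in r -> g p <= h p) -> mean_over r g <= mean_over r h.
Proof.
move=> gh; rewrite ler_wpM2l ?invr_ge0 ?ler0n//.
by rewrite big_seq [leRHS]big_seq; exact: ler_sum.
Qed.

Lemma mean_over_cst (I : Type) (r : seq I) (c : R) :
  (size r)%:R != 0 :> R -> mean_over r (fun=> c) = c.
Proof.
move=> r0; rewrite /mean_over big_const_seq count_predT iter_addr addr0.
by rewrite -(mulr_natl c) mulKf.
Qed.

Lemma mean_overD (I : Type) (r : seq I) (g h : I -> R) :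
  mean_over r (fun p => g p + h p) = mean_over r g + mean_over r h.
Proof. by rewrite /mean_over big_split/= mulrDr. Qed.

Lemma mean_overZ (I : Type) (r : seq I) (c : R) (g : I -> R) :
  mean_over r (fun p => c * g p) = c * mean_over r g.
Proof. by rewrite /mean_over -mulr_sumr mulrCA. Qed.

Lemma mean_over_exchange (I J : Type) (r : seq I) (t : seq J) (g : I -> J -> R) :
  mean_over r (fun p => \sum_(y <- t) g p y) =
  \sum_(y <- t) mean_over r (g^~ y).
Proof. by rewrite /mean_over exchange_big/= mulr_sumr. Qed.

Lemma mean_over_map (I J : Type) (h : I -> J) (s : seq I) (g : J -> R) :
  mean_over (map h s) g = mean_over s (g \o h).
Proof. by rewrite /mean_over size_map big_map. Qed.

Lemma norm_mean_over (I : Type) (r : seq I) (g : I -> R) :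
  `|mean_over r g| <= mean_over r (fun p => `|g p|).
Proof.
by rewrite /mean_over normrM ger0_norm ?invr_ge0 ?ler0n// ler_wpM2l ?invr_ge0
  ?ler0n// ler_norm_sum.
Qed.

(** [beta] is at least 1 on the exceptional indices, so their proportion is at
    most the mean of [beta].  The factor 2 pays once for the exceptional terms
    of the numerator and once for the denominator, which may differ from the
    number of indices. *)
Lemma retained_mean_sandwich (I : eqType) (r : seq I) (u v lo hi : I -> bool)
    (beta : I -> R) :
  (forall p, p \in r -> 0 <= beta p) ->
  (forall p, p \in r -> beta p < 1 ->
     [/\ u p, lo p -> v p & v p -> hi p]) ->
  mean_over r (fun p => (lo p)%:R) - 2 * mean_over r beta <=
    (\sum_(p <- r) (u p)%:R)^-1 * \sum_(p <- r) (v p)%:R * (u p)%:R <=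
  mean_over r (fun p => (hi p)%:R) + 2 * mean_over r beta.
Proof.
move=> b0 H.
have [->|r0] := eqVneq r [::]; first by rewrite /mean_over !big_nil !mulr0 subr0 addr0 lexx.
have sum_le (g h : I -> R) : (forall p, p \in r -> g p <= h p) ->
    \sum_(p <- r) g p <= \sum_(p <- r) h p.
  by move=> gh; rewrite big_seq [leRHS]big_seq ler_sum.
pose M : R := (size r)%:R.
have M0 : 0 < M by rewrite ltr0n lt0n size_eq0.
set N := \sum_(p <- r) (u p)%:R; set S := \sum_(p <- r) _ * _.
set B := \sum_(p <- r) beta p.
have NM : M - N <= B.
  rewrite /M -sum1_size natr_sum -sumrB; apply: sum_le => p pr.
  have [/(H p pr)[-> _ _]|bp] := ltP (beta p) 1; first by rewrite subrr b0.
  by apply: le_trans bp; rewrite lerBlDr lerDl ler0n.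
have NM' : N <= M.
  rewrite /M -sum1_size natr_sum; apply: sum_le => p pr.
  by rewrite ler_nat leq_b1.
have SN : S <= N by apply: sum_le => p pr; rewrite -natrM ler_nat; case: (u p); case: (v p).
have S0 : 0 <= S by apply: sumr_ge0 => p _; rewrite mulr_ge0.
have Shi : S <= \sum_(p <- r) (hi p)%:R + B.
  rewrite -big_split/=; apply: sum_le => p pr.
  have [/(H p pr)[-> _ vh]|bp] := ltP (beta p) 1.
    have bp := b0 p pr; move: vh; case: (v p) => [-> //|_].
      by rewrite mulr1 lerDl.
    by rewrite mul0r addr_ge0.
  have : 0 <= (hi p)%:R :> R by [].
  have : (v p)%:R * (u p)%:R <= 1 :> R by rewrite mulr_ile1 ?lern1 ?leq_b1.
  lra.
have Slo : \sum_(p <- r) (lo p)%:R - B <= S.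
  rewrite -sumrB; apply: sum_le => p pr.
  have [/(H p pr)[-> lv _]|bp] := ltP (beta p) 1.
    have bp := b0 p pr; move: lv; case: (lo p) => [-> //|_].
      by rewrite mulr1 gerBl.
    by rewrite sub0r mulr1 (le_trans _ (ler0n _ _))// oppr_le0.
  have : (lo p)%:R <= 1 :> R by rewrite lern1 leq_b1.
  have : 0 <= (v p)%:R * (u p)%:R :> R by rewrite mulr_ge0.
  lra.
have ratio : S / M <= N^-1 * S <= S / M + B / M.
  have [N0|N0] := eqVneq N 0.
    have -> : S = 0 by apply/le_anti; rewrite S0 -N0 SN.
    by rewrite mulr0 mul0r lexx add0r divr_ge0// ?(ltW M0)//; lra.
  have {}N0 : 0 < N by rewrite lt_def N0 (le_trans S0 SN).
  apply/andP; split.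
    by rewrite mulrC ler_wpM2r// lef_pV2.
  rewrite mulrC -mulrDl ler_pdivrMr// mulrAC ler_pdivlMr//.
  nra.
have MB (x y : R) : x <= y -> x / M <= y / M by move=> ?; rewrite ler_pM2r ?invr_gt0.
have := MB _ _ Shi; have := MB _ _ Slo; move: ratio => /andP[].
have B0 : 0 <= B / M by rewrite divr_ge0 ?(ltW M0)// /B big_seq sumr_ge0.
move: B0; rewrite /mean_over -/M -/B !(mulrC M^-1) !mulrDl mulNr => *.
by apply/andP; split; lra.
Qed.

Definition retained n k m : seq (nat * nat) :=
  [seq (j, i) | j <- index_iota 1 (n %/ k).+1,
     i <- index_iota (block_start k j).+1 (block_start k j + m).+1].

Lemma size_retained n k m : size (retained n k m) = ((n %/ k) * m)%N.
Proof.
rewrite size_allpairs_dep sumnE big_map (eq_bigr (fun=> m)) => [|j _].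
  by rewrite sum_nat_const_nat subn1.
by rewrite size_iota subSS addKn.
Qed.

Lemma sum_retained (n k m : nat) (g : nat -> nat -> R) :
  \sum_(1 <= j < (n %/ k).+1)
    \sum_((block_start k j).+1 <= i < (block_start k j + m).+1) g j i =
  \sum_(p <- retained n k m) g p.1 p.2.
Proof. by rewrite big_allpairs_dep. Qed.

Lemma mem_retained n k m j i : (m <= k)%N -> (j, i) \in retained n k m ->
  [/\ (1 <= j <= n %/ k)%N, (block_start k j < i)%N, (i <= j * k)%N & (j * k <= n)%N].
Proof.
move=> mk /allpairsPdep[j' [i' []]]; rewrite !mem_index_iota.
move=> /andP[j1 jn] /andP[si im] [-> ->]; rewrite ltnS in jn.
have bj : (block_start k j' + k)%N = (j' * k)%N by rewrite /block_start -mulSnr prednK.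
split=> //; first by rewrite j1.
  by rewrite -bj (leq_trans (ltnSE im))// leq_add2l.
by apply: leq_trans (leq_divM n k); rewrite leq_mul2r jn orbT.
Qed.

(** The blocks are disjoint, so an index determines its block. *)
Lemma uniq_retained n k m : (m <= k)%N -> uniq (unzip2 (retained n k m)).
Proof.
move=> mk; rewrite map_inj_in_uniq ?allpairs_uniq_dep ?iota_uniq//.
- by move=> j _; exact: iota_uniq.
- by move=> [j i] [j' i'] _ _ /= [-> ->].
move=> [j i] [j' i'] /allpairsPdep[j1 [i1 [+ + [ej ei]]]].
move=> + + /allpairsPdep[j2 [i2 [+ + [ej' ei']]]] /= ii.
rewrite -{}ej -{}ei -{}ej' -{}ei' -{}ii {j1 i1 j2 i2 i'} !mem_index_iota.
rewrite /block_start; case: j => // j; case: j' => // j' _ /= h1 _ h2.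
by congr (_.+1, _); nia.
Qed.

End counting.

(** * Independence by pi-lambda arguments *)

Section dynkin_arguments.
Context {R : realType} {d : measure_display} {U : measurableType d}.
Variable Q : probability U R.
Local Open Scope ereal_scope.

(** The events [A] for which the product formula holds form a Dynkin system. *)
Lemma indep_generated_l (G : set (set U)) (B : set U) :
  G `<=` measurable -> setI_closed G -> measurable B ->
  (forall A, G A -> Q (A `&` B) = Q A * Q B) ->
  forall A, <<s G >> A -> Q (A `&` B) = Q A * Q B.
Proof.
move=> Gm GI mB GB A; rewrite -setI_closed_g_dynkin_g_sigma_algebra// => dA.
suff [] : [set A | measurable A /\ Q (A `&` B) = Q A * Q B] A by [].
have QBf : Q B \is a fin_num by rewrite fin_num_measure.
apply: dA; split; last by move=> C GC; split; [exact: Gm|exact: GB].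
split.
- by split=> //; rewrite setTI probability_setT mul1e.
- move=> C [mC CB]; split; first exact: measurableC.
  have QCf : Q C \is a fin_num by rewrite fin_num_measure.
  rewrite setIC -setDE measureD//; last by rewrite ltey_eq QBf.
  rewrite setIC [X in _ - X]CB probability_setC// muleBl//; first by rewrite mul1e.
- move=> F tF HF; have mF i : measurable (F i) by case: (HF i).
  split; first exact: bigcupT_measurable.
  rewrite setI_bigcupl measure_semi_bigcup; last 3 first.
  + by move=> i; exact: measurableI.
  + exact: trivIset_setIr.
  + by apply: bigcupT_measurable => i; exact: measurableI.
  rewrite measure_semi_bigcup//; last exact: bigcupT_measurable.
  rewrite -(fineK QBf) muleC -nneseriesZl//.
  by apply: eq_eseriesr => i _; rewrite (fineK QBf) muleC; case: (HF i).
Qed.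

Lemma indep_generated (G1 G2 : set (set U)) :
  G1 `<=` measurable -> G2 `<=` measurable ->
  setI_closed G1 -> setI_closed G2 ->
  (forall A B, G1 A -> G2 B -> Q (A `&` B) = Q A * Q B) ->
  forall A B, <<s G1 >> A -> <<s G2 >> B -> Q (A `&` B) = Q A * Q B.
Proof.
move=> G1m G2m G1I G2I G12 A B sA sB.
have mB : measurable B.
  by apply: (smallest_sub _ G2m sB); exact: sigma_algebra_measurable.
apply: (indep_generated_l G1m) => // C GC.
rewrite setIC muleC; apply: (indep_generated_l G2m) => //; first exact: G1m.
by move=> D GD; rewrite setIC muleC; exact: G12.
Qed.

(** The sets that two random variables charge equally form a Dynkin system. *)
Lemma eq_law_generated {d'} {V : measurableType d'} (f g : U -> V)
    (G : set (set V)) :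
  measurable_fun [set: U] f -> measurable_fun [set: U] g ->
  G `<=` measurable -> setI_closed G ->
  (forall A, G A -> Q (f @^-1` A) = Q (g @^-1` A)) ->
  forall A, <<s G >> A -> Q (f @^-1` A) = Q (g @^-1` A).
Proof.
move=> mf mg Gm GI fg A; rewrite -setI_closed_g_dynkin_g_sigma_algebra// => dA.
suff [] : [set A | measurable A /\ Q (f @^-1` A) = Q (g @^-1` A)] A by [].
have mfi C : measurable C -> measurable (f @^-1` C).
  by move=> mC; rewrite -[X in measurable X]setTI; exact: mf.
have mgi C : measurable C -> measurable (g @^-1` C).
  by move=> mC; rewrite -[X in measurable X]setTI; exact: mg.
apply: dA; split; last by move=> C GC; split; [exact: Gm|exact: fg].
split.
- by split=> //; rewrite !preimage_setT.
- move=> C [mC CB]; split; first exact: measurableC.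
  rewrite -!preimage_setC !probability_setC ?CB//; [exact: mgi|exact: mfi].
- move=> F tF HF; have mF i : measurable (F i) by case: (HF i).
  split; first exact: bigcupT_measurable.
  have tri (h : U -> V) : trivIset setT (fun i => h @^-1` F i).
    apply/trivIsetP => i j _ _ ij.
    by rewrite -preimage_setI (trivIsetP.1 tF)// preimage_set0.
  rewrite !preimage_bigcup !measure_semi_bigcup//; try exact: tri.
  + by apply: eq_eseriesr => i _; case: (HF i).
  + by move=> i; exact: mgi.
  + by apply: bigcupT_measurable => i; exact: mgi.
  + by move=> i; exact: mfi.
  + by apply: bigcupT_measurable => i; exact: mfi.
Qed.

(** Measurable rectangles form a pi-system that generates the product
    sigma-algebra. *)
Lemma eq_pair_law {d1 d2} {V : measurableType d1} {W : measurableType d2}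
    (f f' : U -> V) (g g' : U -> W) :
  measurable_fun [set: U] f -> measurable_fun [set: U] f' ->
  measurable_fun [set: U] g -> measurable_fun [set: U] g' ->
  (forall A B, measurable A -> measurable B ->
     Q (f @^-1` A `&` g @^-1` B) = Q (f' @^-1` A `&` g' @^-1` B)) ->
  forall C, measurable C ->
    Q [set w | C (f w, g w)] = Q [set w | C (f' w, g' w)].
Proof.
move=> mf mf' mg mg' E C; rewrite measurable_prod_measurableType.
apply: (@eq_law_generated _ _ (fun w => (f w, g w)) (fun w => (f' w, g' w))).
- exact: measurable_fun_pair.
- exact: measurable_fun_pair.
- by move=> _ [A mA [B mB <-]]; exact: measurableX.
- move=> _ _ [A mA [B mB <-]] [A' mA' [B' mB' <-]].
  by exists (A `&` A'); [exact: measurableI|exists (B `&` B');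
    [exact: measurableI|rewrite setXI]].
- by move=> _ [A mA [B mB <-]]; exact: E.
Qed.

End dynkin_arguments.

Section independent_sequence.
Context {R : realType} {d : measure_display} {U : measurableType d}.
Variables (Q : probability U R) (e : nat -> U -> R) (n : nat).
Hypothesis e_measurable : forall i, (i <= n)%N -> measurable_fun [set: U] (e i).
Hypothesis e_indep : forall B : nat -> set R, (forall i, measurable (B i)) ->
  Q (\bigcap_(i in [set i | (i <= n)%N]) e i @^-1` B i) =
  (\prod_(i < n.+1) Q (e i @^-1` B i))%E.

(** The events that constrain only the variables whose index is in [I], written
    with a full family of constraints so that the product formula applies to
    the intersection of two of them without reindexing. *)
Definition cylinders (I : pred nat) : set (set U) :=
  [set A | exists B : nat -> set R, [/\ forall i, measurable (B i),
     forall i, ~~ I i -> B i = setT &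
     A = \bigcap_(i in [set i | (i <= n)%N]) e i @^-1` B i]].

Lemma cylinders_measurable I : cylinders I `<=` measurable.
Proof.
move=> _ [B [mB _ ->]]; apply: bigcap_measurable => [|i /= ilen]; first by exists 0.
by rewrite -[X in measurable X]setTI; exact: e_measurable.
Qed.

Lemma cylinders_setI I : setI_closed (cylinders I).
Proof.
move=> _ _ [B [mB BT ->]] [C [mC CT ->]].
exists (fun i => B i `&` C i); split; first by move=> i; exact: measurableI.
  by move=> i Ii; rewrite BT// CT// setTI.
by rewrite -bigcapI; apply: eq_bigcapr => i _; rewrite preimage_setI.
Qed.

(** At each index one of the two constraints is trivial, so the product formula
    for the intersection factors; the pi-lambda argument extends this to the
    generated sigma-algebras. *)
Lemma cylinders_indep I J : (forall i, ~~ (I i && J i)) ->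
  forall A B, <<s cylinders I >> A -> <<s cylinders J >> B ->
  Q (A `&` B) = (Q A * Q B)%E.
Proof.
move=> IJ; apply: indep_generated;
  [exact: cylinders_measurable|exact: cylinders_measurable|
   exact: cylinders_setI|exact: cylinders_setI|].
move=> _ _ [B [mB BT ->]] [C [mC CT ->]].
rewrite -bigcapI [in LHS](eq_bigcapr (fun i _ => esym (preimage_setI _ _ _))).
rewrite !e_indep//; last by move=> i; exact: measurableI.
rewrite -big_split/=; apply: eq_bigr => i _.
have [Ii|/BT ->] := boolP (I i); last by rewrite setTI preimage_setT probability_setT mul1e.
rewrite (CT i) ?setIT ?preimage_setT ?probability_setT ?mule1//.
by have := IJ i; rewrite Ii.
Qed.

Local Notation Sigma I := (g_sigma_algebraType (cylinders I)).

Lemma coordinate_measurable (I : pred nat) i : I i -> (i <= n)%N ->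
  measurable_fun [set: Sigma I] (e i : Sigma I -> R).
Proof.
move=> Ii ilen _ B mB; rewrite setTI; apply: sub_sigma_algebra.
exists (fun l => if l == i then B else setT); split.
- by move=> l; case: ifP.
- by move=> l; case: eqP => // ->; rewrite Ii.
- apply/seteqP; split=> [w Bw l _|w /(_ i ilen)/=]; last by rewrite eqxx.
  by rewrite /preimage/=; case: eqP => // ->.
Qed.

(** The form in which independence is used below. *)
Lemma cylinder_preimages_indep {d1 d2} {V : measurableType d1} {W : measurableType d2}
    (I J : pred nat) (f : U -> V) (g : U -> W) : (forall i, ~~ (I i && J i)) ->
  measurable_fun [set: Sigma I] (f : Sigma I -> V) ->
  measurable_fun [set: Sigma J] (g : Sigma J -> W) ->
  forall A B, measurable A -> measurable B ->
  Q (f @^-1` A `&` g @^-1` B) = (Q (f @^-1` A) * Q (g @^-1` B))%E.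
Proof.
move=> IJ mf mg A B mA mB; apply: (cylinders_indep IJ).
  by have := mf measurableT A mA; rewrite setTI.
by have := mg measurableT B mB; rewrite setTI.
Qed.

End independent_sequence.

(** * Expectations of real random variables *)

Section expectations.
Context {R : realType} {d : measure_display} {U : measurableType d}.
Variable Q : probability U R.
Implicit Types f g : U -> R.

Local Notation Integrable f := (Q.-integrable [set: U] (EFin \o f)).

Lemma integrable_bounded f (C : R) : measurable_fun [set: U] f ->
  (forall w, `|f w| <= C) -> Integrable f.
Proof.
move=> mf fC; apply: measurable_bounded_integrable => //.
  by rewrite fin_num_fun_lty// fin_num_measure.
exists C; split; first exact: num_real.
by move=> M CM w _ /=; exact: le_trans (fC w) (ltW CM).
Qed.

Lemma integrableDr f g : Integrable f -> Integrable g -> Integrable (fun w => f w + g w).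
Proof.
move=> intf intg.
have -> : EFin \o (fun w => f w + g w) = ((EFin \o f) \+ (EFin \o g))%E by [].
exact: integrableD.
Qed.

Lemma integrableZr f (c : R) : Integrable f -> Integrable (fun w => c * f w).
Proof.
move=> intf.
have -> : EFin \o (fun w => c * f w) = (fun w => c%:E * (EFin \o f) w)%E by [].
exact: integrableZl.
Qed.

Lemma integrable_sumr (I : eqType) (s : seq I) (g : I -> U -> R) :
  (forall i, i \in s -> Integrable (g i)) -> Integrable (fun w => \sum_(i <- s) g i w).
Proof.
elim: s => [_|i s IH intg].
  by under eq_fun do rewrite big_nil; exact: integrable0.
under eq_fun do rewrite big_cons.
apply: integrableDr; first by apply: intg; rewrite mem_head.
by apply: IH => l ls; apply: intg; rewrite in_cons ls orbT.
Qed.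

Lemma Rintegral_cst_prob (c : R) : \int[Q]_w c = c.
Proof. by rewrite Rintegral_cst// [X in _ * fine X](probability_setT Q) mulr1. Qed.

Lemma integrable_cst (c : R) : Integrable (fun=> c).
Proof. exact: finite_measure_integrable_cst. Qed.

Lemma Rintegral_sumr (I : eqType) (s : seq I) (g : I -> U -> R) :
  (forall i, i \in s -> Integrable (g i)) ->
  \int[Q]_w (\sum_(i <- s) g i w) = \sum_(i <- s) \int[Q]_w g i w.
Proof.
elim: s => [_|i s IH intg].
  by under eq_Rintegral do rewrite big_nil; rewrite Rintegral_cst_prob big_nil.
under eq_Rintegral do rewrite big_cons.
have intgs l : l \in s -> Integrable (g l) by move=> ls; apply: intg; rewrite in_cons ls orbT.
rewrite RintegralD// ?IH ?big_cons//; last exact: integrable_sumr.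
by apply: intg; rewrite mem_head.
Qed.

Lemma integrable_mean_over (I : eqType) (s : seq I) (g : I -> U -> R) :
  (forall i, i \in s -> Integrable (g i)) -> Integrable (fun w => mean_over s (g^~ w)).
Proof. by move=> intg; exact/integrableZr/integrable_sumr. Qed.

Lemma Rintegral_mean_over (I : eqType) (s : seq I) (g : I -> U -> R) :
  (forall i, i \in s -> Integrable (g i)) ->
  \int[Q]_w mean_over s (g^~ w) = mean_over s (fun i => \int[Q]_w g i w).
Proof.
move=> intg; rewrite /mean_over RintegralZl ?Rintegral_sumr//.
exact: integrable_sumr.
Qed.

Lemma integrable_indicator (A : set U) : measurable A -> Integrable \1_A.
Proof. by move=> mA; exact: integrable_indic. Qed.

Lemma Rintegral_indicator (A : set U) :
  measurable A -> \int[Q]_w \1_A w = fine (Q A).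
Proof. by move=> mA; rewrite /Rintegral integral_indic// setIT. Qed.

Lemma superlevel_measurable f (x : R) : measurable_fun [set: U] f ->
  measurable [set w | x <= f w].
Proof.
move=> mf.
have -> : [set w | x <= f w] = setT `&` f @^-1` `[x, +oo[.
  by apply/seteqP; split=> w /=; rewrite in_itv/= andbT// => -[].
exact: mf.
Qed.

(** [f] dominates [x] times the indicator function of the event. *)
Lemma markov_inequality f (x : R) : Integrable f -> (forall w, 0 <= f w) ->
  0 < x -> (Q [set w | (x <= f w)%R] <= (x^-1 * \int[Q]_w f w)%:E)%E.
Proof.
move=> intf f0 x0.
have mf : measurable_fun [set: U] f by apply/measurable_EFinP; exact: measurable_int intf.
have mA := superlevel_measurable x mf.
rewrite -[leLHS]fineK ?fin_num_measure// lee_fin -Rintegral_indicator//.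
rewrite -ler_pdivrMl ?invr_gt0// invrK -RintegralZl//; last exact: integrable_indicator.
apply: le_Rintegral => //; first exact/integrableZr/integrable_indicator.
move=> w _; rewrite indicE; case: (boolP (_ \in _)) => [|_]; last by rewrite mulr0.
by rewrite inE/= mulr1.
Qed.

End expectations.

(** * Laws of large numbers under finite-range dependence *)

Section laws_of_large_numbers.
Context {R : realType} {d : measure_display} {U : measurableType d}.
Variable Q : probability U R.

Local Notation Integrable f := (Q.-integrable [set: U] (EFin \o f)).

(** The five values are [i - 2], ..., [i + 2]. *)
Lemma count_near_le5 (s : seq nat) (i : nat) : uniq s ->
  (\sum_(l <- s) ((i < l + 3) && (l < i + 3)) <= 5)%N.
Proof.
move=> us; rewrite -big_mkcond sum1_count -size_filter.
rewrite -(size_iota (i - 2) 5) uniq_leq_size ?filter_uniq// => l.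
by rewrite mem_filter mem_iota => /andP[/andP[? ?] _]; lia.
Qed.

(** In the expansion of the square, the covariances at lag 3 or more vanish; each
    index has at most five indices at lag 2 or less, itself included, and each
    of those covariances is at most 1. *)
Lemma indicator_sum_second_moment (s : seq nat) (E : nat -> set U) (p : R) :
  uniq s ->
  (forall i, i \in s -> measurable (E i)) ->
  (forall i, i \in s -> Q (E i) = p%:E) ->
  (forall i l, i \in s -> l \in s -> (i + 3 <= l)%N ->
     Q (E i `&` E l) = (p * p)%:E) ->
  \int[Q]_w (\sum_(i <- s) (\1_(E i) w - p)) ^+ 2 <= 5 * (size s)%:R.
Proof.
move=> us mE QE indepE.
pose a i w : R := \1_(E i) w - p.
have expand i l w : a i w * a l w =
    \1_(E i `&` E l) w + ((- p) * \1_(E i) w + ((- p) * \1_(E l) w + p * p)).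
  by rewrite /a indicI/=; ring.
have inte i : i \in s -> Integrable \1_(E i).
  by move=> /mE; exact: integrable_indicator.
have inta i l : i \in s -> l \in s -> Integrable (fun w => a i w * a l w).
  move=> si sl; under eq_fun do rewrite expand.
  apply: integrableDr; first by apply: integrable_indicator; apply: measurableI; exact: mE.
  apply: integrableDr; first by apply: integrableZr; exact: inte.
  apply: integrableDr; first by apply: integrableZr; exact: inte.
  exact: integrable_cst.
have Ea i l : i \in s -> l \in s ->
    \int[Q]_w (a i w * a l w) = fine (Q (E i `&` E l)) - p * p.
  move=> si sl; under eq_Rintegral do rewrite expand.
  have mil : measurable (E i `&` E l) by apply: measurableI; exact: mE.
  have intp j : j \in s -> Integrable (fun w => - p * \1_(E j) w).
    by move=> sj; apply: integrableZr; exact: inte.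
  rewrite !RintegralD// ?RintegralZl ?Rintegral_indicator ?Rintegral_cst_prob//;
    try by [exact: integrable_indicator|exact: inte|exact: intp|
      exact: integrable_cst|exact: mE|
      apply: integrableDr; [exact: intp|exact: integrable_cst]|
      apply: integrableDr; [exact: intp|
        apply: integrableDr; [exact: intp|exact: integrable_cst]]].
  by rewrite !QE//=; ring.
under eq_Rintegral do rewrite expr2 big_distrlr/=.
have introw i : i \in s -> Integrable (fun w => \sum_(l <- s) a i w * a l w).
  by move=> si; apply: integrable_sumr => l sl; exact: inta.
rewrite Rintegral_sumr//.
have row i : i \in s -> \int[Q]_w (\sum_(l <- s) a i w * a l w) <= 5.
  move=> si; rewrite Rintegral_sumr; last by move=> l sl; exact: inta.
  apply: (@le_trans _ _ (\sum_(l <- s) ((i < l + 3) && (l < i + 3))%N%:R)); last first.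
    by rewrite -natr_sum ler_nat; exact: count_near_le5.
  rewrite big_seq [leRHS]big_seq; apply: ler_sum => l sl; rewrite Ea//.
  have [il|il] := leqP (i + 3) l.
    by rewrite indepE//= subrr.
  have [li|li] /= := leqP (l + 3) i.
    by rewrite setIC indepE//= subrr.
  rewrite lerBlDr ler_wpDr ?sqr_ge0//.
  have mil : measurable (E i `&` E l) by apply: measurableI; exact: mE.
  by rewrite -lee_fin fineK ?fin_num_measure// probability_le1.
apply: (@le_trans _ _ (\sum_(i <- s) 5)).
  by rewrite big_seq [leRHS]big_seq; exact: ler_sum.
by rewrite big_const_seq count_predT iter_addr addr0 mulr_natr.
Qed.

(** Chebyshev's inequality in L1 form: [|D| <= y + D^2 / y] with
    [y = lambda size s].  The threshold on the size of [s] does not depend on the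
    events. *)
Lemma indicator_lln (s : seq nat) (E : nat -> set U) (p lambda : R) :
  0 < lambda -> 5 <= lambda ^+ 2 * (size s)%:R ->
  uniq s ->
  (forall i, i \in s -> measurable (E i)) ->
  (forall i, i \in s -> Q (E i) = p%:E) ->
  (forall i l, i \in s -> l \in s -> (i + 3 <= l)%N ->
     Q (E i `&` E l) = (p * p)%:E) ->
  \int[Q]_w `|mean_over s (fun i => \1_(E i) w) - p| <= 2 * lambda.
Proof.
move=> l0 sl us mE QE indepE.
have N0 : 0 < (size s)%:R :> R.
  have : 0 < lambda ^+ 2 * (size s)%:R by apply: lt_le_trans sl.
  by rewrite pmulr_rgt0// exprn_gt0.
have := indicator_sum_second_moment us mE QE indepE.
set N := (size s)%:R in sl N0 *; set D := fun w => \sum_(i <- s) (\1_(E i) w - p).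
move=> D2.
have meanD w : mean_over s (fun i => \1_(E i) w) - p = N^-1 * D w.
  rewrite /D /mean_over sumrB big_const_seq count_predT iter_addr addr0 mulrBr.
  by rewrite -(mulr_natl p) mulKf// gt_eqF.
have mD : measurable_fun [set: U] D.
  apply/measurable_EFinP/(@measurable_int _ _ _ Q).
  apply: integrable_sumr => i si; apply: integrableDr; last exact: integrable_cst.
  exact/integrable_indicator/mE.
have Db w : `|D w| <= N * (1 + `|p|).
  apply: le_trans (ler_norm_sum _ _ _) _.
  rewrite mulr_natl -[X in _ *+ X]count_predT -iter_addr_0 -big_const_seq.
  apply: ler_sum => i _; apply: le_trans (ler_normB _ _) _; rewrite lerD2r.
  by rewrite indicE ger0_norm// lern1 leq_b1.
have intD2 : Integrable (fun w => D w ^+ 2).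
  apply: (@integrable_bounded _ _ _ Q _ ((N * (1 + `|p|)) ^+ 2)).
    exact: measurable_funX.
  by move=> w; rewrite normrX lerXn2r// ?nnegrE ?mulr_ge0 ?addr_ge0// ltW.
have intD : Integrable (fun w => `|D w|).
  apply: (@integrable_bounded _ _ _ Q _ (N * (1 + `|p|))); last by move=> w; rewrite normr_id.
  exact: measurableT_comp.
under eq_Rintegral do rewrite meanD normrM ger0_norm ?invr_ge0 ?(ltW N0)//.
rewrite RintegralZl// ler_pdivrMl//.
apply: (@le_trans _ _ (\int[Q]_w (lambda * N + (lambda * N)^-1 * D w ^+ 2))).
  apply: le_Rintegral => //.
    by apply: integrableDr; [exact: integrable_cst|exact: integrableZr].
  move=> w _; have y0 : 0 < lambda * N by rewrite mulr_gt0.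
  rewrite -[D w ^+ 2]real_normK ?num_real// -(ler_pM2l y0) mulrDr mulVKf ?gt_eqF//.
  have := normr_ge0 (D w); move: (lambda * N) `|D w| y0 => y x y0 x0; nra.
rewrite RintegralD// ?Rintegral_cst_prob ?RintegralZl//; last 2 first.
  exact: integrable_cst.
  exact: integrableZr.
have y0 : 0 < lambda * N by rewrite mulr_gt0.
have : (lambda * N)^-1 * \int[Q]_w D w ^+ 2 <= lambda * N.
  rewrite ler_pdivrMl//; apply: le_trans D2 _.
  by rewrite -expr2 exprMn [N ^+ 2]expr2 mulrA ler_wpM2r// ltW.
lra.
Qed.

(** Both sides are the integral of [h] against the common law. *)
Lemma eq_law_integral (f g : U -> R) (h : R -> \bar R) :
  measurable_fun [set: U] f -> measurable_fun [set: U] g ->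
  measurable_fun [set: R] h -> (forall x, (0 <= h x)%E) ->
  (forall B : set R, measurable B -> Q (f @^-1` B) = Q (g @^-1` B)) ->
  (\int[Q]_w h (f w) = \int[Q]_w h (g w))%E.
Proof.
move=> mf mg mh h0 fg.
pose F : {mfun U >-> R} := mfun_Sub (mem_set mf).
pose G : {mfun U >-> R} := mfun_Sub (mem_set mg).
have := @ge0_integral_distribution _ _ _ _ _ Q F _ mh h0.
have := @ge0_integral_distribution _ _ _ _ _ Q G _ mh h0.
move=> <- <-; apply: eq_measure_integral => A mA _; exact: fg.
Qed.

Import HBSimple.

(** [g] is applied to the value of [Z0] rather than to the outcome, so that it
    approximates equally well every variable with the law of [Z0]. *)
Lemma simple_approximation (Z0 : {RV Q >-> R}) (eps : R) :
  Integrable Z0 -> 0 < eps -> exists g : R -> R,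
    [/\ measurable_fun [set: R] g, finite_set (range g) &
    (\int[Q]_w (`|Z0 w - g (Z0 w)|)%:E <= eps%:E)%E].
Proof.
move=> intZ0 eps0.
have idint : (distribution Q Z0).-integrable [set: R] (EFin \o id).
  apply/integrableP; split; first exact/measurable_EFinP.
  rewrite ge0_integral_distribution//.
    by have /integrableP[] := intZ0.
  by apply: measurableT_comp => //; exact/measurable_EFinP.
have [g [_ _ cg]] := approximation_sfun_integrable measurableT idint.
have : \forall n \near \oo, (\int[distribution Q Z0]_z
    `|(EFin \o id) z - (g n z)%:E| < eps%:E)%E.
  by apply: (cg (fun y => y < eps%:E)%E); apply: open_ereal_lt'; rewrite lte_fin.
move=> [n _ /(_ n (leqnn n))] H; exists (g n); split => //.
apply: le_trans (ltW H); rewrite ge0_integral_distribution//=.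
by do 2 apply: measurableT_comp => //; exact: measurable_funB.
Qed.


(** Only a first moment is available, so the variables are first replaced by
    [g] of them with [g] finitely valued; the average of [g (Z i)] is a finite
    combination of frequencies, to which [indicator_lln] applies.  [N0] depends
    only on [eps] and the common law, which makes the bound uniform over blocks and over
    sample sizes. *)
Lemma lln_L1 (Z0 : {RV Q >-> R}) (eps : R) : Integrable Z0 -> 0 < eps ->
  exists N0 : nat, forall (Z : nat -> U -> R) (s : seq nat),
    uniq s -> (N0 <= size s)%N ->
    (forall i, i \in s -> measurable_fun [set: U] (Z i)) ->
    (forall i, i \in s -> forall B, measurable B -> Q (Z i @^-1` B) = Q (Z0 @^-1` B)) ->
    (forall i l, i \in s -> l \in s -> (i + 3 <= l)%N -> forall B, measurable B ->
       Q (Z i @^-1` B `&` Z l @^-1` B) = (Q (Z i @^-1` B) * Q (Z l @^-1` B))%E) ->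
    \int[Q]_w `|mean_over s (Z^~ w) - \int[Q]_w Z0 w| <= eps.
Proof.
move=> intZ0 eps0; have eps4 : 0 < eps / 4 by rewrite divr_gt0.
have [g [mg fg gclose]] := simple_approximation intZ0 eps4.
have /finite_seqP[D0 rD] := fg; pose D := undup D0.
pose K : R := \sum_(y <- D) `|y|.
have K0 : 0 <= K by rewrite sumr_ge0.
pose lambda := eps / (8 * (K + 1)).
have l0 : 0 < lambda by rewrite divr_gt0// mulr_gt0// ltr_wpDl.
have [N0 HN0] : exists N0 : nat, forall N : nat, (N0 <= N)%N -> 5 <= lambda ^+ 2 * N%:R.
  have l20 : 0 < lambda ^+ 2 by rewrite exprn_gt0.
  exists (Num.truncn (5 / lambda ^+ 2)).+1 => N HN; rewrite -ler_pdivrMl// mulrC.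
  by rewrite (le_trans (ltW (truncnS_gt _)))// ler_nat.
exists N0 => Z s us sN mZ lawZ indepZ.
have s0 : (size s)%:R != 0 :> R.
  by apply/eqP => e; have := HN0 _ sN; rewrite e mulr0; lra.
have mZ0 : measurable_fun [set: U] Z0 by [].
have gD x : g x \in D.
  by rewrite mem_undup; change ([set` D0] (g x)); rewrite -rD; exists x.
have gE x : g x = \sum_(y <- D) y * \1_(g @^-1` [set y]) x.
  rewrite (big_rem (g x)) ?gD//= indicE mem_set// mulr1 big_seq big1 ?addr0//.
  move=> y; rewrite mem_rem_uniq ?undup_uniq// inE => /andP[ny _].
  rewrite indicE memNset ?mulr0// => /= gy; by rewrite gy eqxx in ny.
have mpre y : measurable (g @^-1` [set y]).
  by rewrite -[X in measurable X]setTI; exact: mg.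
have mE i y : i \in s -> measurable (Z i @^-1` (g @^-1` [set y])).
  by move=> si; rewrite -[X in measurable X]setTI; exact: mZ.
pose p y := fine (Q (Z0 @^-1` (g @^-1` [set y]))).
have gb x : `|g x| <= K by rewrite /K (big_rem (g x)) ?gD//= lerDl sumr_ge0.
have intgZ (f : U -> R) : measurable_fun [set: U] f -> Integrable (g \o f).
  move=> mf; apply: (@integrable_bounded _ _ _ Q _ K); last by move=> w; exact: gb.
  exact: measurableT_comp.
have intdiff (f : U -> R) : measurable_fun [set: U] f -> Integrable f ->
    Integrable (fun w => `|f w - g (f w)|).
  move=> mf intf; apply: integrable_norm; apply: (integrableDr intf).
  have -> : (fun w => - g (f w)) = (fun w => -1 * (g \o f) w).
    by apply/funext => w; rewrite mulN1r.
  by apply: integrableZr; exact: intgZ.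
have intZ i : i \in s -> Integrable (Z i).
  move=> si; apply/integrableP; split; first exact/measurable_EFinP/mZ.
  have /integrableP[_] := intZ0; apply: le_lt_trans; rewrite le_eqVlt; apply/orP; left.
  apply/eqP/(@eq_law_integral _ _ (fun x => `|x%:E|)%E) => //.
  - exact: mZ.
  - by apply: measurableT_comp => //; exact/measurable_EFinP.
  - exact: lawZ.
have mh : measurable_fun [set: R] (fun x => `|x - g x|).
  by apply: measurableT_comp => //; exact: measurable_funB.
have Eabs i : i \in s -> \int[Q]_w `|Z i w - g (Z i w)| <= eps / 4.
  move=> si; rewrite -lee_fin fineK//; last first.
    apply: integrable_fin_num => //; apply: intdiff; [exact: mZ|exact: intZ].
  rewrite (@eq_law_integral _ Z0 (fun x => (`|x - g x|)%:E))//.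
  - exact: mZ.
  - exact/measurable_EFinP.
  - exact: lawZ.
have mp y : measurable (Z0 @^-1` (g @^-1` [set y])).
  by rewrite -[X in measurable X]setTI; exact: mZ0.
have intp y : Integrable (fun w => y * \1_(Z0 @^-1` (g @^-1` [set y])) w).
  by apply: integrableZr; exact: integrable_indicator.
have Eg : \int[Q]_w g (Z0 w) = \sum_(y <- D) y * p y.
  under eq_Rintegral do rewrite gE.
  rewrite Rintegral_sumr//; apply: eq_bigr => y _.
  rewrite RintegralZl ?(Rintegral_indicator _ (mp y))//.
  exact: (integrable_indicator Q (mp y)).
have close0 : `|\int[Q]_w g (Z0 w) - \int[Q]_w Z0 w| <= eps / 4.
  rewrite distrC -RintegralB//; last exact: intgZ.
  apply: le_trans (le_normr_Rintegral measurableT _) _.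
    by have := integrableB measurableT intZ0 (intgZ _ mZ0).
  by rewrite -lee_fin fineK//; apply: integrable_fin_num => //; exact: intdiff.
pose M y w := `|mean_over s (fun i => \1_(Z i @^-1` (g @^-1` [set y])) w) - p y|.
have EM y : \int[Q]_w M y w <= 2 * lambda.
  have Qp : Q (Z0 @^-1` (g @^-1` [set y])) = (p y)%:E by rewrite fineK// fin_num_measure.
  apply: indicator_lln => //.
  - exact: HN0.
  - by move=> i si; exact: mE.
  - by move=> i si; rewrite lawZ.
  - by move=> i l si sl il; rewrite indepZ// !lawZ// Qp.
have intM y : Integrable (M y).
  apply: integrable_norm; apply: integrableDr; last exact: integrable_cst.
  by apply: integrable_mean_over => i si; exact: integrable_indicator (mE _ _ si).
pose bound w := mean_over s (fun i => `|Z i w - g (Z i w)|) +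
   (\sum_(y <- D) `|y| * M y w + eps / 4).
have le_bound w : `|mean_over s (Z^~ w) - \int[Q]_w Z0 w| <= bound w.
  have -> : mean_over s (Z^~ w) - \int[Q]_w Z0 w =
      mean_over s (fun i => Z i w - g (Z i w)) +
      ((mean_over s (fun i => g (Z i w)) - \int[Q]_w g (Z0 w)) +
       (\int[Q]_w g (Z0 w) - \int[Q]_w Z0 w)).
    have -> : mean_over s (Z^~ w) =
        mean_over s (fun i => Z i w - g (Z i w)) + mean_over s (fun i => g (Z i w)).
      by rewrite -mean_overD; congr mean_over; apply/funext => i; rewrite subrK.
    by rewrite subrKA addrA.
  apply: le_trans (ler_normD _ _) _; apply: lerD; first exact: norm_mean_over.
  apply: le_trans (ler_normD _ _) _; apply: lerD; last exact: close0.
  under [X in mean_over s X]funext do rewrite gE.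
  rewrite mean_over_exchange Eg -sumrB.
  apply: le_trans (ler_norm_sum _ _ _) _; apply: ler_sum => y _.
  by rewrite mean_overZ -mulrBr normrM.
have intabs : Integrable (fun w => mean_over s (fun i => `|Z i w - g (Z i w)|)).
  by apply: integrable_mean_over => i si; apply: intdiff; [exact: mZ|exact: intZ].
have intS : Integrable (fun w => \sum_(y <- D) `|y| * M y w).
  by apply: integrable_sumr => y _; exact: integrableZr.
have intSc : Integrable (fun w => \sum_(y <- D) `|y| * M y w + eps / 4).
  by apply: integrableDr => //; exact: integrable_cst.
apply: (@le_trans _ _ (\int[Q]_w bound w)).
  apply: le_Rintegral => //; last exact: integrableDr.
  apply: integrable_norm; apply: integrableDr; last exact: integrable_cst.
  exact: integrable_mean_over.
rewrite RintegralD// RintegralD//; last exact: integrable_cst.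
rewrite Rintegral_cst_prob Rintegral_mean_over; last first.
  by move=> i si; apply: intdiff; [exact: mZ|exact: intZ].
rewrite Rintegral_sumr; last by move=> y _; exact: integrableZr.
rewrite [leRHS](_ : _ = eps / 4 + (eps / 2 + eps / 4)); last by field.
apply: lerD; last apply: lerD; last by [].
  by rewrite -[leRHS](mean_over_cst _ s0); apply: mean_over_le.
apply: (@le_trans _ _ (\sum_(y <- D) `|y| * (2 * lambda))).
  by apply: ler_sum => y _; rewrite RintegralZl// ler_wpM2l.
have K1 : 0 < K + 1 by rewrite ltr_wpDl.
have lE : lambda * (8 * (K + 1)) = eps by rewrite divfK// gt_eqF// mulr_gt0.
rewrite -mulr_suml -/K -lE; nra.
Qed.

End laws_of_large_numbers.

(** * Laws and moments of the noise *)

Section noise_laws.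
Context {R : realType} {d : measure_display} {U : measurableType d}.
Variables (Q : probability U R) (eps : nat -> nat -> {RV Q >-> R}).
Hypothesis eps_indep : forall n (B : nat -> set R), (forall i, measurable (B i)) ->
  Q (\bigcap_(i in [set i | (i <= n)%N]) eps n i @^-1` B i) =
  (\prod_(i < n.+1) Q (eps n i @^-1` B i))%E.
Hypothesis eps_ident : forall n i n' i' (B : set R), (i <= n)%N -> (i' <= n')%N ->
  measurable B -> distribution Q (eps n i) B = distribution Q (eps n' i') B.

Local Notation Integrable f := (Q.-integrable [set: U] (EFin \o f)).

Definition noise n (w : U) : nat -> R := fun l => eps n l w.

Let Sigma n (I : pred nat) := g_sigma_algebraType (cylinders (eps n) n I).

Lemma noise_measurable n (I : pred nat) i : I i -> (i <= n)%N ->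
  measurable_fun [set: Sigma n I] (eps n i : Sigma n I -> R).
Proof. by move=> Ii ilen; exact: coordinate_measurable. Qed.

Lemma eps_preimages_indep {d1 d2} {V : measurableType d1} {W : measurableType d2}
    n (I J : pred nat) (f : U -> V) (g : U -> W) : (forall i, ~~ (I i && J i)) ->
  measurable_fun [set: Sigma n I] (f : Sigma n I -> V) ->
  measurable_fun [set: Sigma n J] (g : Sigma n J -> W) ->
  forall A B, measurable A -> measurable B ->
  Q (f @^-1` A `&` g @^-1` B) = (Q (f @^-1` A) * Q (g @^-1` B))%E.
Proof.
by move=> IJ mf mg A B; apply: (@cylinder_preimages_indep _ _ _ Q (eps n) n) => //;
  exact: eps_indep.
Qed.

(** Both laws are the product of the same marginals; likewise for triples, by
    independence of the first entry from the remaining pair. *)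
Lemma noise_pair_law n i n' i' (C : set (R * R)) :
  (1 <= i <= n)%N -> (1 <= i' <= n')%N -> measurable C ->
  Q [set w | C (eps n i w, eps n i.-1 w)] = Q [set w | C (eps n' i' w, eps n' i'.-1 w)].
Proof.
move=> i1n i1n'; apply: eq_pair_law => // A B mA mB.
have prod m l : (1 <= l <= m)%N -> Q (eps m l @^-1` A `&` eps m l.-1 @^-1` B) =
    (Q (eps m l @^-1` A) * Q (eps m l.-1 @^-1` B))%E.
  move=> lm; apply: (@eps_preimages_indep _ _ _ _ m (pred1 l) (pred1 l.-1)) => //.
  - by move=> p /=; lia.
  - by apply: noise_measurable => /=; rewrite ?eqxx//; lia.
  - by apply: noise_measurable => /=; rewrite ?eqxx//; lia.
rewrite !prod//; congr (_ * _)%E; apply: eps_ident => //; lia.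
Qed.

Lemma noise_triple_law n i n' i' (C : set (R * (R * R))) :
  (2 <= i <= n)%N -> (2 <= i' <= n')%N -> measurable C ->
  Q [set w | C (eps n i w, (eps n i.-1 w, eps n i.-2 w))] =
  Q [set w | C (eps n' i' w, (eps n' i'.-1 w, eps n' i'.-2 w))].
Proof.
move=> i1n i1n'.
apply: (@eq_pair_law _ _ _ Q _ _ _ _ (eps n i) (eps n' i')
  (fun w => (eps n i.-1 w, eps n i.-2 w)) (fun w => (eps n' i'.-1 w, eps n' i'.-2 w))) => //;
  try exact: measurable_fun_pair.
move=> A B mA mB.
have prod m l : (2 <= l <= m)%N ->
    Q (eps m l @^-1` A `&` (fun w => (eps m l.-1 w, eps m l.-2 w)) @^-1` B) =
    (Q (eps m l @^-1` A) * Q ((fun w => (eps m l.-1 w, eps m l.-2 w)) @^-1` B))%E.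
  move=> lm; apply: (@eps_preimages_indep _ _ _ _ m (pred1 l) (pred2 l.-1 l.-2)) => //.
  - by move=> p /=; lia.
  - by apply: noise_measurable => /=; rewrite ?eqxx//; lia.
  - by apply: measurable_fun_pair; apply: noise_measurable => /=;
      rewrite ?eqxx ?orbT//; lia.
rewrite !prod//; congr (_ * _)%E; first by apply: eps_ident => //; lia.
by apply: (@noise_pair_law n i.-1 n' i'.-1) => //; lia.
Qed.

Definition noise_bipower n i (w : U) : R := bipower (noise n w) i.

Lemma noise_bipower_law n i n' i' (B : set R) :
  (2 <= i <= n)%N -> (2 <= i' <= n')%N -> measurable B ->
  Q (noise_bipower n i @^-1` B) = Q (noise_bipower n' i' @^-1` B).
Proof.
move=> i2 i2' mB.
(* The argument is the triple of noises at times [i], [i - 1] and [i - 2]. *)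
pose phi (x : R * (R * R)) : R := `|x.2.1 - x.2.2| * `|x.1 - x.2.1|.
have mphi : measurable_fun [set: R * (R * R)] phi.
  have m21 : measurable_fun [set: R * (R * R)] (fun x => x.2.1).
    exact: measurableT_comp measurable_fst measurable_snd.
  have m22 : measurable_fun [set: R * (R * R)] (fun x => x.2.2).
    exact: measurableT_comp measurable_snd measurable_snd.
  by apply: measurable_funM; apply: measurableT_comp => //; apply: measurable_funB.
apply: (@noise_triple_law n i n' i' (phi @^-1` B)) => //.
by rewrite -[X in measurable X]setTI; exact: mphi.
Qed.

(** An increment depends on the noise at two consecutive times and a product of
    consecutive increments on three, so [r] is 1 or 2. *)
Definition window r i : pred nat := fun l => (i - r <= l <= i)%N.

Lemma incr_window_measurable n r i l : (1 <= l)%N -> (l <= i <= n)%N -> (i < l + r)%N ->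
  measurable_fun [set: Sigma n (window r i)]
    ((fun w => incr (noise n w) l) : Sigma n (window r i) -> R).
Proof.
move=> l1 lin ir; apply: measurable_funB; apply: noise_measurable; rewrite /window; lia.
Qed.

Lemma noise_bipower_indep n i l (B : set R) : (2 <= i <= n)%N -> (l <= n)%N ->
  (i + 3 <= l)%N -> measurable B ->
  Q (noise_bipower n i @^-1` B `&` noise_bipower n l @^-1` B) =
  (Q (noise_bipower n i @^-1` B) * Q (noise_bipower n l @^-1` B))%E.
Proof.
move=> i2 ln il mB; apply: (@eps_preimages_indep _ _ _ _ n (window 2 i) (window 2 l)) => //.
- by move=> p; rewrite /window; lia.
- apply: measurable_funM; apply: measurableT_comp => //;
    apply: incr_window_measurable; lia.
- apply: measurable_funM; apply: measurableT_comp => //;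
    apply: incr_window_measurable; lia.
Qed.

Lemma noise_increment_indep n i l (B : set R) : (1 <= i <= n)%N -> (l <= n)%N ->
  (i + 3 <= l)%N -> measurable B ->
  Q ((fun w => incr (noise n w) i) @^-1` B `&` (fun w => incr (noise n w) l) @^-1` B) =
  (Q ((fun w => incr (noise n w) i) @^-1` B) *
   Q ((fun w => incr (noise n w) l) @^-1` B))%E.
Proof.
move=> i2 ln il mB; apply: (@eps_preimages_indep _ _ _ _ n (window 1 i) (window 1 l)) => //.
- by move=> p; rewrite /window; lia.
- apply: incr_window_measurable; lia.
- apply: incr_window_measurable; lia.
Qed.

Lemma incr_noise_measurable n i : measurable_fun [set: U] (fun w => incr (noise n w) i).
Proof. exact: measurable_funB. Qed.

Lemma noise_bipower_measurable n i : measurable_fun [set: U] (noise_bipower n i).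
Proof.
by apply: measurable_funM; apply: measurableT_comp => //; exact: incr_noise_measurable.
Qed.

Hypothesis eps_integrable : forall n i, (i <= n)%N -> Integrable (eps n i).
Let c1 := \int[Q]_w `|eps 0%N 0%N w|.

Lemma incr_noise_integrable n i : (1 <= i <= n)%N ->
  Integrable (fun w => `|incr (noise n w) i|).
Proof.
move=> i1; apply: integrable_norm.
have i0 : (i <= n)%N by lia.
have i0' : (i.-1 <= n)%N by lia.
by have := integrableB measurableT (eps_integrable i0) (eps_integrable i0').
Qed.

Lemma incr_noise_mean n i : (1 <= i <= n)%N ->
  \int[Q]_w `|incr (noise n w) i| <= 2 * c1.
Proof.
move=> i1.
have mean l : (l <= n)%N -> \int[Q]_w `|eps n l w| = c1.
  move=> ln; congr fine; apply: (@eq_law_integral _ _ _ Q (eps n l) (eps 0%N 0%N)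
    (fun x => `|x%:E|%E)) => //.
    by apply: measurableT_comp => //; exact/measurable_EFinP.
  by move=> B mB; exact: eps_ident.
have intn l : (l <= n)%N -> Integrable (fun w => `|eps n l w|).
  by move=> ln; apply: integrable_norm; exact: eps_integrable.
have i0 : (i <= n)%N by lia.
have i0' : (i.-1 <= n)%N by lia.
apply: (@le_trans _ _ (\int[Q]_w (`|eps n i w| + `|eps n i.-1 w|))).
  apply: le_Rintegral => //; [exact: incr_noise_integrable| |].
    by apply: integrableDr; exact: intn.
  by move=> w _; exact: ler_normB.
rewrite RintegralD//; [|exact: intn|exact: intn].
by rewrite !mean// mulr_natl mulr2n.
Qed.

Hypothesis bipower_integrable : Integrable (noise_bipower 2 2).

Let kappa := \int[Q]_w noise_bipower 2 2 w.

Lemma noise_bipower_integrable n i : (2 <= i <= n)%N -> Integrable (noise_bipower n i).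
Proof.
move=> i2; apply/integrableP; split; first exact/measurable_EFinP/noise_bipower_measurable.
have /integrableP[_] := bipower_integrable; apply: le_lt_trans.
rewrite le_eqVlt; apply/orP; left; apply/eqP.
apply: (@eq_law_integral _ _ _ Q _ _ (fun x => `|x%:E|%E)) => //;
  try exact: noise_bipower_measurable.
  by apply: measurableT_comp => //; exact/measurable_EFinP.
by move=> B mB; exact: noise_bipower_law.
Qed.

Lemma noise_bipower_mean n i : (2 <= i <= n)%N ->
  \int[Q]_w noise_bipower n i w = kappa.
Proof.
move=> i2.
have abs m l w : noise_bipower m l w = `|noise_bipower m l w|.
  by rewrite ger0_norm// mulr_ge0.
rewrite /kappa; under eq_Rintegral do rewrite abs.
under [in RHS]eq_Rintegral do rewrite abs.
congr fine; apply: (@eq_law_integral _ _ _ Q _ _ (fun x => `|x%:E|%E)) => //;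
  try exact: noise_bipower_measurable.
  by apply: measurableT_comp => //; exact/measurable_EFinP.
by move=> B mB; exact: noise_bipower_law.
Qed.

Lemma padded_noise_integrable n i : (2 <= i <= n)%N ->
  Integrable (fun w => padded_bipower (noise n w) i) /\
  \int[Q]_w padded_bipower (noise n w) i <= kappa + 4 * c1 + 1.
Proof.
move=> i2.
have expand w : padded_bipower (noise n w) i = noise_bipower n i w +
    (`|incr (noise n w) i.-1| + (`|incr (noise n w) i| + 1)).
  by rewrite /padded_bipower /noise_bipower /bipower; ring.
have i1 : (1 <= i <= n)%N by lia.
have i1' : (1 <= i.-1 <= n)%N by lia.
have int1 := incr_noise_integrable i1; have int2 := incr_noise_integrable i1'.
have int3 := integrable_cst Q 1; have intb := noise_bipower_integrable i2.
have int13 := integrableDr int1 int3; have int213 := integrableDr int2 int13.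
split; first by under eq_fun do rewrite expand; exact: integrableDr.
under eq_Rintegral do rewrite expand.
rewrite !RintegralD// noise_bipower_mean// Rintegral_cst_prob.
have := incr_noise_mean i1; have := incr_noise_mean i1'; lra.
Qed.

End noise_laws.

(** * Rates and finite nets *)

Section rates.
Context {R : realType}.

(** The inverse power function provides the rank. *)
Lemma near_powR_ge (p K : R) : 0 < p -> \forall n \near \oo, K <= n%:R `^ p.
Proof.
move=> p0; pose K1 := Num.max K 0.
exists (Num.truncn (K1 `^ p^-1)).+1 => // n /= Hn.
have K10 : 0 <= K1 by rewrite le_max lexx orbT.
have nK : K1 `^ p^-1 <= n%:R.
  by rewrite (le_trans (ltW (truncnS_gt _)))// ler_nat.
apply: (@le_trans _ _ K1); first by rewrite le_max lexx.
have -> : K1 = (K1 `^ p^-1) `^ p by rewrite -powRrM mulVf ?lt0r_neq0// powRr1.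
by apply: ge0_ler_powR; rewrite ?nnegrE ?powR_ge0 ?ler0n ?(ltW p0).
Qed.

Lemma near_block_length_ge (k : nat -> nat) (q : R) (K : nat) : 0 < q ->
  proportional_to_power k q -> \forall n \near \oo, (K <= k n)%N.
Proof.
move=> q0 [a1 [a2 [a10 a20 near_k]]].
have near_n := near_powR_ge (K%:R / a1) q0.
near=> n.
rewrite -(ler_nat R); have /andP[+ _] : a1 * n%:R `^ q <= (k n)%:R <= a2 * n%:R `^ q.
  by near: n.
apply: le_trans; rewrite mulrC -ler_pdivrMr//; near: n; exact: near_n.
Unshelve. all: by end_near. Qed.

(** [k_n] is at most of order [n^q], and [n = n^q n^(1-q)]. *)
Lemma near_block_number_ge (k : nat -> nat) (q : R) (K : nat) : 0 < q < 1 ->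
  proportional_to_power k q -> \forall n \near \oo, (K <= n %/ k n)%N.
Proof.
move=> /andP[q0 q1] prop_k; have [a1 [a2 [a10 a20 near_k]]] := prop_k.
have q1' : 0 < 1 - q by rewrite subr_gt0.
have near_n := near_powR_ge (a2 * K%:R) q1'.
have near_k1 := near_block_length_ge 1 q0 prop_k.
near=> n.
have k1 : (0 < k n)%N by near: n.
rewrite leq_divRL// -(ler_nat R) natrM.
have /andP[_ kn] : a1 * n%:R `^ q <= (k n)%:R <= a2 * n%:R `^ q by near: n.
have n0 : (0 < n)%N by near: n; exists 1%N.
have -> : n%:R = n%:R `^ q * n%:R `^ (1 - q) :> R.
  by rewrite -powRD ?subrKC ?powRr1// gt_eqF ?implybT// ltr0n.
apply: (le_trans (ler_wpM2l (ler0n _ K) kn)).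
rewrite mulrA [_ * a2]mulrC [leRHS]mulrC ler_wpM2r ?powR_ge0//.
near: n; exact: near_n.
Unshelve. all: by end_near. Qed.

End rates.

Section nets.
Context {R : realType}.

(** The radii [1 / (N + 1)] and the near-covering form of compactness replace the
    extraction of a finite subcover. *)
Lemma compact_uniform_continuity (A : set R) (F : R -> R) (e : R) :
  compact A -> continuous F -> 0 < e ->
  exists2 r : R, 0 < r & forall t s, A t -> `|s - t| <= r -> `|F s - F t| <= e.
Proof.
move=> /compact_near_coveringP cA cF e0; have e20 : 0 < e / 2 by rewrite divr_gt0.
have [N _ HN] : \forall N \near \oo,
    A `<=` [set t | forall s, `|s - t| <= N.+1%:R^-1 -> `|F s - F t| <= e].
  apply: cA => x Ax.
  have /cvgrPdist_le/(_ _ e20) := cF x.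
  move=> /nbhs_ballP[r /= r0 H].
  have r20 : 0 < r / 2 by rewrite divr_gt0.
  exists (ball x (r / 2), [set N | N.+1%:R^-1 < r / 2]).
    split => /=; first exact: nbhsx_ballx.
    exact: near_infty_natSinv_lt (PosNum r20).
  move=> [t N] [/= xt Nr] s st; rewrite (splitr e) -(subrKA (F x)).
  apply: le_trans (ler_normD _ _) _; apply: lerD.
    rewrite distrC; apply: H; rewrite /ball/=.
    have -> : x - s = (x - t) + (t - s) by rewrite addrA subrK.
    apply: le_lt_trans (ler_normD _ _) _; rewrite (splitr r) ltr_leD//.
    by rewrite distrC (le_trans st)// ltW.
  by apply: H; apply: lt_trans xt _; rewrite ltr_pdivrMr// ltr_pMr// ltr1n.
exists N.+1%:R^-1; first by rewrite invr_gt0.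
by move=> t s At st; exact: (HN N (leqnn N)).
Qed.

(** The net is the grid of mesh [rho], a third of a modulus of continuity: the grid
    points around [t - rho] and [t + rho] are within three meshes of [t]. *)
Lemma finite_net (A : set R) (F : R -> R) (e : R) :
  compact A -> continuous F -> 0 < e ->
  exists (rho : R) (s : seq R), 0 < rho /\ forall t, A t ->
    exists t1 t2, [/\ t1 \in s, t2 \in s, t1 <= t - rho /\ t + rho <= t2,
      `|F t1 - F t| <= e & `|F t2 - F t| <= e].
Proof.
move=> cA cF e0; have [r r0 Hr] := compact_uniform_continuity cA cF e0.
have [M [_ HM]] := compact_bounded cA.
have {}HM t : A t -> `|t| <= `|M| + 1.
  by move=> At; apply: (HM (`|M| + 1)) => //; rewrite ltr_pwDr// ler_norm.
pose rho := r / 3; have rho0 : 0 < rho by rewrite divr_gt0.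
(* The indices are shifted by [K] to make them natural numbers, the grid reaching
   two meshes beyond the bound on [A] on either side. *)
pose K0 := (Num.truncn ((`|M| + 1) / rho)).+1; pose K := (K0 + 2)%N.
have K0E : (`|M| + 1) / rho < K0%:R by exact: truncnS_gt.
have KE : K%:R = K0%:R + 2 :> R by rewrite natrD.
exists rho, [seq (i%:R - K%:R) * rho | i <- iota 0 (K + K).+1]; split => // t At.
have tK : `|t / rho| < K0%:R.
  apply: le_lt_trans K0E; rewrite normrM [`|rho^-1|]gtr0_norm ?invr_gt0//.
  by rewrite ler_pM2r ?invr_gt0// HM.
move: tK; rewrite ltr_norml => /andP[tK1 tK2].
pose p := Num.truncn (t / rho + K%:R).
have /andP[p1 p2] : p%:R <= t / rho + K%:R < p.+1%:R by apply: truncn_itv; lra.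
have tE : t = t / rho * rho by rewrite divfK// gt_eqF.
have rE : r = 3 * rho by rewrite /rho; field.
rewrite -natr1 in p2.
have pK : (p + 2 <= K + K)%N.
  by rewrite -(ler_nat R) !natrD; lra.
have p0 : (0 < p)%N by rewrite -(ltr_nat R); lra.
exists ((p.-1%:R - K%:R) * rho), (((p + 2)%:R - K%:R) * rho).
have pE : p.-1%:R = p%:R - 1 :> R by rewrite -subn1 natrB.
have t1E : t - (p.-1%:R - K%:R) * rho = (t / rho - p%:R + 1 + K%:R) * rho.
  by rewrite pE {1}tE; ring.
have t2E : ((p + 2)%:R - K%:R) * rho - t = (p%:R + 2 - K%:R - t / rho) * rho.
  by rewrite natrD {1}tE; ring.
have b1 : rho <= t - (p.-1%:R - K%:R) * rho <= r.
  by rewrite t1E rE ler_peMl ?ler_pM2r//=; lra.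
have b2 : rho <= ((p + 2)%:R - K%:R) * rho - t <= r.
  by rewrite t2E rE ler_peMl ?ler_pM2r//=; lra.
have in1 : (p.-1 < (K + K).+1)%N.
  by rewrite ltnS (leq_trans (leq_pred p))// (leq_trans _ pK)// leq_addr.
have in2 : (p + 2 < (K + K).+1)%N by rewrite ltnS.
split.
- by apply/mapP; exists p.-1; rewrite // mem_iota.
- by apply/mapP; exists (p + 2)%N; rewrite // mem_iota.
- by case/andP: b1 => ? _; case/andP: b2 => ? _; split; lra.
- apply: Hr => //; rewrite distrC ger0_norm; by case/andP: b1 => *; lra.
- apply: Hr => //; rewrite ger0_norm; by case/andP: b2 => *; lra.
Qed.

End nets.

(** * The statistic caught between noise distribution functions *)

Section sandwich.
Context {R : realType}.
Implicit Types (e f : nat -> R) (n k m j i : nat).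

(** Half of the asymptotic value of the truncation level, in which the local
    variance is [n mu^2]. *)
Definition retention_bound (a mu varpi : R) n : R :=
  a * (mu / 2) * (Num.sqrt n%:R * n%:R `^ (- varpi)).

(** Each term is at least 1 when the corresponding requirement fails: the noise
    block mean is close to its limit, the perturbation by the signal is small,
    the left-out terms are small, and the noise increment is below the
    truncation level. *)
Definition badness (mu eta delta b : R) e k j i : R :=
  `|pi / 2 * block_mean (bipower e) k j - mu ^+ 2| / eta +
  (pi / 2 * (delta * block_mean (padded_bipower e) k j) / eta +
   (pi / 2 * adjacent_padded e k j i / (eta * (k%:R - 3)) +
    (`|incr e i| + 1) / b)).

Definition mean_badness (mu eta delta a varpi : R) n k m e : R :=
  mean_over (retained n k m)
    (fun p => badness mu eta delta (retention_bound a mu varpi n) e k p.1 p.2).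

Definition block_jumps f (delta : R) k j : R :=
  \sum_((block_start k j).+1 <= l < (j * k).+1) (delta < `|incr f l|)%R%:R.

Definition jump_count f (delta : R) n : R :=
  \sum_(1 <= l < n.+1) (delta < `|incr f l|)%R%:R.

Lemma sum_blocks (h : nat -> R) k B :
  \sum_(1 <= j < B.+1) \sum_((block_start k j).+1 <= l < (j * k).+1) h l =
  \sum_(1 <= l < (B * k).+1) h l.
Proof.
elim: B => [|B IH]; first by rewrite mul0n !big_geq.
rewrite big_nat_recr//= IH /block_start/= [RHS](@big_cat_nat _ _ _ (B * k).+1)//=.
by rewrite ltnS leq_mul2r leqnSn orbT.
Qed.

(** Each block contributes as many retained indices as any other, and the blocks
    do not overlap. *)
Lemma mean_block_jumps f (delta : R) n k m : (0 < n %/ k)%N -> (0 < m)%N ->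
  mean_over (retained n k m) (fun p => block_jumps f delta k p.1) <=
  jump_count f delta n / (n %/ k)%:R.
Proof.
move=> B0 m0; rewrite /mean_over size_retained.
rewrite -(sum_retained n k m (fun j _ => block_jumps f delta k j)).
have -> : \sum_(1 <= j < (n %/ k).+1)
    \sum_((block_start k j).+1 <= i < (block_start k j + m).+1) block_jumps f delta k j =
    m%:R * \sum_(1 <= j < (n %/ k).+1) block_jumps f delta k j.
  rewrite mulr_sumr; apply: eq_bigr => j _.
  by rewrite sumr_const_nat subSS addKn mulr_natl.
rewrite sum_blocks natrM invfM mulrA mulfVK ?pnatr_eq0 -?lt0n// mulrC.
rewrite ler_wpM2r ?invr_ge0 ?ler0n// /jump_count.
rewrite [leRHS](@big_cat_nat _ _ _ ((n %/ k) * k).+1)//=; last by rewrite ltnS leq_divM.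
by rewrite lerDl sumr_ge0.
Qed.

Lemma block_jumps_small f (delta : R) k j : block_jumps f delta k j < 1 ->
  forall l, (block_start k j < l <= j * k)%N -> `|incr f l| <= delta.
Proof.
move=> bj l /andP[sl lk]; rewrite leNgt; apply/negP => lg; move: bj.
rewrite ltNge => /negP; apply; rewrite /block_jumps (big_rem l)/= ?lg ?lerDl ?sumr_ge0//.
by rewrite mem_index_iota sl ltnS.
Qed.

Lemma sum4_lt1 (x y z t : R) : 0 <= x -> 0 <= y -> 0 <= z -> 0 <= t ->
  x + (y + (z + t)) < 1 -> [/\ x <= 1, y <= 1, z <= 1 & t <= 1].
Proof. by move=> x0 y0 z0 t0 xyzt; split; lra. Qed.

Section studentized_sandwich.
Variables (f e : nat -> R) (n k m : nat) (a varpi mu eta delta rho M : R).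
Hypotheses (n0 : (0 < n)%N) (k4 : (4 <= k)%N) (m0 : (0 < m)%N) (mk : (m <= k)%N).
Hypotheses (a0 : 0 < a) (mu0 : 0 < mu) (eta0 : 0 < eta) (delta01 : 0 <= delta <= 1).
Hypothesis eta_small : 8 * eta <= mu ^+ 2.
Hypothesis k_large : 2 * (mu ^+ 2 + 2 * eta) <= eta * (k%:R - 3).
Hypothesis error_small : M * (4 * eta / mu) + delta <= rho * mu.

Local Notation x := (fun l => f l + e l).
Local Notation r := (retained n k m).
Local Notation b := (retention_bound a mu varpi n).

Lemma retention_bound_gt0 : 0 < b.
Proof. by rewrite !mulr_gt0 ?divr_gt0 ?sqrtr_gt0 ?powR_gt0 ?ltr0n. Qed.

Let k3 : 0 < k%:R - 3 :> R.
Proof. by rewrite subr_gt0 ltr_nat. Qed.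

Lemma block_mean_ge0 (g : nat -> R) j : (forall i, 0 <= g i) -> 0 <= block_mean g k j.
Proof.
move=> g0; rewrite mulr_ge0 ?invr_ge0 ?sumr_ge0// subr_ge0 ler1n.
exact: leq_trans k4.
Qed.

Lemma badness_terms_ge0 j i : [/\
  0 <= `|pi / 2 * block_mean (bipower e) k j - mu ^+ 2| / eta,
  0 <= pi / 2 * (delta * block_mean (padded_bipower e) k j) / eta,
  0 <= pi / 2 * adjacent_padded e k j i / (eta * (k%:R - 3)) &
  0 <= (`|incr e i| + 1) / b].
Proof.
have p0 : 0 <= pi / 2 :> R by rewrite divr_ge0 ?pi_ge0.
have d0 : 0 <= delta by case/andP: delta01.
have pad := padded_bipower_ge0 e.
split; rewrite divr_ge0 ?(ltW eta0) ?(ltW retention_bound_gt0)//.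
- by rewrite mulr_ge0// mulr_ge0// block_mean_ge0.
- by rewrite mulr_ge0// addr_ge0// mulr_ge0.
- by rewrite mulr_ge0// ltW.
Qed.

(** An index is exceptional if its badness plus the number of large signal
    increments in its block is at least 1. *)
Lemma empirical_cdf_sandwich (tau : R) : `|tau| <= M ->
  let bad := mean_badness mu eta delta a varpi n k m e +
             jump_count f delta n / (n %/ k)%:R in
  let H t := mean_over r (fun p => (mu^-1 * incr e p.2 <= t)%R%:R) in
  H (tau - rho) - 2 * bad <= empirical_cdf x n k m a varpi tau /\
  empirical_cdf x n k m a varpi tau <= H (tau + rho) + 2 * bad.
Proof.
move=> tauM bad H.
have [B0|B0] := posnP (n %/ k).
  have r0 : r = [::] by apply/nilP; rewrite /nilp size_retained B0.
  have E0 : empirical_cdf x n k m a varpi tau = 0.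
    by rewrite /empirical_cdf B0 [X in _ * X]big_geq// mulr0.
  rewrite E0 /bad /H /mean_badness /mean_over r0 B0 !big_nil invr0.
  by rewrite !mulr0 addr0 mulr0 oppr0 addr0.
pose beta (p : nat * nat) :=
  badness mu eta delta b e k p.1 p.2 + block_jumps f delta k p.1.
have bad_ge : mean_over r beta <= bad.
  by rewrite mean_overD lerD2l; exact: mean_block_jumps.
have beta0 p : p \in r -> 0 <= beta p.
  move=> _; have [? ? ? ?] := badness_terms_ge0 p.1 p.2.
  by rewrite addr_ge0 ?sumr_ge0// !addr_ge0.
pose u (p : nat * nat) := untruncated x n k a varpi p.1 p.2.
pose v (p : nat * nat) :=
  Num.sqrt n%:R * incr x p.2 / Num.sqrt (local_var_without x n k p.1 p.2) <= tau.
pose lo (p : nat * nat) := mu^-1 * incr e p.2 <= tau - rho.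
pose hi (p : nat * nat) := mu^-1 * incr e p.2 <= tau + rho.
have key p : p \in r -> beta p < 1 -> [/\ u p, lo p -> v p & v p -> hi p].
  case: p => j i /(mem_retained mk)[/andP[j1 _] si ij _] bp.
  have [t1 t2 t3 t4] := badness_terms_ge0 j i.
  have bj : block_jumps f delta k j < 1.
    by apply: le_lt_trans bp; rewrite lerDr !addr_ge0.
  have small := block_jumps_small bj.
  have bp' : badness mu eta delta b e k j i < 1.
    by apply: le_lt_trans bp; rewrite lerDl sumr_ge0.
  have [] := sum4_lt1 t1 t2 t3 t4 bp'.
  rewrite !ler_pdivrMr ?mul1r ?retention_bound_gt0 ?mulr_gt0// => h1 h2 h3 h4.
  have sij : (block_start k j < i <= j * k)%N by rewrite si ij.
  have di : `|incr f i| <= 1.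
    by rewrite (le_trans (small _ sij))//; case/andP: delta01.
  have [lov vhi] := studentized_le k4 j1 delta01 small n0 mu0 eta0 eta_small k_large
    h1 h2 sij h3 tauM error_small.
  split => //.
  rewrite /u /=.
  exact: (retained_increment k4 j1 delta01 small mu0 eta_small h1 h2 a0 di h4).
have sandwich := retained_mean_sandwich beta0 key.
have EE : empirical_cdf x n k m a varpi tau =
    (\sum_(p <- r) (u p)%:R)^-1 * \sum_(p <- r) (v p)%:R * (u p)%:R.
  rewrite /empirical_cdf /untruncated_count.
  by rewrite -(sum_retained n k m (fun j i => (u (j, i))%:R))
    -(sum_retained n k m (fun j i => (v (j, i))%:R * (u (j, i))%:R)).
rewrite EE; move/andP: sandwich => [s1 s2]; split.
  by apply: (le_trans _ s1); rewrite lerD2l lerN2 ler_pM2l.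
by apply: (le_trans s2); rewrite lerD2l ler_pM2l.
Qed.

End studentized_sandwich.
End sandwich.

(** * Mean badness of an increment *)

Section noise_badness.
Context {R : realType} {d : measure_display} {U : measurableType d}.
Variables (Q : probability U R) (eps : nat -> nat -> {RV Q >-> R}).
Hypothesis eps_indep : forall n (B : nat -> set R), (forall i, measurable (B i)) ->
  Q (\bigcap_(i in [set i | (i <= n)%N]) eps n i @^-1` B i) =
  (\prod_(i < n.+1) Q (eps n i @^-1` B i))%E.
Hypothesis eps_ident : forall n i n' i' (B : set R), (i <= n)%N -> (i' <= n')%N ->
  measurable B -> distribution Q (eps n i) B = distribution Q (eps n' i') B.
Hypothesis eps_integrable : forall n i, (i <= n)%N ->
  Q.-integrable [set: U] (EFin \o eps n i).
Hypothesis bipower_integrable :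
  Q.-integrable [set: U] (EFin \o noise_bipower eps 2 2).

Local Notation Integrable f := (Q.-integrable [set: U] (EFin \o f)).
Local Notation kappa := (\int[Q]_w noise_bipower eps 2 2 w).
Local Notation c1 := (\int[Q]_w `|eps 0%N 0%N w|).
Local Notation noise := (noise eps).

Lemma size_block k j : (1 <= j)%N -> (2 <= k)%N ->
  size (index_iota (block_start k j).+2 (j * k).+1) = (k - 1)%N.
Proof.
move=> j1 k2; rewrite size_iota /block_start.
have -> : (j * k = j.-1 * k + k)%N by rewrite -mulSnr prednK.
by rewrite -addn2 -addn1; lia.
Qed.

Lemma block_meanE (g : nat -> R) k j : (1 <= j)%N -> (2 <= k)%N ->
  block_mean g k j = mean_over (index_iota (block_start k j).+2 (j * k).+1) g.
Proof.
move=> j1 k2; rewrite /block_mean /mean_over size_block// natrB//.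
exact: leq_trans k2.
Qed.

Lemma mem_block k j n i : (1 <= j)%N -> (j * k <= n)%N ->
  i \in index_iota (block_start k j).+2 (j * k).+1 -> (2 <= i <= n)%N.
Proof. by move=> j1 jn; rewrite mem_index_iota; lia. Qed.

(** The rank depends only on [z]: the law of the products depends neither on the
    block nor on [n]. *)
Lemma block_mean_lln (z : R) : 0 < z -> exists K : nat, forall n k j,
  (K <= k)%N -> (2 <= k)%N -> (1 <= j)%N -> (j * k <= n)%N ->
  \int[Q]_w `|block_mean (bipower (noise n w)) k j - kappa| <= z.
Proof.
move=> z0.
pose Z0 : {RV Q >-> R} := mfun_Sub (mem_set (noise_bipower_measurable eps 2 2)).
have [N0 H] := @lln_L1 _ _ _ Q Z0 _ bipower_integrable z0.
exists N0.+1 => n k j Kk k2 j1 jn.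
under eq_Rintegral do rewrite block_meanE//.
have mem i := @mem_block k j n i j1 jn.
apply: (H (noise_bipower eps n)).
- exact: iota_uniq.
- by rewrite size_block//; lia.
- by move=> i _; exact: noise_bipower_measurable.
- by move=> i /mem i2 B mB; exact: noise_bipower_law.
- move=> i l /mem i2 /mem l2 il B mB; apply: noise_bipower_indep => //; lia.
Qed.

Lemma block_mean_integrable n k j : (2 <= k)%N -> (1 <= j)%N -> (j * k <= n)%N ->
  Integrable (fun w => block_mean (bipower (noise n w)) k j).
Proof.
move=> k2 j1 jn; under eq_fun do rewrite block_meanE//.
apply: integrable_mean_over => i /(mem_block j1 jn) i2.
exact: noise_bipower_integrable.
Qed.

Lemma block_padded_mean n k j : (2 <= k)%N -> (1 <= j)%N -> (j * k <= n)%N ->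
  Integrable (fun w => block_mean (padded_bipower (noise n w)) k j) /\
  \int[Q]_w block_mean (padded_bipower (noise n w)) k j <= kappa + 4 * c1 + 1.
Proof.
move=> k2 j1 jn.
have pad i : i \in index_iota (block_start k j).+2 (j * k).+1 ->
    Integrable (fun w => padded_bipower (noise n w) i) /\
    \int[Q]_w padded_bipower (noise n w) i <= kappa + 4 * c1 + 1.
  by move=> /(mem_block j1 jn) i2; exact: padded_noise_integrable.
split.
  under eq_fun do rewrite block_meanE//.
  by apply: integrable_mean_over => i /pad[].
under eq_Rintegral do rewrite block_meanE//.
rewrite (Rintegral_mean_over (fun i hi => (pad i hi).1)).
rewrite -[leRHS](@mean_over_cst _ _ (index_iota (block_start k j).+2 (j * k).+1)).
  by apply: mean_over_le => i /pad[].
by rewrite size_block// pnatr_eq0; lia.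
Qed.

Lemma adjacent_padded_mean n k j i : (2 <= k)%N -> (1 <= j)%N -> (j * k <= n)%N ->
  (block_start k j < i <= j * k)%N ->
  Integrable (fun w => adjacent_padded (noise n w) k j i) /\
  \int[Q]_w adjacent_padded (noise n w) k j i <= 2 * (kappa + 4 * c1 + 1).
Proof.
move=> k2 j1 jn /andP[si ij].
have C0 : 0 <= kappa + 4 * c1 + 1.
  rewrite !addr_ge0 ?mulr_ge0 ?Rintegral_ge0//.
  by move=> w _; rewrite mulr_ge0.
have term (c : bool) l : (c -> 2 <= l <= n)%N ->
    Integrable (fun w => c%:R * padded_bipower (noise n w) l) /\
    \int[Q]_w (c%:R * padded_bipower (noise n w) l) <= kappa + 4 * c1 + 1.
  case: c => [/(_ isT) l2|_].
    have [ip Ep] := padded_noise_integrable eps_indep eps_ident eps_integrable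
      bipower_integrable l2.
    by split; [exact: integrableZr|rewrite RintegralZl// mul1r].
  split; first by under eq_fun do rewrite mul0r; exact: integrable_cst.
  by under eq_Rintegral do rewrite mul0r; rewrite Rintegral_cst_prob.
have [|i1 E1] := term ((block_start k j).+1 < i)%N i; first lia.
have [|i2 E2] := term (i < j * k)%N i.+1; first lia.
split; first exact: integrableDr.
by rewrite RintegralD// mulr_natl mulr2n lerD.
Qed.

Lemma badness_mean (mu eta delta b z : R) n k j i :
  mu ^+ 2 = pi / 2 * kappa -> 0 < eta -> 0 <= delta -> 0 < b ->
  (4 <= k)%N -> (1 <= j)%N -> (j * k <= n)%N -> (block_start k j < i <= j * k)%N ->
  \int[Q]_w `|block_mean (bipower (noise n w)) k j - kappa| <= z ->
  Integrable (fun w => badness mu eta delta b (noise n w) k j i) /\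
  \int[Q]_w badness mu eta delta b (noise n w) k j i <=
    pi / 2 / eta * z + (pi / 2 * delta / eta * (kappa + 4 * c1 + 1) +
    (pi / 2 / (eta * (k%:R - 3)) * (2 * (kappa + 4 * c1 + 1)) +
     b^-1 * (2 * c1 + 1))).
Proof.
move=> muE eta0 d0 b0 k4 j1 jn sij Ez.
have k2 : (2 <= k)%N by exact: leq_trans k4.
have p0 : 0 < pi / 2 :> R by rewrite divr_gt0 ?pi_gt0.
have k3 : 0 < k%:R - 3 :> R by rewrite subr_gt0 ltr_nat.
have i1 : (1 <= i <= n)%N by lia.
have expand w : badness mu eta delta b (noise n w) k j i =
    pi / 2 / eta * `|block_mean (bipower (noise n w)) k j - kappa| +
    (pi / 2 * delta / eta * block_mean (padded_bipower (noise n w)) k j +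
     (pi / 2 / (eta * (k%:R - 3)) * adjacent_padded (noise n w) k j i +
      b^-1 * (`|incr (noise n w) i| + 1))).
  rewrite /badness muE -mulrBr normrM (gtr0_norm p0).
  by congr (_ + (_ + (_ + _))); rewrite ?(mulrC b^-1)//; ring.
have [intp Ep] := block_padded_mean k2 j1 jn.
have [inta Ea] := adjacent_padded_mean k2 j1 jn sij.
have inti := incr_noise_integrable eps_integrable i1.
have Ei := incr_noise_mean eps_ident eps_integrable i1.
have intm : Integrable (fun w => `|block_mean (bipower (noise n w)) k j - kappa|).
  exact: integrable_norm (integrableDr (block_mean_integrable k2 j1 jn)
    (integrable_cst Q (- kappa))).
have int1 := integrableZr (pi / 2 / eta) intm.
have int2 := integrableZr (pi / 2 * delta / eta) intp.
have int3 := integrableZr (pi / 2 / (eta * (k%:R - 3))) inta.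
have inti1 := integrableDr inti (integrable_cst Q 1).
have int4 := integrableZr b^-1 inti1.
have int34 := integrableDr int3 int4.
have int234 := integrableDr int2 int34.
split.
  by under eq_fun do rewrite expand; exact: integrableDr int1 int234.
under eq_Rintegral do rewrite expand.
rewrite (RintegralD measurableT int1 int234).
rewrite (RintegralD measurableT int2 int34) (RintegralD measurableT int3 int4).
rewrite (RintegralZl _ measurableT intm) (RintegralZl _ measurableT intp).
rewrite (RintegralZl _ measurableT inta) (RintegralZl _ measurableT inti1).
rewrite (RintegralD measurableT inti (integrable_cst Q 1)) Rintegral_cst_prob.
have pe0 : 0 <= pi / 2 / eta by exact: divr_ge0 (ltW p0) (ltW eta0).
have pd0 : 0 <= pi / 2 * delta / eta.
  exact: divr_ge0 (mulr_ge0 (ltW p0) d0) (ltW eta0).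
have pk0 : 0 <= pi / 2 / (eta * (k%:R - 3)).
  exact: divr_ge0 (ltW p0) (mulr_ge0 (ltW eta0) (ltW k3)).
apply: lerD; first by rewrite ler_wpM2l.
apply: lerD; first by rewrite ler_wpM2l.
apply: lerD; first by rewrite ler_wpM2l.
by rewrite ler_wpM2l ?invr_ge0 ?(ltW b0)// lerD2r.
Qed.

(** The four terms of the badness have means that are, respectively, small by the
    law of large numbers, proportional to [delta], of order [1 / k_n] and of order
    [n^(varpi - 1/2)]; each is made at most a quarter of [zeta]. *)
Lemma near_mean_badness (mu eta a varpi q zeta : R) (k m : nat -> nat) :
  mu ^+ 2 = pi / 2 * kappa -> 0 < mu -> 0 < eta -> 0 < a -> varpi < 1 / 2 ->
  0 < zeta -> 0 < q < 1 -> proportional_to_power k q ->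
  (forall n, (1 <= m n <= k n)%N) ->
  exists delta0, 0 < delta0 <= 1 /\ forall delta, 0 < delta <= delta0 ->
  \forall n \near \oo,
    Integrable (fun w => mean_badness mu eta delta a varpi n (k n) (m n) (noise n w)) /\
    \int[Q]_w mean_badness mu eta delta a varpi n (k n) (m n) (noise n w) <= zeta.
Proof.
move=> muE mu0 eta0 a0 varpi12 zeta0 q01 prop_k mk.
have q0 : 0 < q by case/andP: q01.
have p0 : 0 < pi / 2 :> R by rewrite divr_gt0 ?pi_gt0.
set C := kappa + 4 * c1 + 1.
have c10 : 0 <= c1 by rewrite Rintegral_ge0.
have C0 : 0 <= C.
  rewrite !addr_ge0 ?mulr_ge0 ?Rintegral_ge0//.
  by move=> w _; rewrite mulr_ge0.
have zeta4 : 0 < zeta / 4 by rewrite divr_gt0.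
(* [z] and [dl] are the values for which the first two terms of the bound of
   [badness_mean] are at most [zeta / 4]. *)
pose z := zeta / 4 / (pi / 2 / eta).
have pe0 : 0 < pi / 2 / eta by rewrite divr_gt0.
have z0 : 0 < z by rewrite divr_gt0.
have [K HK] := block_mean_lln z0.
pose dl := zeta / 4 / (pi / 2 / eta * (C + 1)).
have pC0 : 0 < pi / 2 / eta * (C + 1) by rewrite mulr_gt0// ltr_wpDl.
have dl0 : 0 < dl by rewrite divr_gt0.
exists (Num.min 1 dl); split.
  by rewrite lt_min ltr01 dl0 ge_min lexx.
move=> delta /andP[d0]; rewrite le_min => /andP[d1 ddl].
(* [K3] and [b0] do the same for the last two terms. *)
pose K3 := pi / 2 * (2 * C) / (eta * (zeta / 4)).
pose b0 := 4 * (2 * c1 + 1) / zeta.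
have varpi0 : 0 < 1 / 2 - varpi by rewrite subr_gt0.
have near_rate := near_powR_ge (b0 / (a * (mu / 2))) varpi0.
have near_k := near_block_length_ge (maxn K (Num.truncn K3 + 4)) q0 prop_k.
have near_B := near_block_number_ge 1 q01 prop_k.
near=> n.
have kn : (maxn K (Num.truncn K3 + 4) <= k n)%N by near: n.
have Kk : (K <= k n)%N by apply: leq_trans kn; exact: leq_maxl.
have K3k : (Num.truncn K3 + 4 <= k n)%N by apply: leq_trans kn; exact: leq_maxr.
have k4 : (4 <= k n)%N by apply: leq_trans K3k; exact: leq_addl.
have B1 : (1 <= n %/ k n)%N by near: n.
have n0 : (0 < n)%N by move: B1; case: (n) => //; rewrite div0n.
have /andP[m1 mkn] := mk n.
have k3 : 0 < (k n)%:R - 3 :> R by rewrite subr_gt0 ltr_nat.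
have rateE : Num.sqrt n%:R * n%:R `^ (- varpi) = n%:R `^ (1 / 2 - varpi) :> R.
  rewrite powRD; last by rewrite pnatr_eq0 -lt0n n0 implybT.
  by rewrite div1r powR12_sqrt.
have am0 : 0 < a * (mu / 2) by rewrite mulr_gt0 ?divr_gt0.
have b00 : 0 < b0 by rewrite divr_gt0// mulr_gt0// ltr_wpDl ?mulr_ge0.
have bb0 : b0 <= retention_bound a mu varpi n.
  by rewrite /retention_bound rateE mulrC -ler_pdivrMr//; near: n.
have bgt0 : 0 < retention_bound a mu varpi n by exact: lt_le_trans bb0.
have each p : p \in retained n (k n) (m n) ->
    Integrable (fun w => badness mu eta delta (retention_bound a mu varpi n)
      (noise n w) (k n) p.1 p.2) /\
    \int[Q]_w badness mu eta delta (retention_bound a mu varpi n)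
      (noise n w) (k n) p.1 p.2 <= zeta.
  case: p => j i /(mem_retained mkn)[/andP[j1 _] si ij jn] /=.
  have sij : (block_start (k n) j < i <= j * k n)%N by rewrite si ij.
  have k2 : (2 <= k n)%N by exact: leq_trans k4.
  have [intb Eb] := badness_mean muE eta0 (ltW d0) bgt0 k4 j1 jn sij
    (HK n (k n) j Kk k2 j1 jn).
  split => //; apply: le_trans Eb _.
  have -> : zeta = zeta / 4 + (zeta / 4 + (zeta / 4 + zeta / 4)) by field.
  rewrite -/C; apply: lerD; last apply: lerD; last apply: lerD.
  - by rewrite /z mulrC divfK// gt_eqF.
  - have -> : pi / 2 * delta / eta * C = delta * (pi / 2 / eta * C) by ring.
    move: ddl; rewrite /dl ler_pdivlMr//; apply: le_trans.
    by rewrite ler_wpM2l ?(ltW d0)// ler_wpM2l ?(ltW pe0)// lerDl.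
  - rewrite mulrAC ler_pdivrMr ?mulr_gt0//.
    have K3lt : K3 <= (k n)%:R - 3.
      rewrite (le_trans (ltW (truncnS_gt _)))// lerBrDr -natrD ler_nat.
      by rewrite addSnnS.
    move: K3lt; rewrite /K3 ler_pdivrMr ?mulr_gt0// => /le_trans; apply.
    by rewrite le_eqVlt; apply/orP; left; apply/eqP; ring.
  - rewrite ler_pdivrMl//.
    have -> : 2 * c1 + 1 = b0 * (zeta / 4) by rewrite /b0; field; rewrite gt_eqF.
    by rewrite ler_wpM2r// ltW.
have r0 : (size (retained n (k n) (m n)))%:R != 0 :> R.
  by rewrite size_retained pnatr_eq0 -lt0n muln_gt0 B1.
split; first by apply: integrable_mean_over => p /each[].
rewrite (Rintegral_mean_over (fun p hp => (each p hp).1)).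
by rewrite -[leRHS](mean_over_cst _ r0); apply: mean_over_le => p /each[].
Unshelve. all: by end_near. Qed.

End noise_badness.

(** * Measurability of the statistic *)

Section statistic_measurability.
Context {R : realType} {d : measure_display} {U : measurableType d}.

Lemma measurable_sum_mem (I : eqType) (s : seq I) (h : I -> U -> R) :
  (forall i, i \in s -> measurable_fun [set: U] (h i)) ->
  measurable_fun [set: U] (fun w => \sum_(i <- s) h i w).
Proof.
elim: s => [_|i s IH mh].
  by under eq_fun do rewrite big_nil; exact: measurable_cst.
under eq_fun do rewrite big_cons.
apply: measurable_funD; first by apply: mh; rewrite mem_head.
by apply: IH => l ls; apply: mh; rewrite in_cons ls orbT.
Qed.

Lemma measurable_le_indicator (g h : U -> R) :
  measurable_fun [set: U] g -> measurable_fun [set: U] h ->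
  measurable_fun [set: U] (fun w => (g w <= h w)%R%:R : R).
Proof.
move=> mg mh.
have -> : (fun w => (g w <= h w)%R%:R : R) = \1_[set w | g w <= h w].
  apply/funext => w; rewrite indicE; suff -> : w \in [set w | g w <= h w] = (g w <= h w) by [].
  by apply/idP/idP => gh; [move: gh; rewrite inE|rewrite mem_set].
apply: measurable_indic.
have -> : [set w | g w <= h w] = setT `&` (h \- g) @^-1` `[0, +oo[.
  by apply/seteqP; split=> w /=; rewrite in_itv/= andbT subr_ge0// => -[].
by apply: measurable_funB.
Qed.

Lemma measurable_sqrt (g : U -> R) : measurable_fun [set: U] g ->
  measurable_fun [set: U] (fun w => Num.sqrt (g w)).
Proof.
move=> mg; apply: (measurableT_comp _ mg).
by apply: nondecreasing_measurable => // x y xy; exact: ler_wsqrtr.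
Qed.

(** On nonnegative numbers the inverse, with [0^-1 = 0], is the power of
    exponent [-1]. *)
Lemma measurable_inv_ge0 (g : U -> R) : measurable_fun [set: U] g ->
  (forall w, 0 <= g w) -> measurable_fun [set: U] (fun w => (g w)^-1).
Proof.
move=> mg g0.
have -> : (fun w => (g w)^-1) = (fun w => g w `^ (- 1)).
  by apply/funext => w; rewrite powR_inv1.
exact: (measurableT_comp (measurable_powR (-1)) mg).
Qed.

Section observations.
Variables (x : U -> nat -> R) (n k m : nat) (a varpi : R).
Hypotheses (k2 : (2 <= k)%N) (mk : (m <= k)%N).
Hypothesis mx : forall i, (i <= n)%N -> measurable_fun [set: U] (x^~ i).

Lemma incr_measurable i : (i <= n)%N -> measurable_fun [set: U] (fun w => incr (x w) i).
Proof.
by move=> ilen; apply: measurable_funB; apply: mx => //; exact: leq_trans (leq_pred i) _.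
Qed.

Lemma bipower_measurable i : (i <= n)%N ->
  measurable_fun [set: U] (fun w => bipower (x w) i).
Proof.
move=> ilen; apply: measurable_funM; apply: measurableT_comp => //;
  apply: incr_measurable => //.
exact: leq_trans (leq_pred i) _.
Qed.

Lemma local_var_measurable j : (j * k <= n)%N ->
  measurable_fun [set: U] (fun w => local_var (x w) n k j).
Proof.
move=> jn; under eq_fun do rewrite local_varE /block_mean.
do 3 (apply: measurable_funM => //).
apply: measurable_sum_mem => i; rewrite mem_index_iota => /andP[_ ij].
by apply: bipower_measurable; rewrite (leq_trans _ jn).
Qed.

Lemma adjacent_terms_measurable j i : (1 <= j)%N -> (j * k <= n)%N ->
  (block_start k j < i <= j * k)%N ->
  measurable_fun [set: U] (fun w => adjacent_terms (x w) k j i).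
Proof.
move=> j1 jn /andP[si ij].
have jk : (j * k = block_start k j + k)%N by rewrite /block_start -mulSnr prednK.
have b1 : measurable_fun [set: U] (fun w => bipower (x w) i).
  by apply: bipower_measurable; lia.
rewrite /adjacent_terms; case: (boolP (i == (block_start k j).+1)) => [/eqP ie|ne1].
  by apply: (@bipower_measurable i.+1); lia.
case: (boolP (i == (j * k)%N)) => [_|ne2]; first exact: b1.
by apply: measurable_funD; [exact: b1|apply: (@bipower_measurable i.+1); lia].
Qed.

Lemma local_var_without_measurable j i : (1 <= j)%N -> (j * k <= n)%N ->
  (block_start k j < i <= j * k)%N ->
  measurable_fun [set: U] (fun w => local_var_without (x w) n k j i).
Proof.
move=> j1 jn sij; apply: measurable_funB; apply: measurable_funM => //.
  exact: local_var_measurable.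
exact: adjacent_terms_measurable.
Qed.

Lemma untruncated_measurable j i : (j * k <= n)%N -> (i <= n)%N ->
  measurable_fun [set: U] (fun w => (untruncated (x w) n k a varpi j i)%:R : R).
Proof.
move=> jn ilen; apply: measurable_le_indicator.
  by apply: measurableT_comp => //; exact: incr_measurable.
do 2 (apply: measurable_funM => //).
exact/measurable_sqrt/local_var_measurable.
Qed.

Lemma empirical_cdf_measurable tau :
  measurable_fun [set: U] (fun w => empirical_cdf (x w) n k m a varpi tau).
Proof.
have mem p : p \in retained n k m -> [/\ (1 <= p.1)%N, (p.1 * k <= n)%N,
    (block_start k p.1 < p.2 <= p.1 * k)%N & (p.2 <= n)%N].
  case: p => j i /(mem_retained mk)[/andP[j1 _] si ij jn] /=.
  by rewrite si ij jn j1 (leq_trans ij jn).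
have mu_ p : p \in retained n k m ->
    measurable_fun [set: U] (fun w => (untruncated (x w) n k a varpi p.1 p.2)%:R : R).
  by move=> /mem[_ jn _ ilen]; exact: untruncated_measurable.
rewrite /empirical_cdf /untruncated_count; apply: measurable_funM.
  apply: measurable_inv_ge0 => [|w]; last by rewrite !sumr_ge0// => j _; exact: sumr_ge0.
  under eq_fun do rewrite (sum_retained n k m
    (fun j i => (untruncated (x _) n k a varpi j i)%:R)).
  exact: measurable_sum_mem.
under eq_fun do rewrite (sum_retained n k m (fun j i =>
  (Num.sqrt n%:R * incr (x _) i / Num.sqrt (local_var_without (x _) n k j i) <= tau)%R%:R *
  (untruncated (x _) n k a varpi j i)%:R)).
apply: measurable_sum_mem => p pr; have [j1 jn sij ilen] := mem p pr.
apply: measurable_funM; last exact: mu_.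
apply: measurable_le_indicator => //; apply: measurable_funM.
  by apply: measurable_funM => //; exact: incr_measurable.
apply: measurable_inv_ge0 => //.
exact/measurable_sqrt/local_var_without_measurable.
Qed.

Lemma empirical_cdf_cvg_right w tau :
  empirical_cdf (x w) n k m a varpi s @[s --> tau^'+] -->
  empirical_cdf (x w) n k m a varpi tau.
Proof.
rewrite /empirical_cdf; apply: cvgM; first exact: cvg_cst.
do 2 (apply: (cvg_big (op := +%R) (x0 := 0)) => [|? _]; first exact: add_continuous).
by apply: cvgM; [exact: cvg_at_right_le_indicator|exact: cvg_cst].
Qed.

Lemma empirical_cdf_bounded w tau :
  `|empirical_cdf (x w) n k m a varpi tau| <= (size (retained n k m))%:R *
    `|(untruncated_count (x w) n k m a varpi)^-1|.
Proof.
rewrite /empirical_cdf normrM mulrC ler_wpM2r//.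
rewrite (sum_retained n k m (fun j i =>
  (Num.sqrt n%:R * incr (x w) i / Num.sqrt (local_var_without (x w) n k j i) <= tau)%R%:R *
  (untruncated (x w) n k a varpi j i)%:R)).
apply: le_trans (ler_norm_sum _ _ _) _.
rewrite -sum1_size natr_sum; apply: ler_sum => p _.
by rewrite -natrM ger0_norm// lern1 -[1%N]/(1 * 1)%N leq_mul// leq_b1.
Qed.

End observations.
End statistic_measurability.

(** * Convergence for a signal with few jumps *)

Section convergence.
Context {R : realType} {d : measure_display} {U : measurableType d}.
Variables (Q : probability U R) (eps : nat -> nat -> {RV Q >-> R}).
Hypothesis eps_indep : forall n (B : nat -> set R), (forall i, measurable (B i)) ->
  Q (\bigcap_(i in [set i | (i <= n)%N]) eps n i @^-1` B i) =
  (\prod_(i < n.+1) Q (eps n i @^-1` B i))%E.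
Hypothesis eps_ident : forall n i n' i' (B : set R), (i <= n)%N -> (i' <= n')%N ->
  measurable B -> distribution Q (eps n i) B = distribution Q (eps n' i') B.
Hypothesis eps_integrable : forall n i, (i <= n)%N ->
  Q.-integrable [set: U] (EFin \o eps n i).
Hypothesis bipower_integrable :
  Q.-integrable [set: U] (EFin \o noise_bipower eps 2 2).
Variables (q a varpi mu : R) (k m : nat -> nat) (F : R -> R).
Hypotheses (q01 : 0 < q < 1) (prop_k : proportional_to_power k q).
Hypothesis mk : forall n, (1 <= m n <= k n)%N.
Hypotheses (a0 : 0 < a) (varpi12 : varpi < 1 / 2) (mu0 : 0 < mu).
Hypothesis muE : mu ^+ 2 = pi / 2 * \int[Q]_w noise_bipower eps 2 2 w.
Hypothesis F_def : forall n i t, (1 <= i <= n)%N ->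
  Q [set w | mu^-1 * incr (noise eps n w) i <= t] = (F t)%:E.
Hypothesis F_continuous : continuous F.

Local Notation Integrable f := (Q.-integrable [set: U] (EFin \o f)).
Local Notation noise := (noise eps).

Definition noise_ecdf n (t : R) (w : U) : R :=
  mean_over (retained n (k n) (m n)) (fun p => (mu^-1 * incr (noise n w) p.2 <= t)%R%:R).

Lemma near_retained_size (K : nat) :
  \forall n \near \oo, (K <= size (retained n (k n) (m n)))%N.
Proof.
have near_B := near_block_number_ge K q01 prop_k.
near=> n; rewrite size_retained.
have KB : (K <= n %/ k n)%N by near: n.
by apply: leq_trans KB _; rewrite leq_pmulr//; case/andP: (mk n).
Unshelve. all: by end_near. Qed.

(** The increments of the noise are identically distributed, and independent as
    soon as their indices differ by 3 or more. *)
Lemma near_noise_ecdf t (z : R) : 0 < z -> \forall n \near \oo,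
  Integrable (fun w => `|noise_ecdf n t w - F t|) /\
  \int[Q]_w `|noise_ecdf n t w - F t| <= z.
Proof.
move=> z0; pose lambda := z / 2; have l0 : 0 < lambda by rewrite divr_gt0.
have near_s := near_retained_size (Num.truncn (5 / lambda ^+ 2)).+1.
near=> n.
have sn : ((Num.truncn (5 / lambda ^+ 2)).+1 <= size (retained n (k n) (m n)))%N by near: n.
have /andP[_ mkn] := mk n.
pose B := [set x : R | mu^-1 * x <= t].
have mB : measurable B.
  have -> : B = setT `&` ( *%R mu^-1) @^-1` `]-oo, t].
    by apply/seteqP; split=> x /=; rewrite in_itv/= // => -[].
  exact: mulrl_measurable.
pose E i := (fun w => incr (noise n w) i) @^-1` B.
have mE i : measurable (E i).
  by rewrite -[X in measurable X]setTI; exact: incr_noise_measurable.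
pose s := unzip2 (retained n (k n) (m n)).
have ecdfE w : noise_ecdf n t w = mean_over s (fun i => \1_(E i) w).
  rewrite mean_over_map; congr (_ * _); apply: eq_bigr => p _ /=.
  rewrite indicE; suff -> : w \in E p.2 = (mu^-1 * incr (noise n w) p.2 <= t) by [].
  by apply/idP/idP => h; [move: h; rewrite inE|rewrite mem_set].
have mem i : i \in s -> (1 <= i <= n)%N.
  case/mapP => -[j l] /(mem_retained mkn)[_ sl lj jn] -> /=.
  by rewrite (leq_trans lj jn) andbT (leq_trans _ sl).
have QE i : i \in s -> Q (E i) = (F t)%:E by move=> /mem /F_def; exact.
split.
  apply: integrable_norm; under eq_fun do rewrite ecdfE.
  apply: integrableDr; last exact: integrable_cst.
  by apply: integrable_mean_over => i _; exact: integrable_indicator.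
under eq_Rintegral do rewrite ecdfE.
have -> : z = 2 * lambda by rewrite /lambda; field.
apply: indicator_lln => //.
- rewrite size_map -ler_pdivrMl ?exprn_gt0// mulrC.
  by rewrite (le_trans (ltW (truncnS_gt _)))// ler_nat.
- exact: uniq_retained.
- move=> i l si sl il; rewrite noise_increment_indep//.
  + by rewrite [X in (X * _)%E](QE i si) [X in (_ * X)%E](QE l sl).
  + exact: mem.
  + by case/andP: (mem _ sl).
Unshelve. all: by end_near. Qed.

Variable f : nat -> U -> nat -> R.
Hypothesis f_measurable : forall n i, (i <= n)%N -> measurable_fun [set: U] (fun w => f n w i).
Hypothesis f_jumps : forall delta eta z : R, 0 < delta -> 0 < eta -> 0 < z ->
  \forall n \near \oo,
    (Q [set w | (eta * (n %/ k n)%:R < jump_count (f n w) delta n)%R] <= z%:E)%E.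

Let x n w l := f n w l + noise n w l.

Lemma x_measurable n i : (i <= n)%N -> measurable_fun [set: U] (fun w => x n w i).
Proof. by move=> ilen; apply: measurable_funD => //; exact: f_measurable. Qed.

Lemma jump_event_measurable (delta c : R) n :
  measurable [set w | c < jump_count (f n w) delta n].
Proof.
have mJ : measurable_fun [set: U] (fun w => jump_count (f n w) delta n).
  apply: measurable_sum_mem => l; rewrite mem_index_iota ltnS => /andP[l1 ln].
  have -> : (fun w => (delta < `|incr (f n w) l|)%R%:R : R) =
            (fun w => 1 - (`|incr (f n w) l| <= delta)%R%:R).
    by apply/funext => w; rewrite ltNge; case: (_ <= _); rewrite ?subrr ?subr0.
  apply: measurable_funB => //; apply: measurable_le_indicator => //.
  apply: measurableT_comp => //.
  by apply: (@incr_measurable _ _ _ (f n) n) => // i; exact: f_measurable.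
have -> : [set w | c < jump_count (f n w) delta n] =
    setT `&` (fun w => jump_count (f n w) delta n) @^-1` `]c, +oo[.
  by apply/seteqP; split=> w /=; rewrite in_itv/= andbT // => -[].
exact: mJ.
Qed.

Let ecdf_error n t w := `|empirical_cdf (x n w) n (k n) (m n) a varpi t - F t|.

Lemma F_norm_le1 t : `|F t| <= 1.
Proof.
have := @F_def 1%N 1%N t isT => FE.
have mS : measurable [set w | mu^-1 * incr (noise 1 w) 1 <= t].
  have -> : [set w | mu^-1 * incr (noise 1 w) 1 <= t] =
      setT `&` (fun w => mu^-1 * incr (noise 1 w) 1) @^-1` `]-oo, t].
    by apply/seteqP; split=> w /=; rewrite in_itv/= // => -[].
  by apply: measurable_funM => //; exact: incr_noise_measurable.
have F0 : 0 <= F t by rewrite -lee_fin -FE.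
by rewrite ger0_norm// -lee_fin -FE probability_le1.
Qed.

Lemma near_sup_event_measurable (A : set R) (e : R) : 0 <= e ->
  \forall n \near \oo, measurable [set w | e < sup [set ecdf_error n t w | t in A]].
Proof.
move=> e0; have q0 : 0 < q by case/andP: q01.
have near_k := near_block_length_ge 2 q0 prop_k.
near=> n; have k2 : (2 <= k n)%N by near: n.
have /andP[_ mkn] := mk n.
apply: measurable_sup_gt => //.
- move=> t.
  have -> : [set w | e < ecdf_error n t w] = setT `&` ecdf_error n t @^-1` `]e, +oo[.
    by apply/seteqP; split=> w /=; rewrite in_itv/= andbT // => -[].
  have mG := empirical_cdf_measurable a varpi k2 mkn (@x_measurable n) t.
  have me : measurable_fun [set: U] (ecdf_error n t).
    by apply: measurableT_comp => //; exact: measurable_funB.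
  exact: me.
- move=> w t; apply: cvg_norm; apply: cvgB; first exact: empirical_cdf_cvg_right.
  by apply: cvg_at_right_filter; exact: F_continuous.
- move=> w; exists ((size (retained n (k n) (m n)))%:R *
    `|(untruncated_count (x n w) n (k n) (m n) a varpi)^-1| + 1) => _ [t _ <-].
  apply: le_trans (ler_normB _ _) _.
  by apply: lerD; [exact: empirical_cdf_bounded|exact: F_norm_le1].
Unshelve. all: by end_near. Qed.

Lemma near_all_mem (I : eqType) (s : seq I) (P : I -> nat -> Prop) :
  (forall i, \forall n \near \oo, P i n) ->
  \forall n \near \oo, forall i, i \in s -> P i n.
Proof.
move=> HP; elim: s => [|i s IH]; first by apply: nearW => n i; rewrite in_nil.
apply: filterS2 (HP i) IH => n Pi Ps l; rewrite in_cons => /predU1P[->//|].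
exact: Ps.
Qed.

Lemma ereal_cvg0 (u : nat -> \bar R) : (forall n, (0 <= u n)%E) ->
  (forall z : R, 0 < z -> \forall n \near \oo, (u n <= z%:E)%E) ->
  u n @[n --> \oo] --> 0%E.
Proof.
move=> u0 uz; apply/fine_cvgP; split.
  apply: filterS (uz 1 ltr01) => n un1.
  by rewrite ge0_fin_numE// (le_lt_trans un1)// ltry.
apply/cvgr0Pnorm_le => z z0; apply: filterS (uz z z0) => n unz /=.
rewrite ger0_norm ?fine_ge0// -lee_fin fineK//.
by rewrite ge0_fin_numE// (le_lt_trans unz)// ltry.
Qed.

(** The error budget is [e / 4] for each of the continuity modulus and of the noise
    distribution function, and twice [e / 16 + e / 16] for the exceptional
    indices. *)
Lemma ecdf_error_le (eta delta rho M e t t1 t2 : R) n w :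
  (0 < n)%N -> (4 <= k n)%N -> (0 < n %/ k n)%N -> 0 < eta -> 0 <= delta <= 1 ->
  8 * eta <= mu ^+ 2 -> 2 * (mu ^+ 2 + 2 * eta) <= eta * ((k n)%:R - 3) ->
  M * (4 * eta / mu) + delta <= rho * mu -> `|t| <= M ->
  t1 <= t - rho /\ t + rho <= t2 -> `|F t1 - F t| <= e / 4 -> `|F t2 - F t| <= e / 4 ->
  `|noise_ecdf n t1 w - F t1| <= e / 4 -> `|noise_ecdf n t2 w - F t2| <= e / 4 ->
  mean_badness mu eta delta a varpi n (k n) (m n) (noise n w) <= e / 16 ->
  jump_count (f n w) delta n <= e / 16 * (n %/ k n)%:R ->
  ecdf_error n t w <= e.
Proof.
move=> n0 k4 B0 eta0 d01 eta_small k_large err tM [t1t tt2] F1 F2 H1 H2 b16 J16.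
have /andP[m1 mkn] := mk n.
have [lower upper] := empirical_cdf_sandwich (f n w) (noise n w) varpi n0 k4 m1 mkn a0 mu0
  eta0 d01 eta_small k_large err tM.
have JB : jump_count (f n w) delta n / (n %/ k n)%:R <= e / 16.
  by rewrite ler_pdivrMr ?ltr0n.
have mono (u v : R) : u <= v -> noise_ecdf n u w <= noise_ecdf n v w.
  move=> uv; apply: mean_over_le => p _; rewrite ler_nat.
  by case: leP => // pu; rewrite (le_trans pu uv).
have mono1 := mono _ _ t1t; have mono2 := mono _ _ tt2.
move: lower upper; rewrite -/(noise_ecdf n (t - rho) w) -/(noise_ecdf n (t + rho) w).
rewrite -/(x n w) /ecdf_error => lower upper.
move: F1 F2 H1 H2; rewrite !ler_norml => /andP[? ?] /andP[? ?] /andP[? ?] /andP[? ?].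
by apply/andP; split; lra.
Qed.

(** Outside the event that the signal has many jumps, a deviation larger than
    [e] forces [W >= 1], where [W] adds up the mean badness and the errors of the
    noise distribution function on the net, each divided by its share of [e].
    So a single application of Markov's inequality to [W] suffices. *)
Theorem sup_ecdf_error_cvg (A : set R) (e : R) : compact A -> 0 < e ->
  Q [set w | e < sup [set ecdf_error n t w | t in A]] @[n --> \oo] --> 0%E.
Proof.
move=> cA e0; apply: ereal_cvg0 => // z z0.
have e4 : 0 < e / 4 by rewrite divr_gt0.
have [rho [s [rho0 net]]] := finite_net cA F_continuous e4.
have [M M0 AM] : exists2 M : R, 0 <= M & forall t, A t -> `|t| <= M.
  have [M [_ HM]] := compact_bounded cA; exists (`|M| + 1); first by rewrite addr_ge0.
  by move=> t At; apply: (HM (`|M| + 1)) => //; rewrite ltr_pwDr// ler_norm.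
have M1 : 0 < M + 1 by rewrite ltr_wpDl.
have ie4 : 0 <= 4 / e by rewrite divr_ge0// ltW.
have ie16 : 0 <= 16 / e by rewrite divr_ge0// ltW.
have mu20 : 0 < mu ^+ 2 by rewrite exprn_gt0.
(* The two bounds on [eta] are those required by [studentized_le], half of
   [rho * mu] being left to [delta]. *)
pose eta := Num.min (mu ^+ 2 / 8) (rho * mu ^+ 2 / (8 * (M + 1))).
have eta0 : 0 < eta by rewrite lt_min !divr_gt0 ?mulr_gt0.
have eta8 : 8 * eta <= mu ^+ 2.
  by rewrite -ler_pdivlMl// mulrC ge_min lexx.
have etaM : M * (4 * eta / mu) <= rho * mu / 2.
  have : eta <= rho * mu ^+ 2 / (8 * (M + 1)) by rewrite ge_min lexx orbT.
  rewrite ler_pdivlMr ?mulr_gt0// => etaM.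
  rewrite mulrA ler_pdivrMr// (_ : rho * mu / 2 * mu = rho * mu ^+ 2 / 2); last by ring.
  by have := mulr_ge0 M0 (ltW eta0); lra.
have zeta0 : 0 < z * e / 48 by rewrite divr_gt0// mulr_gt0.
have [delta0 [/andP[delta00 delta01] near_b]] := near_mean_badness eps_indep eps_ident
  eps_integrable bipower_integrable muE mu0 eta0 a0 varpi12 zeta0 q01 prop_k mk.
pose delta := Num.min delta0 (rho * mu / 2).
have delta_gt0 : 0 < delta by rewrite lt_min delta00 divr_gt0// mulr_gt0.
have delta_le : delta <= delta0 by rewrite ge_min lexx.
have delta_le2 : delta <= rho * mu / 2 by rewrite ge_min lexx orbT.
have err : M * (4 * eta / mu) + delta <= rho * mu by lra.
have d01 : 0 <= delta <= 1 by rewrite ltW//= (le_trans delta_le).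
pose zs := z * e / (12 * ((size s)%:R + 1)).
have zs0 : 0 < zs by rewrite divr_gt0 ?mulr_gt0 ?ltr_wpDl.
have near_H := near_all_mem s (fun t => near_noise_ecdf t zs0).
have e16 : 0 < e / 16 by rewrite divr_gt0.
have z3 : 0 < z / 3 by rewrite divr_gt0.
have near_J := f_jumps delta_gt0 e16 z3.
have near_meas := near_sup_event_measurable A (ltW e0).
have {}near_b := near_b delta _.
have q0 : 0 < q by case/andP: q01.
have near_k := near_block_length_ge
  (Num.truncn (2 * (mu ^+ 2 + 2 * eta) / eta) + 4) q0 prop_k.
have near_B := near_block_number_ge 1 q01 prop_k.
have {}near_b : \forall n \near \oo,
    Integrable (fun w => mean_badness mu eta delta a varpi n (k n) (m n) (noise n w)) /\
    \int[Q]_w mean_badness mu eta delta a varpi n (k n) (m n) (noise n w) <= z * e / 48.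
  by apply: near_b; rewrite delta_gt0.
near=> n.
have kn : (Num.truncn (2 * (mu ^+ 2 + 2 * eta) / eta) + 4 <= k n)%N by near: n.
have k4 : (4 <= k n)%N by exact: leq_trans (leq_addl _ _) kn.
have k_large : 2 * (mu ^+ 2 + 2 * eta) <= eta * ((k n)%:R - 3).
  rewrite -ler_pdivrMl// mulrC (le_trans (ltW (truncnS_gt _)))// lerBrDr -natrD ler_nat.
  by rewrite addSnnS.
have B1 : (0 < n %/ k n)%N by near: n.
have n0 : (0 < n)%N by move: B1; case: (n) => //; rewrite div0n.
have [intb Eb] :
    Integrable (fun w => mean_badness mu eta delta a varpi n (k n) (m n) (noise n w)) /\
    \int[Q]_w mean_badness mu eta delta a varpi n (k n) (m n) (noise n w) <= z * e / 48.
  by near: n.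
have HH : forall t, t \in s -> Integrable (fun w => `|noise_ecdf n t w - F t|) /\
    \int[Q]_w `|noise_ecdf n t w - F t| <= zs by near: n.
have QJ : (Q [set w | (e / 16 * (n %/ k n)%:R < jump_count (f n w) delta n)%R] <=
    (z / 3)%:E)%E.
  by near: n.
have mE : measurable [set w | e < sup [set ecdf_error n t w | t in A]] by near: n.
pose b w := mean_badness mu eta delta a varpi n (k n) (m n) (noise n w).
have b_ge0 w : 0 <= b w.
  rewrite mulr_ge0 ?invr_ge0 ?sumr_ge0// => p _.
  have [? ? ? ?] := badness_terms_ge0 (noise n w) varpi n0 k4 a0 mu0 eta0 d01 p.1 p.2.
  by rewrite !addr_ge0.
pose W w := 16 / e * b w + \sum_(t <- s) 4 / e * `|noise_ecdf n t w - F t|.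
have intS : Integrable (fun w => \sum_(t <- s) 4 / e * `|noise_ecdf n t w - F t|).
  by apply: integrable_sumr => t ts; apply: integrableZr; exact: (HH t ts).1.
have intW : Integrable W by apply: integrableDr => //; exact: integrableZr.
have EW : \int[Q]_w W w <= 2 * (z / 3).
  have int1 := integrableZr (16 / e) intb.
  rewrite (RintegralD measurableT int1 intS) (RintegralZl _ measurableT intb).
  rewrite Rintegral_sumr; last by move=> t ts; apply: integrableZr; exact: (HH t ts).1.
  (* The last summand is slack: it comes from the 1 added to [size s] in [zs]. *)
  have -> : 2 * (z / 3) = 16 / e * (z * e / 48) + (size s)%:R * (4 / e * zs) +
      4 / e * zs.
    by rewrite /zs; field; rewrite gt_eqF//= gt_eqF// ltr_wpDl.
  rewrite -[leLHS]addr0; apply: lerD; last by rewrite mulr_ge0 ?(ltW zs0).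
  apply: lerD; first by rewrite ler_wpM2l.
  apply: (@le_trans _ _ (\sum_(t <- s) (4 / e * zs))).
    rewrite big_seq [leRHS]big_seq; apply: ler_sum => t ts.
    by rewrite (RintegralZl _ measurableT (HH t ts).1) ler_wpM2l// (HH t ts).2.
  by rewrite big_const_seq count_predT iter_addr addr0 [leRHS]mulr_natl.
have W0 w : 0 <= W w.
  by rewrite addr_ge0// ?sumr_ge0// => [|t _]; rewrite mulr_ge0.
have QW := markov_inequality intW W0 ltr01.
have mW : measurable [set w | 1 <= W w].
  by apply: superlevel_measurable; apply/measurable_EFinP; exact: measurable_int intW.
have mJ := jump_event_measurable delta (e / 16 * (n %/ k n)%:R) n.
have sub : [set w | e < sup [set ecdf_error n t w | t in A]] `<=`
    [set w | 1 <= W w] `|` [set w | e / 16 * (n %/ k n)%:R < jump_count (f n w) delta n].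
  move=> w /= ew; have [W1|W1] := leP 1 (W w); first by left.
  right; rewrite ltNge; apply/negP => J16; move: ew; rewrite ltNge => /negP; apply.
  have S0 : 0 <= \sum_(t <- s) 4 / e * `|noise_ecdf n t w - F t|.
    by rewrite sumr_ge0// => t _; rewrite mulr_ge0.
  have b16 : b w <= e / 16.
    have : 16 / e * b w <= 1.
      by apply: le_trans (ltW W1); rewrite lerDl.
    by rewrite mulrAC ler_pdivrMr// mul1r -ler_pdivlMl// mulrC.
  have H4 t : t \in s -> `|noise_ecdf n t w - F t| <= e / 4.
    move=> ts; have : 4 / e * `|noise_ecdf n t w - F t| <= 1.
      apply: le_trans (ltW W1).
      apply: (@le_trans _ _ (\sum_(t <- s) 4 / e * `|noise_ecdf n t w - F t|)).
        by rewrite (big_rem t)//= lerDl sumr_ge0// => u _; rewrite mulr_ge0.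
      by rewrite /W lerDr mulr_ge0.
    by rewrite mulrAC ler_pdivrMr// mul1r -ler_pdivlMl// mulrC.
  have error_le t : A t -> ecdf_error n t w <= e.
    move=> At; have [t1 [t2 [t1s t2s tt F1 F2]]] := net t At.
    by apply: (@ecdf_error_le eta delta rho M e t t1 t2) => //;
      [exact: AM|exact: H4|exact: H4].
  have [[t At]|noA] := pselect (A !=set0).
    apply: ge_sup; first by exists (ecdf_error n t w), t.
    by move=> _ [u Au <-]; exact: error_le.
  rewrite (_ : [set _ | _ in _] = set0) ?sup0 ?(ltW e0)//.
  by rewrite -subset0 => y [t At _]; apply: noA; exists t.
apply: (le_trans (le_measure Q _ _ sub)); rewrite ?inE//; first exact: measurableU.
apply: (le_trans (measureU2 _ mW mJ)).
have -> : z%:E = ((2 * (z / 3))%:E + (z / 3)%:E)%E by rewrite -EFinD; congr EFin; field.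
apply: leeD => //; apply: (le_trans QW); rewrite lee_fin invr1 mul1r; exact: EW.
Unshelve. all: by end_near. Qed.

End convergence.

(** * Jumps of a sampled regulated path *)

Section signal_jumps.
Context {R : realType} {d : measure_display} {T : measurableType d}.
Variables (P : probability T R) (X : R -> T -> R).
Hypothesis X_measurable : forall t : R, 0 <= t <= 1 -> measurable_fun [set: T] (X t).
Hypothesis X_regulated : {ae P, forall w, regulated (fun t => X t w)}.

Definition sampled n (w : T) (l : nat) : R := X (l%:R / n%:R) w.

Lemma sampled_measurable n i : (i <= n)%N ->
  measurable_fun [set: T] (fun w => sampled n w i).
Proof.
move=> ilen; apply: X_measurable; rewrite divr_ge0//=.
case: n ilen => [|n ilen]; first by rewrite invr0 mulr0.
by rewrite ler_pdivrMr// mul1r ler_nat.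
Qed.

Lemma jump_count_sampled delta n w : jump_count (sampled n w) delta n =
  (large_increments (fun t => X t w) delta n)%:R.
Proof. by rewrite /large_increments natr_sum. Qed.

(** On each regulated path the number of large increments is bounded, so the
    indicator functions of these events vanish eventually and dominated
    convergence applies. *)
Lemma near_few_jumps (q : R) (k : nat -> nat) (delta eta z : R) :
  0 < q < 1 -> proportional_to_power k q -> 0 < delta -> 0 < eta -> 0 < z ->
  \forall n \near \oo,
    (P [set w | (eta * (n %/ k n)%:R < jump_count (sampled n w) delta n)%R] <= z%:E)%E.
Proof.
move=> q01 prop_k d0 eta0 z0.
pose N n := [set w | (eta * (n %/ k n)%:R < jump_count (sampled n w) delta n)%R].
have mN n : measurable (N n).
  by apply: jump_event_measurable => *; exact: sampled_measurable.
have ae_cvg : {ae P, forall w, [set: T] w ->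
      ((\1_(N n) w : R)%:E) @[n --> \oo] --> (0 : \bar R)%E}.
  move: X_regulated; apply: filterS => w regw _.
  have [C HC] := regulated_large_increments regw d0.
  have near_B := near_block_number_ge (Num.truncn (C%:R / eta)).+1 q01 prop_k.
  apply: cvg_near_cst; near=> n.
  rewrite indicE memNset//= /N/= jump_count_sampled; apply/negP; rewrite -leNgt.
  apply: (@le_trans _ _ C%:R); first by rewrite ler_nat.
  rewrite -ler_pdivrMl// mulrC (le_trans (ltW (truncnS_gt _)))// ler_nat.
  by near: n.
have mN1 n : measurable_fun [set: T] (fun w => (\1_(N n) w : R)%:E).
  exact/measurable_EFinP/measurable_indic.
have le1 : {ae P, forall w, forall n, [set: T] w ->
    (`|(\1_(N n) w : R)%:E| <= (cst 1 w : R)%:E)%E}.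
  by apply: aeW => w n _; rewrite /= lee_fin ger0_norm// indicE lern1 leq_b1.
have [_ _ cvgN] := dominated_convergence measurableT mN1 (measurable_cst _) ae_cvg
  (finite_measure_integrable_cst P 1 measurableT) le1.
have : \forall n \near \oo, ((\int[P]_w (\1_(N n) w : R)%:E) < z%:E)%E.
  apply: (cvgN (fun y => y < z%:E)%E); rewrite integral0.
  by apply: open_ereal_lt'; rewrite lte_fin.
apply: filterS => n; rewrite integral_indic// setIT; exact: ltW.
Unshelve. all: by end_near. Qed.

End signal_jumps.

(** * Positivity of the scale and the main theorem *)

Section noise_moments.
Context {R : realType} {d : measure_display} {U : measurableType d}.
Variables (Q : probability U R) (eps : nat -> nat -> {RV Q >-> R}).

(** [|x| <= 1 + |x|^(1 + iota)]. *)
Lemma integrable_of_moment (X : {RV Q >-> R}) (iota : R) : 0 < iota ->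
  ('E_Q[fun w => (`|X w| `^ (1 + iota))%R] < +oo)%E ->
  Q.-integrable [set: U] (EFin \o X).
Proof.
move=> iota0; rewrite unlock => mom.
have mp : measurable_fun [set: U] (fun w => `|X w| `^ (1 + iota)).
  by apply: (measurableT_comp (measurable_powR (1 + iota))); apply: measurableT_comp.
have intp : Q.-integrable [set: U] (EFin \o (fun w => `|X w| `^ (1 + iota))).
  apply/integrableP; split; first exact/measurable_EFinP.
  apply: le_lt_trans mom; rewrite le_eqVlt; apply/orP; left; apply/eqP.
  by apply: eq_integral => w _ /=; rewrite ger0_norm// powR_ge0.
apply: (le_integrable measurableT _ _ (integrableDr (integrable_cst Q 1) intp)).
  exact/measurable_EFinP.
move=> w _ /=; rewrite lee_fin [leRHS]ger0_norm ?addr_ge0 ?powR_ge0//.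
have [X1|X1] := leP `|X w| 1; first by rewrite (le_trans X1)// lerDl powR_ge0.
rewrite -[leLHS]powRr1// (le_trans (_ : _ <= `|X w| `^ (1 + iota)))//; last by rewrite lerDr.
by rewrite ler_powR ?(ltW X1)// lerDl ltW.
Qed.

(** If [mu] is 0, so is [mu^-1], and [F] jumps from 0 to 1 at the origin. *)
Lemma scale_neq0 (mu : R) (F : R -> R) : continuous F ->
  (forall t, (F t)%:E = Q [set w | mu^-1 * (eps 1 1 w - eps 1 0 w) <= t]) -> mu != 0.
Proof.
move=> cF FE; apply/eqP => mu0; move: FE; rewrite mu0 invr0 => FE.
have F0 : F 0 = 1.
  apply: EFin_inj; rewrite FE (_ : [set _ | _] = setT) ?probability_setT//.
  by apply/seteqP; split=> // w _ /=; rewrite mul0r.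
have Fneg t : t < 0 -> F t = 0.
  move=> t0; apply: EFin_inj; rewrite FE (_ : [set _ | _] = set0) ?measure0//.
  by rewrite -subset0 => w /=; rewrite mul0r leNgt t0.
have /cvgrPdist_lt/(_ _ ltr01) := cF 0.
move=> /nbhs_ballP[r /= r0 /(_ (- (r / 2)))].
have r20 : 0 < r / 2 by rewrite divr_gt0.
rewrite /ball/= sub0r opprK gtr0_norm// ltr_pdivrMr// ltr_pMr// ltr1n => /(_ isT).
by rewrite F0 Fneg ?oppr_lt0// subr0 normr1 ltxx.
Qed.

End noise_moments.

Theorem theorem2
  (R : realType) (d d' : measure_display)
  (T : measurableType d) (T' : measurableType d')
  (P : probability T R) (P' : probability T' R)
  (F : R -> set (set T)) (X alpha sigma S Y : R -> T -> R)
  (beta gamma c : R)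
  (q : R) (k m : nat -> nat) (a varpi : R)
  (eps : nat -> nat -> {RV (P \x P')%E >-> R})
  (mu : R) (Feps : R -> R)
  (F_filtration : filtration F)
  (X_process : forall t : R, 0 <= t <= 1 -> measurable_fun [set: T] (X t))
  (alpha_adapted : adapted F alpha) (alpha_cadlag : cadlag_paths alpha)
  (sigma_adapted : adapted F sigma) (sigma_cadlag : cadlag_paths sigma)
  (S_stable : stable_levy_process P F beta gamma c S)
  (Y_pure_jump : pure_jump_ito_semimartingale P F Y)
  (X_dynamics : jump_diffusion P F X alpha sigma S Y)
  (A1 : assumption_A1 P F sigma)
  (A2 : assumption_A2 P F beta Y)
  (q_range : 0 < q < 1)
  (k_rate : proportional_to_power k q)
  (m_infty : m n @[n --> \oo] --> \oo)
  (m_range : forall n, (1 <= m n <= k n)%N)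
  (a_gt0 : 0 < a) (varpi_range : 0 < varpi < 1 / 2)
  (eps_iid : noise_iid eps)
  (eps_indep : noise_independent_of_base eps)
  (eps_moment : exists2 iota : R, 0 < iota & forall n i, (i <= n)%N ->
     ('E_(P \x P')[fun w => (`|eps n i w| `^ (1 + iota))%R] < +oo)%E)
  (mu_def : forall n i, (2 <= i <= n)%N ->
     mu = Num.sqrt (pi / 2) *
          Num.sqrt (fine ('E_(P \x P')[fun w =>
            (`|eps n i w - eps n i.-1 w| *
             `|eps n i.-1 w - eps n i.-2 w|)%R])%E))
  (Feps_def : forall n i tau, (1 <= i <= n)%N ->
     (Feps tau)%:E =
     (P \x P')%E [set w | mu^-1 * (eps n i w - eps n i.-1 w) <= tau])
  (Feps_continuous : continuous Feps) :
  forall A : set R, compact A -> forall e : R, 0 < e ->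
    (P \x P')%E [set w | e < sup [set
        `|empirical_cdf (noisy_obs eps X n w) n (k n) (m n) a varpi tau
          - Feps tau| | tau in A] ] @[n --> \oo] --> 0%E.
Proof.
pose Q : probability (T * T')%type R := (P \x P')%E.
have eps_integrable n i : (i <= n)%N -> Q.-integrable [set: T * T'] (EFin \o eps n i).
  have [iota iota0 mom] := eps_moment.
  by move=> ilen; exact: integrable_of_moment iota0 (mom n i ilen).
have mu_neq0 : mu != 0.
  by apply: (scale_neq0 (eps := eps) Feps_continuous) => t; exact: Feps_def.
have muE := mu_def 2%N 2%N isT.
pose E2 := ('E_Q[fun w => (`|eps 2 2 w - eps 2 1 w| * `|eps 2 1 w - eps 2 0 w|)%R])%E.
have E2E : E2 = (\int[Q]_w (noise_bipower eps 2 2 w)%:E)%E.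
  rewrite /E2 unlock; apply: eq_integral => w _.
  by rewrite /noise_bipower /bipower mulrC.
have bip_ge0 w : 0 <= noise_bipower eps 2 2 w by rewrite mulr_ge0.
have E20 : (0 <= E2)%E by rewrite E2E integral_ge0// => w _; rewrite lee_fin.
have E2fin : (E2 < +oo)%E.
  rewrite ltey; apply/eqP => E2oo; move/eqP: mu_neq0; apply.
  by rewrite muE -/E2 E2oo/= sqrtr0 mulr0.
have bip_int : Q.-integrable [set: T * T'] (EFin \o noise_bipower eps 2 2).
  apply/integrableP; split; first exact/measurable_EFinP/noise_bipower_measurable.
  apply: le_lt_trans E2fin; rewrite E2E le_eqVlt; apply/orP; left; apply/eqP.
  by apply: eq_integral => w _ /=; rewrite ger0_norm.
have mu0 : 0 < mu by rewrite lt_def mu_neq0 muE mulr_ge0 ?sqrtr_ge0.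
have mu2 : mu ^+ 2 = pi / 2 * \int[Q]_w noise_bipower eps 2 2 w.
  rewrite muE exprMn !sqr_sqrtr ?divr_ge0 ?pi_ge0 ?fine_ge0//.
  by rewrite -/E2 E2E.
have [eps_indep1 eps_ident] := eps_iid.
have X_regulated := jump_diffusion_regulated alpha_cadlag Y_pure_jump X_dynamics.
pose f n (w : T * T') l := sampled X n w.1 l.
have f_measurable n i : (i <= n)%N -> measurable_fun [set: T * T'] (fun w => f n w i).
  by move=> ilen; apply: (measurableT_comp (sampled_measurable X_process ilen)).
have f_jumps (delta eta z : R) : 0 < delta -> 0 < eta -> 0 < z -> \forall n \near \oo,
    (Q [set w | (eta * (n %/ k n)%:R < jump_count (f n w) delta n)%R] <= z%:E)%E.
  move=> delta0 eta0 z0.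
  have := near_few_jumps X_process X_regulated q_range k_rate delta0 eta0 z0.
  apply: filterS => n; apply: le_trans.
  set N := [set w : T | _].
  have mN : measurable N by apply: jump_event_measurable => *; exact: sampled_measurable.
  have -> : [set w : T * T' | eta * (n %/ k n)%:R < jump_count (f n w) delta n] =
      N `*` [set: T'] by apply/seteqP; split=> w //= -[].
  by rewrite /Q/= product_measure1E// [X in (_ * X)%E](probability_setT P') mule1.
have varpi12 : varpi < 1 / 2 by case/andP: varpi_range.
move=> A cA e e0.
have F_def n i t : (1 <= i <= n)%N ->
    Q [set w | mu^-1 * incr (noise eps n w) i <= t] = (Feps t)%:E.
  by move=> i1; rewrite (Feps_def n i t i1).
exact: (sup_ecdf_error_cvg eps_indep1 eps_ident eps_integrable bip_int
  q_range k_rate m_range a_gt0 varpi12 mu0 mu2 F_def Feps_continuous f_measurable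
  f_jumps cA e0).
Qed.
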